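(* Assume (A) and (B) below. Then for any measurable base prediction $f:\mathbb R^p\times[K]\to\mathbb R$, any $\sigma\in(0,1)$ and any $q\in[1,\infty)$, the post-processed predictor $\hat\Pi(f)$ satisfies $$\mathbf E\big\|\hat\Pi(f)-f^*_0\big\|_q\le C\Big(\|f-f^*\|_q+\min\Big\{\|f-f^*\|_{q-1}^{1-1/q}+\sigma^{1-1/q},\ \|f-f^*\|_\infty+\sigma\Big\}\mathbf 1\{q>1\}+\sum_{s=1}^Kw_sN_s^{-1/2}+\Big\{\sum_{s=1}^Kw_sN_s^{-q/2}\Big\}^{1/q}+\sigma\Big),$$ where $C>0$ depends only on $(\underline\lambda_s)_s$, $(\overline\lambda_s)_s$ and $q$.
   Context: Let $(\boldsymbol X,S,Y)$ have a joint distribution on $\mathbb R^p\times[K]\times\mathbb R$ with $\mathbb P(S=s)>0$; $f^*(\boldsymbol x,s)=\mathbb E[Y\mid\boldsymbol X=\boldsymbol x,S=s]$; $\boldsymbol w\in\Delta^{K-1}$; $\nu^*_s=\mathrm{Law}(f^*(\boldsymbol X,S)\mid S=s)$; $F_\mu$ a CDF and $F^{-1}_\mu(u)=\inf\{x:F_\mu(x)\ge u\}$. $f^*_0(\boldsymbol x,s)=\sum_{s'}w_{s'}F^{-1}_{\nu^*_{s'}}\circ F_{\nu^*_s}\circ f^*(\boldsymbol x,s)$. (A): each $\nu^*_s$ is non-atomic with finite second moment. (B): each $\nu^*_s$ is supported on an interval and has a Lebesgue density bounded below by $\underline\lambda_s>0$ and above by $\overline\lambda_s>0$ there. Norms: $\|g\|_r^r=\sum_sw_s\mathbb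 E[|g(\boldsymbol X,S)|^r\mid S=s]$ for $r>0$, and $\|g\|_\infty=\sum_sw_s\inf\{b:\mathbb P(|g(\boldsymbol X,S)|>b\mid S=s)=0\}$. Construction of $\hat\Pi(f)$: for each $s$, $\boldsymbol X^s_1,\dots,\boldsymbol X^s_{2N_s}$ i.i.d. from $\mathrm{Law}(\boldsymbol X\mid S=s)$ independent of everything else; $\zeta,(\zeta^s_i)$ i.i.d. uniform on $[-\sigma,\sigma]$; $(U^s)$ i.i.d. uniform on $[0,1]$; all independent. $\tilde f^s_i=f(\boldsymbol X^s_i,s)+\zeta^s_i$, $\tilde f(\boldsymbol x,s)=f(\boldsymbol x,s)+\zeta$; $\hat F_{1,s}(t)=\frac1{N_s+1}(\sum_{i\le N_s}\mathbf1\{\tilde f^s_i<t\}+U^s(1+\sum_{i\le N_s}\mathbf1\{\tilde f^s_i=t\}))$, $\hat F_{2,s}(t)=\frac1{N_s}\sum_{i=N_s+1}^{2N_s}\mathbf1\{\tilde f^s_i\le t\}$; $\hat\Pi(f)(\boldsymbol x,s)=\sum_{s'}w_{s'}\hat F^{-1}_{2,s'}\circ\hat F_{1,s}\circ\tilde f(\boldsymbol x,s)$. In $\|\hat\Pi(f)-f^*_0\|_q$ the conditional expectations average over $(\boldsymbol X,\zeta)$ with the auxiliary samples and $U^s$ fixed; the outer $\mathbf E$ is over the auxiliary samples, their noises and the $U^s$. *)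

(* Defs.v *)
From HB Require Import structures.
From mathcomp Require Import all_boot all_order all_algebra.
From mathcomp Require Import all_classical all_reals all_analysis.
Set Implicit Arguments. Unset Strict Implicit. Unset Printing Implicit Defensive.
Import Order.TTheory GRing.Theory Num.Theory.
Local Open Scope classical_set_scope.
Local Open Scope ring_scope.

Section fairness_defs.
Context {R : realType} {d : measure_display} {Omega : measurableType d}.
Context (P : probability Omega R) {K : nat} (S : Omega -> 'I_K).

Definition evS (s : 'I_K) : set Omega := [set om | S om = s].

Definition condP (s : 'I_K) (A : set Omega) : \bar R :=
  (((fine (P (evS s)))^-1)%:E * P (evS s `&` A))%E.

Definition condE (s : 'I_K) (h : Omega -> \bar R) : \bar R :=
  (((fine (P (evS s)))^-1)%:E * \int[P]_(om in evS s) h om)%E.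

Context {p : nat} (X : Omega -> p.-tuple R) (w : 'I_K -> R).

Definition normr (g : p.-tuple R -> 'I_K -> R) (r : R) : \bar R :=
  poweR (\sum_(s < K) (w s)%:E *
           condE s (fun om => (powR `|g (X om) s| r)%:E))%E r^-1.

Definition norminf (g : p.-tuple R -> 'I_K -> R) : \bar R :=
  (\sum_(s < K) (w s)%:E *
     ereal_inf [set b%:E | b in [set b : R | condP s [set om | (b < `|g (X om) s|)%R] = 0%E]])%E.

Definition cdf_nu (fstar : p.-tuple R -> 'I_K -> R) (s : 'I_K) (t : R) : R :=
  fine (condP s [set om | fstar (X om) s <= t]).

Definition fstar0 (fstar : p.-tuple R -> 'I_K -> R) (x : p.-tuple R) (s : 'I_K) : R :=
  \sum_(s' < K) w s' * inf [set y : R | cdf_nu fstar s (fstar x s) <= cdf_nu fstar s' y].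

Definition is_cond_exp (Y : Omega -> R) (fstar : p.-tuple R -> 'I_K -> R) : Prop :=
  (forall s, measurable_fun setT (fun x => fstar x s)) /\
  P.-integrable setT (EFin \o Y) /\
  forall D : p.-tuple R -> 'I_K -> Prop,
    (forall s, measurable [set x | D x s]) ->
    (\int[P]_(om in [set om | D (X om) (S om)]) (Y om)%:E =
     \int[P]_(om in [set om | D (X om) (S om)]) (fstar (X om) (S om))%:E)%E.

End fairness_defs.

(* generalized inverse F^{-1}(u) = inf {x : u <= F x}  (real-valued [inf];
   only differs from the extended-real one on u <= 0, a null event here) *)
Definition ginv {R : realType} (F : R -> R) (u : R) : R := inf [set x : R | u <= F x].

Definition mutual_indep {R : realType} {d : measure_display} {Omega : measurableType d}
  (Q : probability Omega R) {I : eqType} (D : set I) (E : I -> set (set Omega)) : Prop :=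
  forall (J : seq I) (A : I -> set Omega), uniq J ->
    (forall i, i \in J -> D i /\ E i (A i)) ->
    Q (\bigcap_(i in [set` J]) A i) = (\prod_(i <- J) Q (A i))%E.

Section postproc.
Context {R : realType} {K p : nat} (w : 'I_K -> R) (N : 'I_K -> nat).
Context (f : p.-tuple R -> 'I_K -> R).
(* auxiliary data for a fixed outcome: samples xa s i, noises za s i, uniforms u s;
   indices are 0-based: i < N s is the first half, N s <= i < 2 N s the second. *)
Context (xa : 'I_K -> nat -> p.-tuple R) (za : 'I_K -> nat -> R) (u : 'I_K -> R).

Definition ftil (s : 'I_K) (i : nat) : R := f (xa s i) s + za s i.

Definition F1hat (s : 'I_K) (t : R) : R :=
  ((N s)%:R + 1)^-1 * (\sum_(i < N s) ((ftil s i < t)%R)%:R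
                        + u s * (1 + \sum_(i < N s) ((ftil s i == t)%R)%:R)).

Definition F2hat (s : 'I_K) (t : R) : R :=
  ((N s)%:R)^-1 * \sum_(i < N s) ((ftil s (N s + i) <= t)%R)%:R.

(* hat Pi(f)(x, s) evaluated with the noise value z (so that tilde f(x,s) = f(x,s) + z) *)
Definition Pihat (x : p.-tuple R) (s : 'I_K) (z : R) : R :=
  \sum_(s' < K) w s' * ginv (F2hat s') (F1hat s (f x s + z)).
End postproc.

(* aux index type: X^s_i, zeta^s_i, U^s *)
Definition aux_idx (K : nat) : eqType := (('I_K * nat) + ('I_K * nat) + 'I_K)%type.

(* Main.v *)
(* Everything happens at the level of q-th powers.  Put T = f*(X, s), D = |f - f*| + sigma, V = F(T) with F the
   CDF of nu*_s, and let v be the randomized empirical rank of the perturbed test point.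

   Since perturbed scores are within D of the true ones, N |v - V| is at most the deviation of the empirical CDF of the
   T_j at T plus the number of j with |T_j - T| <= D_j + D.  The deviation has q-th moment O(N^{q/2}).  For the
   count, a density bounded by Lam forces the mass h(t) of {|T - t| <= 2 D} to satisfy E h(T)^q <= C E D^q.

   The empirical quantile at level v is a sample point Y_j whose cell of ranks contains v, and Lipschitz continuity of
   F^{-1} bounds its distance to F^{-1}(v) by D_j plus the rank error at j.  Exchangeability and the randomization of
   ties make v uniform on [0, 1], independently of the other half-sample, so a cell holding m tied points is
   hit with probability at most m / N and the error averages over j.

   Altogether E inner^q <= C a^q with a^q = ||f - f*||_q^q + sigma^q + sum_s w_s N_s^{-q/2}, and the tangent
   inequality y <= a + a^{1-q} y^q turns this into E inner <= (1 + C) a. *)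

Require Import Defs.
From HB Require Import structures.
From mathcomp Require Import all_boot all_order all_algebra.
From mathcomp Require Import all_classical all_reals all_analysis measurable_realfun.
From mathcomp Require Import perm ring lra.
Import Order.TTheory GRing.Theory Num.Theory.
Local Open Scope classical_set_scope.
Local Open Scope ring_scope.

(** * Integrals, laws and decoupling *)

(** Measurability shapes the argument. The loss reads empirical quantiles at a random level and is
    never shown measurable in the auxiliary outcome. Off a null set it is dominated by a measurable
    [majorant], in which the random choice of a sample point is replaced by a sum over all sample
    points of a cost times the indicator of a cell. Only majorants are integrated, and the tangent
    inequality stands in for Jensen's because it applies pointwise, before the domination.

    Independence is given as a product formula for events. [decouple] turns it into a Fubini theorem
    on a single space: the diagonal integral of a function measurable for the product of two block
    sigma-algebras is a double integral. Leave-one-out errors, uniformity of the rank and the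
    separation of the two half-samples all use it.

    Ties are kept and share their cell equally, so exact counting replaces null-set arguments about
    them. *)

Section integral_facts.
Context {d : measure_display} {T : measurableType d} {R : realType}.
Context (mu : {measure set T -> \bar R}).
Local Open Scope ereal_scope.

(* Monotonicity of the integral of nonnegative functions needs no measurability, since it is a supremum over simple minorants. *)
Lemma ge0_le_integral_nomeas (D : set T) (f g : T -> \bar R) :
  (forall x, D x -> 0 <= f x) -> (forall x, D x -> f x <= g x) ->
  \int[mu]_(x in D) f x <= \int[mu]_(x in D) g x.
Proof.
move=> f0 fg; rewrite !ge0_integralE//; last first.
  by move=> x Dx; apply: le_trans (f0 x Dx) (fg x Dx).
apply: ereal_sup_le => _ [h hf <-]; apply: imageP.
move=> x; apply: le_trans (hf x) _; rewrite /patch; case: ifPn => //.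
by rewrite inE => /fg.
Qed.

(** Adding [+oo] to [g] on the null set [N0] restores domination everywhere and leaves the integral
    unchanged, so measurability is asked of the majorant [g] only. *)
Lemma ge0_le_integral_off (D N0 : set T) (f g : T -> \bar R) :
  measurable D -> measurable N0 -> mu N0 = 0 ->
  (forall x, D x -> 0 <= f x) -> (forall x, D x -> 0 <= g x) ->
  measurable_fun D g -> (forall x, D x -> ~ N0 x -> f x <= g x) ->
  \int[mu]_(x in D) f x <= \int[mu]_(x in D) g x.
Proof.
move=> mD mN N0_0 f0 g0 mg fg.
have m1 : measurable_fun D (fun x => +oo * (\1_N0 x : R)%:E).
  apply: measurable_funeM; apply/measurable_EFinP.
  by apply: measurable_funTS; exact: measurable_indic.
have i0 x : 0 <= +oo * (\1_N0 x : R)%:E by apply: mule_ge0 => //; rewrite lee_fin.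
apply: (@le_trans _ _ (\int[mu]_(x in D) (g x + +oo * (\1_N0 x : R)%:E))).
  apply: ge0_le_integral_nomeas => // x Dx.
  rewrite indicE; have [xN|xN] := boolP (x \in N0).
    by rewrite mule1 addey ?leey// -ltNye (lt_le_trans _ (g0 x Dx)).
  by rewrite mule0 adde0 fg//; move: xN; rewrite notin_setE.
rewrite ge0_integralD//.
have mi : measurable_fun D (fun x => (\1_N0 x : R)%:E).
  by apply/measurable_EFinP; apply: measurable_funTS; exact: measurable_indic.
rewrite (ge0_integralZl mu mD mi)//.
rewrite integral_indic// (_ : mu (N0 `&` D) = 0) ?mule0 ?adde0//.
by apply: subset_measure0 N0_0 => //; exact: measurableI.
Qed.

End integral_facts.

Section law.
Context {R : realType}.
Local Open Scope ereal_scope.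

(** Restricting [mu1] to [D] and scaling by [c] makes one lemma serve both the conditioning on
    [S = s], with [c] an inverse probability, and the uniform noise, with [mu1] Lebesgue measure and
    [c] an inverse length. *)
Lemma integral_same_law {d1 d2 d3 : measure_display} {T1 : measurableType d1} {T2 : measurableType d2}
    {T : measurableType d3} (mu1 : {measure set T1 -> \bar R}) (mu2 : {measure set T2 -> \bar R})
    (D : set T1) (c : R) (X : T1 -> T) (W : T2 -> T) (psi : T -> \bar R) :
  (0 <= c)%R -> measurable D -> measurable_fun setT X -> measurable_fun setT W ->
  (forall B, measurable B -> mu2 (W @^-1` B) = c%:E * mu1 (D `&` X @^-1` B)) ->
  measurable_fun setT psi -> (forall x, 0 <= psi x) ->
  c%:E * \int[mu1]_(x in D) psi (X x) = \int[mu2]_x psi (W x).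
Proof.
move=> c0 mD mX mW law mpsi psi0.
pose k : {nonneg R} := NngNum c0.
have m1 : measurable_fun setT (psi \o X) by exact: measurableT_comp.
transitivity (\int[pushforward (mscale k (mrestr mu1 mD)) X]_x psi x).
  apply/esym; rewrite (ge0_integral_pushforward mX)//.
  rewrite preimage_setT ge0_integral_mscale//; last by move=> ? _; exact: psi0.
  congr (_ * _); apply/esym.
  rewrite [RHS](@ge0_negligible_integral _ _ _ _ setT (~` D)) //.
  - rewrite setTD setCK.
    apply: eq_measure_integral => A mA AD; by rewrite /= /mrestr setIidl.
  - exact: measurableC.
  - by move=> ? _; exact: psi0.
  - by rewrite /= /mrestr setICl measure0.
rewrite (@eq_measure_integral _ _ _ setT (pushforward mu2 W)); last first.
  by move=> A mA _; rewrite /= /pushforward /mscale /mrestr law//= setIC.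
by rewrite (ge0_integral_pushforward mW).
Qed.

End law.

Definition law_of {d1 d2 : measure_display} {T1 : measurableType d1} {T2 : measurableType d2}
    {R : realType} (Q : probability T1 R) {f : T1 -> T2} (mf : measurable_fun setT f) :
    probability T2 R :=
  distribution Q (HB.pack_for {mfun T1 >-> T2} f (isMeasurableFun.Build _ _ _ _ f mf)).

Lemma integral_law {d1 d2 : measure_display} {T1 : measurableType d1} {T2 : measurableType d2}
    {R : realType} (Q : probability T1 R) {f : T1 -> T2} (mf : measurable_fun setT f)
    (psi : T2 -> \bar R) : measurable_fun setT psi -> (forall x, (0 <= psi x)%E) ->
  (\int[law_of Q mf]_x psi x = \int[Q]_x psi (f x))%E.
Proof. by move=> mpsi psi0; rewrite (ge0_integral_pushforward mf). Qed.

Section decoupling.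
Context {d : measure_display} {Om : measurableType d} {R : realType}.
Context (Q : probability Om R).
Local Open Scope ereal_scope.

(** Dynkin argument: both sides, as functions of [A], are finite measures that agree on a pi-system
    containing the whole space. *)
Lemma indep_sigma (G : set (set Om)) (B : set Om) :
  G `<=` measurable -> setI_closed G -> G setT -> measurable B ->
  (forall A, G A -> Q (A `&` B) = Q A * Q B) ->
  forall A, <<s G >> A -> Q (A `&` B) = Q A * Q B.
Proof.
move=> Gm GI GT mB GB A sA.
have QB0 : (0 <= fine (Q B))%R by exact: fine_ge0.
have -> : Q A * Q B = mscale (NngNum QB0) Q A.
  by rewrite /mscale/= fineK ?fin_num_measure// muleC.
rewrite -[LHS]/(mrestr Q mB A).
apply: (g_sigma_algebra_measure_unique G Gm (fun=> setT)) => //.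
- by rewrite bigcup_const.
- move=> C GC; rewrite /= /mrestr /mscale/= GB// fineK ?fin_num_measure//.
  by rewrite muleC.
- move=> _; rewrite /= /mrestr setTI.
  by rewrite (le_lt_trans (probability_le1 _ _))// ltry.
Qed.

Lemma sub_gen (G : set (set Om)) A : G `<=` measurable -> <<s G >> A -> measurable A.
Proof.
move=> Gm; apply: smallest_sub => //.
exact: sigma_algebra_measurable.
Qed.

(** The diagonal map into the product of the two generated sigma-algebras pushes [Q] to the product
    of its restrictions, and Tonelli splits the integral. Joint measurability for these
    sigma-algebras is how the statement says that each argument of [Phi] uses one block only. *)
Lemma decouple (G1 G2 : set (set Om)) (Phi : Om -> Om -> \bar R) :
  G1 `<=` measurable -> setI_closed G1 -> G1 setT ->
  G2 `<=` measurable -> setI_closed G2 -> G2 setT ->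
  (forall A B, G1 A -> G2 B -> Q (A `&` B) = Q A * Q B) ->
  measurable_fun setT
    (fun z : g_sigma_algebraType G1 * g_sigma_algebraType G2 => Phi z.1 z.2) ->
  (forall x y, 0 <= Phi x y) ->
  \int[Q]_x Phi x x = \int[Q]_x \int[Q]_y Phi x y.
Proof.
move=> G1m G1I G1T G2m G2I G2T GG mPhi Phi0.
have m1 : measurable_fun setT (id : Om -> g_sigma_algebraType G1).
  by move=> _ B mB; rewrite setTI; exact: sub_gen mB.
have m2 : measurable_fun setT (id : Om -> g_sigma_algebraType G2).
  by move=> _ B mB; rewrite setTI; exact: sub_gen mB.
have m12 : measurable_fun setT
    (fun x : Om => (x : g_sigma_algebraType G1, x : g_sigma_algebraType G2)).
  exact: measurable_fun_pair.
pose P12 := law_of Q m12.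
pose Q1 := law_of Q m1.
pose Q2 := law_of Q m2.
have ind A B : <<s G1 >> A -> <<s G2 >> B -> Q (A `&` B) = Q A * Q B.
  move=> sA sB; apply: (indep_sigma G1) => //; first exact: sub_gen sB.
  move=> A' GA'; rewrite setIC muleC; apply: (indep_sigma G2) => //; first exact: G1m.
  by move=> B' GB'; rewrite setIC muleC GG.
have PP X : measurable X -> (Q1 \x Q2)%E X = P12 X.
  by move=> mX; apply: product_measure_unique => // A B mA mB; exact: ind.
transitivity (\int[P12]_z Phi z.1 z.2).
  by rewrite (integral_law _ m12)// => z; exact: Phi0.
rewrite -(eq_measure_integral _ (fun A mA _ => PP A mA)).
rewrite (fubini_tonelli1 _ mPhi)//.
rewrite (integral_law _ m1)//; last 2 first.
- by apply: (measurable_fun_fubini_tonelli_F (m2 := Q2) _ mPhi) => z; exact: Phi0.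
- by move=> x; apply: integral_ge0 => y _; exact: Phi0.
apply: eq_integral => x _; rewrite /fubini_F (integral_law _ m2)//.
- have mx : measurable_fun setT (fun y : g_sigma_algebraType G2 => (x : g_sigma_algebraType G1, y)).
    exact: pair1_measurable.
  have := measurableT_comp mPhi mx. by rewrite /comp /=.
Qed.

End decoupling.

(** * Ranks and empirical quantiles *)

Lemma sumr_const_seq {V : pzRingType} {I : Type} (r : seq I) (x : V) :
  \sum_(i <- r) x = (size r)%:R * x.
Proof. by rewrite big_const_seq count_predT iter_addr addr0 mulr_natl. Qed.

Section powers.
Context {R : realType}.
Implicit Types (x a b q : R).

(** Each [a i] is at most the [1/q]-th power of the sum of [q]-th powers. The constant is cruder
    than the one from convexity, but the argument is uniform in [q > 0]. *)
Lemma powR_sum_le {I : eqType} (r : seq I) (a : I -> R) q : 0 < q ->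
  (forall i, i \in r -> 0 <= a i) ->
  powR (\sum_(i <- r) a i) q <= powR (size r)%:R q * \sum_(i <- r) powR (a i) q.
Proof.
move=> q0 a0; set S := \sum_(i <- r) powR (a i) q.
have S0 : 0 <= S by apply: sumr_ge0 => i _; exact: powR_ge0.
have aS i : i \in r -> a i <= powR S q^-1.
  move=> ir; have -> : a i = powR (powR (a i) q) q^-1.
    by rewrite -powRrM mulfV ?gt_eqF// powRr1// a0.
  apply: ge0_ler_powR; rewrite ?nnegrE ?powR_ge0 ?invr_ge0 ?(ltW q0)//.
  rewrite /S (perm_big _ (perm_to_rem ir)) big_cons lerDl.
  by apply: sumr_ge0 => j _; exact: powR_ge0.
have -> : S = powR (powR S q^-1) q by rewrite -powRrM mulVf ?gt_eqF// powRr1.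
rewrite -powRM ?powR_ge0//; apply: ge0_ler_powR; rewrite ?nnegrE ?(ltW q0)//.
- by rewrite big_seq; apply: sumr_ge0.
- by rewrite mulr_ge0 ?powR_ge0.
rewrite -(sumr_const_seq r) big_seq [leRHS]big_seq.
by apply: ler_sum.
Qed.

Lemma powRD_le a b q : 0 < q -> 0 <= a -> 0 <= b ->
  powR (a + b) q <= powR 2 q * (powR a q + powR b q).
Proof.
move=> q0 a0 b0.
have := @powR_sum_le _ [:: true; false] (fun c : bool => if c then a else b) q q0.
by rewrite /= !big_cons !big_nil !addr0; apply; case.
Qed.

(** This is [x/q <= expR (x/q)] raised to the power [q]; it turns exponential moments into moments
    of order [q]. *)
Lemma powR_le_expR x q : 0 < q -> 0 <= x -> powR x q <= powR q q * expR x.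
Proof.
move=> q0 x0.
have -> : expR x = powR (expR (x / q)) q.
  by rewrite /powR gt_eqF ?expR_gt0// expRK mulrC divfK ?gt_eqF.
rewrite -powRM ?expR_ge0 ?(ltW q0)//.
have h : x / q <= expR (x / q).
  by apply: le_trans (expR_ge1Dx _); rewrite lerDr.
apply: ge0_ler_powR; rewrite ?nnegrE ?mulr_ge0 ?expR_ge0 ?(ltW q0)//.
by rewrite -ler_pdivrMl// mulrC.
Qed.

(** A ratio [c / (a + b)] in [0, 1] is at most its own [1/q]-th power; the two ratios for [c = a]
    and [c = b] add up to 1. *)
Lemma powR_subadd a b q : 1 <= q -> 0 <= a -> 0 <= b ->
  powR (a + b) q^-1 <= powR a q^-1 + powR b q^-1.
Proof.
move=> q1 a0 b0.
have q0 : 0 < q by exact: lt_le_trans q1.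
have qi0 : 0 <= q^-1 by rewrite invr_ge0 ltW.
have qi1 : q^-1 <= 1 by rewrite invf_le1.
have [ab0|abN] := eqVneq (a + b) 0.
  by rewrite ab0 powR0 ?invr_eq0 ?gt_eqF// addr_ge0 ?powR_ge0.
have ab0 : 0 < a + b by rewrite lt_def abN addr_ge0.
have key c : 0 <= c <= a + b -> c / (a + b) * powR (a + b) q^-1 <= powR c q^-1.
  move=> /andP[c0 cab].
  have [->|cN] := eqVneq c 0; first by rewrite !mul0r powR_ge0.
  have {}c0 : 0 < c by rewrite lt_def cN.
  have {2}-> : c = c / (a + b) * (a + b) by rewrite divfK.
  rewrite powRM ?divr_ge0 ?(ltW c0) ?(ltW ab0)// ler_wpM2r ?powR_ge0//.
  by apply: ger1_powR => //; rewrite divr_gt0// ler_pdivrMr// mul1r.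
have ka := key a; have kb := key b.
apply: le_trans (lerD (ka _) (kb _)); last 2 first.
- by rewrite a0 lerDl.
- by rewrite b0 lerDr.
by rewrite -mulrDl -mulrDl divff// mul1r.
Qed.

End powers.

Section ranks.
Context {R : realType}.
Implicit Types v : R.

(** [neq] counts the points equal to [y k], itself included. The ties of [y k] occupy the integer
    ranks from [nlt y k] up to, but excluding, [nlt y k + neq y k]. *)
Definition nlt {n} (y : 'I_n -> R) (k : 'I_n) : nat := \sum_(l < n) ((y l < y k)%R : nat).
Definition neq {n} (y : 'I_n -> R) (k : 'I_n) : nat := \sum_(l < n) ((y l == y k)%R : nat).

Lemma nltD_neq_le {n} (y : 'I_n -> R) k k' : y k < y k' -> (nlt y k + neq y k <= nlt y k')%N.
Proof.
move=> kk'; rewrite /nlt /neq -big_split /=; apply: leq_sum => l _.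
case: (ltgtP (y l) (y k)) => [lk|lk|->] /=.
- by rewrite (lt_trans lk kk').
- by [].
- by rewrite kk'.
Qed.

Lemma neq_gt0 {n} (y : 'I_n -> R) k : (0 < neq y k)%N.
Proof. by rewrite /neq (bigD1 k)//= eqxx. Qed.

Lemma nltD_neq_max {n} (y : 'I_n -> R) k : (nlt y k + neq y k <= n)%N.
Proof.
rewrite /nlt /neq -big_split /= -[leqRHS]card_ord -sum1_card; apply: leq_sum => l _.
by case: (ltgtP (y l) (y k)).
Qed.

Lemma sum_class {n} (y : 'I_n -> R) k0 :
  \sum_(k < n | y k == y k0) ((neq y k)%:R : R)^-1 = 1.
Proof.
rewrite (eq_bigr (fun=> ((neq y k0)%:R : R)^-1)); last first.
  by move=> k /eqP yk; rewrite /neq yk.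
rewrite big_mkcond (eq_bigr (fun k => ((y k == y k0) : nat)%:R * ((neq y k0)%:R)^-1)); last first.
  by move=> k _; case: eqP; rewrite ?mul1r ?mul0r.
by rewrite -mulr_suml -natr_sum mulfV// pnatr_eq0 -lt0n neq_gt0.
Qed.

(** By [nltD_neq_le] the rank blocks of distinct values are disjoint, so all contributing indices
    belong to one tie class, whose weights sum to 1. *)
Lemma sum_cell_le1 {n} (y : 'I_n -> R) (c : nat) :
  \sum_(k < n | (nlt y k <= c < nlt y k + neq y k)%N) ((neq y k)%:R : R)^-1 <= 1.
Proof.
have [k0 k0P|no] := pickP (fun k => (nlt y k <= c < nlt y k + neq y k)%N); last first.
  by rewrite big_pred0.
rewrite -[leRHS](sum_class y k0); rewrite big_mkcond [leRHS]big_mkcond /=.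
apply: ler_sum => k _; case: ifP => [kP|_]; last by case: ifP.
case: ifPn => // /eqP ne; exfalso.
move: k0P kP => /andP[a1 a2] /andP[b1 b2].
case: (ltgtP (y k) (y k0)) ne => // [/nltD_neq_le h|/nltD_neq_le h] _.
- by move: (leq_trans b2 (leq_trans h a1)); rewrite ltnn.
- by move: (leq_trans a2 (leq_trans h b1)); rewrite ltnn.
Qed.

(* Each block of ties [k] spreads its increment of [g] evenly over its members, so the blocks, which are disjoint, telescope. *)
Lemma sum_rank_increments {n} (y : 'I_n -> R) (g : nat -> R) :
  (forall c, g c <= g c.+1) ->
  \sum_(k < n) (g (nlt y k + neq y k)%N - g (nlt y k)) / (neq y k)%:R <= g n - g 0%N.
Proof.
move=> g_nd.
have -> : \sum_(k < n) (g (nlt y k + neq y k)%N - g (nlt y k)) / (neq y k)%:R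
  = \sum_(0 <= c < n) (\sum_(k < n | (nlt y k <= c < nlt y k + neq y k)%N) ((neq y k)%:R : R)^-1)
      * (g c.+1 - g c).
  rewrite [RHS](eq_bigr (fun c => \sum_(k < n)
     (if (nlt y k <= c < nlt y k + neq y k)%N then (g c.+1 - g c) else 0) / (neq y k)%:R)).
    rewrite exchange_big /=; apply: eq_bigr => k _.
    rewrite -mulr_suml; congr (_ / _).
    rewrite -(telescope_sumr _ (leq_addr _ _)) (big_nat_widen _ _ _ _ _ (nltD_neq_max y k)).
    rewrite (big_nat_widenl _ _ _ _ _ (leq0n (nlt y k))) big_mkcond /=.
    by apply: eq_bigr => c _; rewrite andbC.
  move=> c _; rewrite big_mkcond mulr_suml; apply: eq_bigr => k _.
  by case: ifP; rewrite ?mul0r// mulrC.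
rewrite -(telescope_sumr _ (leq0n n)); apply: ler_sum => c _.
by rewrite ler_piMl ?subr_ge0// sum_cell_le1.
Qed.

Lemma nltE {n} (y : 'I_n -> R) k : (nlt y k)%:R = \sum_(l < n) ((y l < y k)%R)%:R :> R.
Proof. by rewrite /nlt natr_sum. Qed.

Lemma nltD_neqE {n} (y : 'I_n -> R) k :
  (nlt y k + neq y k)%:R = \sum_(l < n) ((y l <= y k)%R)%:R :> R.
Proof.
rewrite /nlt /neq -big_split natr_sum /=; apply: eq_bigr => l _.
by case: (ltgtP (y l) (y k)).
Qed.

(** The empirical CDF jumps only at sample points, so the infimum is attained at the smallest sample
    point that reaches level [v]. Positivity of [v] keeps the level set bounded below. *)
Lemma ginv_sample {n} (y : 'I_n -> R) v : (0 < n)%N -> 0 < v <= 1 ->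
  exists i, ginv (fun t => n%:R^-1 * \sum_(j < n) ((y j <= t)%R)%:R) v = y i /\
    (nlt y i)%:R / n%:R <= v <= (nlt y i + neq y i)%:R / n%:R.
Proof.
move=> n0 /andP[v0 v1]; set F := (X in ginv X _).
have nR0 : 0 < n%:R^-1 :> R by rewrite invr_gt0 ltr0n.
have F_le t t' : (forall l, y l <= t -> y l <= t') -> F t <= F t'.
  move=> h; rewrite /F ler_pM2l//; apply: ler_sum => l _; rewrite ler_nat.
  by case: (boolP (y l <= t)) => // /h ->.
have F_pos t : 0 < F t -> exists2 j, y j <= t & forall l, y l <= t -> y l <= y j.
  move=> Ft; have [l0 l0P|no] := pickP (fun l => y l <= t).
    by case: (@arg_maxP _ _ _ l0 (fun l => y l <= t) y l0P) => j jt jmax; exists j.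
  by exfalso; move: Ft; rewrite /F big1 ?mulr0 ?ltxx// => l _; rewrite no.
have [M MP] : exists M, forall l, y l <= y M.
  case: (@arg_maxP _ _ _ (Ordinal n0) predT y isT) => M _ h; exists M => l.
  exact: h.
have FM : v <= F (y M).
  apply: le_trans v1 _; rewrite /F (eq_bigr (fun=> 1)) => [|l _]; last by rewrite MP.
  by rewrite sumr_const card_ord mulVf// pnatr_eq0 -lt0n.
case: (@arg_minP _ _ _ M (fun i => v <= F (y i)) y FM) => i iP imin.
have S_ge t : v <= F t -> y i <= t.
  move=> vt; have [j jt jmax] := F_pos t (lt_le_trans v0 vt).
  apply: le_trans (jt); apply: imin; apply: le_trans vt _.
  by apply: F_le.
exists i; split.
  apply/eqP; rewrite eq_le; apply/andP; split.
    by apply: ge_inf => //; exists (y i) => t /S_ge.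
  by apply: lb_le_inf; [exists (y i)|move=> t /S_ge].
apply/andP; split; last by rewrite mulrC nltD_neqE.
(* If [v] were below the strict rank, the largest sample point below [y i] would already reach level
   [v], against the minimality of [y i]. *)
rewrite leNgt; apply/negP => vlt.
have [l0 l0P|no] := pickP (fun l => y l < y i); last first.
  move: vlt; rewrite nltE big1 ?mul0r => [|l _]; last by rewrite no.
  by rewrite ltNge ltW.
case: (@arg_maxP _ _ _ l0 (fun l => y l < y i) y l0P) => j ji jmax.
have : y i <= y j.
  apply: imin; apply: le_trans (ltW vlt) _; rewrite mulrC nltE /F ler_pM2l//.
  apply: ler_sum => l _; rewrite ler_nat.
  by case: (boolP (y l < y i)) => // /jmax /= ->.
by rewrite leNgt ji.
Qed.

End ranks.

Section quantile.
Context {R : realType} (F : R -> R) (a b L : R).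
Implicit Types v : R.
Hypothesis (F_nd : forall x y, x <= y -> F x <= F y).
Hypothesis (F_lo : forall x, x < a -> F x <= 0).
Hypothesis (F_hi : forall x, b <= x -> 1 <= F x).
Hypothesis (L0 : 0 <= L).
Hypothesis (F_lip : forall x y, a <= x -> x <= y -> y <= b -> y - x <= L * (F y - F x)).

Let S_lb v : 0 < v -> forall x, v <= F x -> a <= x.
Proof.
move=> v0 x vx; rewrite leNgt; apply/negP => /F_lo Fx.
by have := lt_le_trans v0 (le_trans vx Fx); rewrite ltxx.
Qed.

Let ginv_le v x : 0 < v -> v <= F x -> ginv F v <= x.
Proof. by move=> v0 vx; apply: ge_inf => //; exists a => t; exact: S_lb. Qed.

Let le_ginv v x : v <= 1 -> (forall t, v <= F t -> x <= t) -> x <= ginv F v.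
Proof.
by move=> v1 h; apply: lb_le_inf => //; exists b; exact: le_trans v1 (F_hi _ (lexx b)).
Qed.

(** [F_lip] says that [F] grows at rate at least [1/L] on [a, b]. If [v <= F t], a point left of [t]
    that reaches [v] is within [L (F t - v)] of [t]. Otherwise, moving right from [t] by
    [L (v - F t)] either reaches level [v] or passes [b], where [F] is at least 1. *)
Lemma dist_ginv t v : a <= t <= b -> 0 < v <= 1 -> `|t - ginv F v| <= L * `|F t - v|.
Proof.
move=> /andP[at_ tb] /andP[v0 v1]; have [vt|tv] := leP v (F t).
  rewrite [X in _ <= L * X]ger0_norm ?subr_ge0// ger0_norm; last by rewrite subr_ge0 ginv_le.
  rewrite lerBlDr -lerBlDl; apply: le_ginv => // x vx.
  have [tx|xt] := leP t x.
    by rewrite (le_trans _ tx)// gerBl mulr_ge0// subr_ge0.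
  have := F_lip _ _ (S_lb _ v0 _ vx) (ltW xt) tb.
  have : L * (F t - F x) <= L * (F t - v) by rewrite ler_wpM2l// lerB.
  by lra.
have tg : t <= ginv F v.
  apply: le_ginv => // x vx; rewrite leNgt; apply/negP => /ltW /F_nd xt.
  by have := lt_le_trans tv (le_trans vx xt); rewrite ltxx.
rewrite distrC ger0_norm ?subr_ge0// distrC ger0_norm ?subr_ge0 ?(ltW tv)//.
rewrite lerBlDl; apply: ginv_le => //.
have d0 : 0 <= L * (v - F t) by rewrite mulr_ge0// subr_ge0 ltW.
have [bx|xb] := leP b (t + L * (v - F t)); first exact: le_trans v1 (F_hi _ bx).
have tt : t <= t + L * (v - F t) by rewrite lerDl.
have := F_lip _ _ at_ tt (ltW xb); rewrite [_ - t]addrC addKr => h.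
(* When [L] vanishes, [F_lip] collapses [t, b], so [F t] is already at least 1. *)
have [L_0|LN] := eqVneq L 0; last first.
  by move: h; rewrite ler_pM2l ?lerD2r// lt_def LN.
exfalso; have := F_lip _ _ at_ tb (lexx b); rewrite L_0 mul0r subr_le0 => bt.
by have := lt_le_trans tv (le_trans v1 (F_hi _ bt)); rewrite ltxx.
Qed.

(** Translating a point that reaches [v] by [L (v' - v)] gives a point that reaches [v']. *)
Lemma ginv_lipschitz v v' : 0 < v <= 1 -> 0 < v' <= 1 ->
  `|ginv F v - ginv F v'| <= L * `|v - v'|.
Proof.
wlog vv' : v v' / v <= v'.
  move=> H hv hv'; have [|/ltW] := leP v v'; first by move=> ?; exact: H.
  by move=> ?; rewrite distrC [`|v - v'|]distrC; exact: H.
move=> /andP[v0 v1] /andP[v'0 v'1].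
have g : ginv F v <= ginv F v'.
  by apply: le_ginv => // t v't; apply: ginv_le => //; exact: le_trans v't.
rewrite distrC ger0_norm ?subr_ge0// distrC ger0_norm ?subr_ge0//.
rewrite lerBlDr -lerBlDl; apply: le_ginv => // x vx; rewrite lerBlDl.
apply: ginv_le => //.
have d0 : 0 <= L * (v' - v) by rewrite mulr_ge0// subr_ge0.
rewrite addrC; have [bx|xb] := leP b (x + L * (v' - v)); first exact: le_trans (F_hi _ bx).
have ax := S_lb _ v0 _ vx.
have xx : x <= x + L * (v' - v) by rewrite lerDl.
have := F_lip _ _ ax xx (ltW xb); rewrite [_ - x]addrC addKr => h.
have [L_0|LN] := eqVneq L 0; last first.
  move: h; rewrite ler_pM2l ?lt_def ?LN// => h.
  by move: h vx; lra.
exfalso; have xb' : x <= b.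
  by apply: le_trans (ltW xb); rewrite lerDl.
have := F_lip _ _ ax xb' (lexx b); rewrite L_0 mul0r subr_le0 => bt.
by move: xb; rewrite L_0 mul0r addr0 ltNge bt.
Qed.

End quantile.

Section rank_error.
Context {R : realType} {I : Type}.

(* Bounds the error made when the rank of [t0] among the [T j] is read off perturbed data [y j], with [`|y j - T j| <= D j] *)
Definition rank_err (J : seq I) (T D : I -> R) (F t0 D0 : R) : R :=
  `|\sum_(j <- J) (((T j <= t0)%R)%:R - F)| + \sum_(j <- J) ((`|T j - t0| <= D j + D0)%R)%:R.

(** Passing from [T j], [t0] to [y j], [y0] can change the outcome of a comparison only when
    [|T j - t0| <= D j + D0]. Letting [c] range between the strict and the weak count covers every
    way of breaking ties. *)
Lemma rank_err_bound (J : seq I) (T D y : I -> R) (F t0 D0 y0 c : R) :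
  (forall j, `|y j - T j| <= D j) -> `|y0 - t0| <= D0 ->
  \sum_(j <- J) ((y j < y0)%R)%:R <= c <= \sum_(j <- J) ((y j <= y0)%R)%:R ->
  `|c - (size J)%:R * F| <= rank_err J T D F t0 D0.
Proof.
move=> hD hD0 /andP[c1 c2]; rewrite /rank_err.
set A := \sum_(j <- J) (((T j <= t0)%R)%:R : R).
set B := \sum_(j <- J) ((`|T j - t0| <= D j + D0)%R)%:R.
have -> : \sum_(j <- J) (((T j <= t0)%R)%:R - F) = A - (size J)%:R * F.
  by rewrite sumrB sumr_const_seq.
have h1 : A - B <= c.
  apply: le_trans c1; rewrite -sumrB; apply: ler_sum => j _.
  have := hD j; move: hD0; rewrite !ler_norml => /andP[? ?] /andP[? ?].
  case: (leP (T j) t0) => tj; case: (boolP (- (D j + D0) <= T j - t0 <= D j + D0)) => dj;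
    case: (ltP (y j) y0) => yj /=; lra.
have h2 : c <= A + B.
  apply: le_trans c2 _; rewrite -big_split; apply: ler_sum => j _ /=.
  have := hD j; move: hD0; rewrite !ler_norml => /andP[? ?] /andP[? ?].
  case: (leP (T j) t0) => tj; case: (boolP (- (D j + D0) <= T j - t0 <= D j + D0)) => dj;
    case: (leP (y j) y0) => yj /=; lra.
have h3 := ler_norm (A - (size J)%:R * F).
have h4 := ler_norm (- (A - (size J)%:R * F)); rewrite normrN in h4.
by rewrite ler_norml; lra.
Qed.

End rank_error.

(** * Moments of centered counts *)

Section measurability.
Context {d : measure_display} {T : measurableType d} {R : realType}.
Implicit Types f g : T -> R.

Lemma mf_b2r (b : T -> bool) : measurable_fun setT b -> measurable_fun setT (fun x => (b x)%:R : R).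
Proof.
move=> mb; rewrite (_ : (fun x => _) = (fun x => if b x then 1 else 0 : R)).
  exact: measurable_fun_ifT.
by apply/funext => x; case: (b x).
Qed.
Lemma mf_lt f g : measurable_fun setT f -> measurable_fun setT g ->
  measurable_fun setT (fun x => (f x < g x)%R).
Proof. exact: measurable_fun_ltr. Qed.
Lemma mf_le f g : measurable_fun setT f -> measurable_fun setT g ->
  measurable_fun setT (fun x => (f x <= g x)%R).
Proof. exact: measurable_fun_ler. Qed.
Lemma mf_eq f g : measurable_fun setT f -> measurable_fun setT g ->
  measurable_fun setT (fun x => (f x == g x)%R).
Proof. exact: measurable_fun_eqr. Qed.
Lemma mf_and (b c : T -> bool) : measurable_fun setT b -> measurable_fun setT c ->
  measurable_fun setT (fun x => b x && c x).
Proof. exact: measurable_and. Qed.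
Lemma mf_D f g : measurable_fun setT f -> measurable_fun setT g ->
  measurable_fun setT (fun x => f x + g x).
Proof. exact: measurable_funD. Qed.
Lemma mf_N f : measurable_fun setT f -> measurable_fun setT (fun x => - f x).
Proof. by move=> mf; apply: measurableT_comp. Qed.
Lemma mf_M f g : measurable_fun setT f -> measurable_fun setT g ->
  measurable_fun setT (fun x => f x * g x).
Proof. exact: measurable_funM. Qed.
Lemma mf_V f : (forall x, 0 <= f x) -> measurable_fun setT f ->
  measurable_fun setT (fun x => (f x)^-1).
Proof.
move=> f0 mf; rewrite (_ : (fun x => _) = (fun x => powR (f x) (-1))).
  exact: (measurableT_comp (measurable_powR _)).
by apply/funext => x; rewrite powR_inv1.
Qed.
Lemma mf_abs f : measurable_fun setT f -> measurable_fun setT (fun x => `|f x|).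
Proof. by move=> mf; apply: measurableT_comp. Qed.
Lemma mf_pow f q : measurable_fun setT f -> measurable_fun setT (fun x => powR (f x) q).
Proof. by move=> mf; apply: (measurableT_comp (measurable_powR q)). Qed.
Lemma mf_exp f : measurable_fun setT f -> measurable_fun setT (fun x => expR (f x)).
Proof. by move=> mf; apply: measurableT_comp. Qed.
Lemma mf_max f g : measurable_fun setT f -> measurable_fun setT g ->
  measurable_fun setT (fun x => Num.max (f x) (g x)).
Proof. exact: measurable_maxr. Qed.
Lemma mf_min f g : measurable_fun setT f -> measurable_fun setT g ->
  measurable_fun setT (fun x => Num.min (f x) (g x)).
Proof. exact: measurable_minr. Qed.
Lemma mf_sum {I : Type} (r : seq I) (h : I -> T -> R) : (forall i, measurable_fun setT (h i)) ->
  measurable_fun setT (fun x => \sum_(i <- r) h i x).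
Proof. exact: measurable_sum. Qed.
Lemma mf_prod {I : Type} (r : seq I) (h : I -> T -> R) : (forall i, measurable_fun setT (h i)) ->
  measurable_fun setT (fun x => \prod_(i <- r) h i x).
Proof.
move=> mh; elim: r => [|i r IH].
  by under eq_fun do rewrite big_nil; exact: measurable_cst.
by under eq_fun do rewrite big_cons; exact: mf_M.
Qed.
Lemma mf_cst (c : R) : measurable_fun setT (fun _ : T => c).
Proof. exact: measurable_cst. Qed.
Lemma mf_EFin f : measurable_fun setT f -> measurable_fun setT (fun x => (f x)%:E).
Proof. by move=> mf; apply/measurable_EFinP. Qed.
Lemma measurable_bool (b : T -> bool) : measurable_fun setT b -> measurable [set x | b x].
Proof. by move=> mb; rewrite -[X in measurable X]setTI; exact: mb. Qed.

End measurability.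

Ltac meas_step := first [ assumption | apply: mf_cst | apply: mf_EFin | apply: mf_sum => ?
  | apply: mf_prod => ? | apply: mf_b2r | apply: mf_lt | apply: mf_le | apply: mf_eq | apply: mf_and
  | apply: mf_pow | apply: mf_abs | apply: mf_exp | apply: mf_max | apply: mf_min
  | apply: mf_N | apply: mf_D | apply: mf_V | apply: mf_M
  | apply: emeasurable_funD | apply: measurable_funeM ].
Ltac meas := repeat meas_step.
Tactic Notation "meas" "using" constr(H) := repeat first [ exact: H | meas_step ].
Tactic Notation "meas" "using" constr(H) constr(H') := repeat first [ exact: H | exact: H' | meas_step ].

Ltac nneg := move=> *; repeat first [ assumption | apply: mule_ge0 | apply: adde_ge0 | rewrite lee_fin
  | apply: powR_ge0 | apply: expR_ge0 | exact: ler0n | apply: mulr_ge0 | apply: addr_ge0 | rewrite invr_ge0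
  | apply: sume_ge0 => * | apply: integral_ge0 => * | done ].

Ltac side := try solve [ meas | nneg ].

Section binomial_moment.
Context {R : realType} {d dT : measure_display} {Om : measurableType d} {T : measurableType dT}.
Context (Q : probability Om R) (m : probability T R) {I : eqType} (Z : I -> Om -> T).

(** One common event [A] is tested at a time: the application is to counts of a single event, whose
    exponential moments expand into intersections of this kind. *)
Definition iid_on (J : seq I) := forall L, uniq L -> {subset L <= J} ->
  forall A, measurable A ->
  Q (\bigcap_(i in [set` L]) (Z i @^-1` A)) = ((fine (m A)) ^+ size L)%:E.

Hypothesis mZ : forall i, measurable_fun setT (Z i).

(** Expanding a factor [1 + k b] either drops its index or moves it to the list [L] of pure
    indicators, whence the induction. With [k = expR t - 1] the first product is the exponential of
    [t] times a count. *)
Lemma integral_prod_indep (k : R) (b : T -> bool) (J L : seq I) :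
  0 <= k -> measurable_fun setT b -> uniq (J ++ L) -> iid_on (J ++ L) ->
  (\int[Q]_x (\prod_(j <- J) (1 + k * (b (Z j x))%:R) * \prod_(l <- L) (b (Z l x))%:R)%:E
   = ((1 + k * fine (m [set x | b x])) ^+ size J * fine (m [set x | b x]) ^+ size L)%:E)%E.
Proof.
move=> k0 mb; set pi := fine _; elim: J L => [|j J IH] L uJL iid.
  rewrite /= expr0 mul1r -(iid L)//; last exact: measurable_bool.
  rewrite -[X in Q X]setIT -integral_indic//; last first.
    apply: fin_bigcap_measurable => // i _.
    by rewrite -[X in measurable X]setTI; apply: mZ => //; exact: measurable_bool.
  apply: eq_integral => x _; rewrite big_nil mul1r; congr EFin.
  elim: (L) => [|l L' IHL]; first by rewrite big_nil indicE mem_set.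
  rewrite big_cons IHL !indicE; case: (boolP (b (Z l x))) => bl.
    rewrite mul1r; congr (nat_of_bool _)%:R; apply/idP/idP; rewrite !inE => h i /=.
      by rewrite inE => /orP[/eqP->|iL] //; exact: h.
    by move=> iL; apply: h; rewrite /= inE iL orbT.
  rewrite mul0r; case: (boolP (x \in _)) => //; rewrite inE => h; exfalso.
  by move: bl => /negP; apply; apply: (h l); rewrite /= inE eqxx.
have mbZ i : measurable_fun setT (fun x => b (Z i x)) by exact: (measurableT_comp mb (mZ i)).
have pr0 (r : seq I) x : 0 <= \prod_(i <- r) (1 + k * (b (Z i x))%:R).
  by apply: prodr_ge0 => i _; rewrite addr_ge0// mulr_ge0.
have pr0' (r : seq I) x : 0 <= \prod_(i <- r) (b (Z i x))%:R :> R.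
  by apply: prodr_ge0.
transitivity (\int[Q]_x ((\prod_(i <- J) (1 + k * (b (Z i x))%:R) * \prod_(l <- L) (b (Z l x))%:R)%:E
   + k%:E * (\prod_(i <- J) (1 + k * (b (Z i x))%:R) * \prod_(l <- j :: L) (b (Z l x))%:R)%:E))%E.
  apply: eq_integral => x _; rewrite -EFinM -EFinD !big_cons; congr EFin; ring.
have jJL : {subset J ++ j :: L <= (j :: J) ++ L}.
  by move=> i; rewrite !(mem_cat, inE) orbCA orbA.
rewrite ge0_integralD//; first last.
- by meas.
- by move=> x _; rewrite -EFinM lee_fin !mulr_ge0.
- by meas.
- by move=> x _; rewrite lee_fin mulr_ge0.
rewrite ge0_integralZl_EFin//; first last.
- by meas.
- by move=> x _; rewrite lee_fin mulr_ge0.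
rewrite IH; first last.
- by move=> L' uL' sL' A mA; apply: iid => // i /sL' iJL; rewrite /= inE iJL orbT.
- by move: uJL => /= /andP[].
rewrite IH; first last.
- by move=> L' uL' sL' A mA; apply: iid => // i /sL' /jJL.
- by move: uJL; rewrite /= !cat_uniq /= mem_cat !negb_or => /andP[/andP[-> ->] /and3P[-> -> ->]].
by rewrite -EFinM -EFinD /= !exprS; congr EFin; ring.
Qed.

(** From [1 - x <= expR (- x)] and [(1 - x)(1 + x + 2 x^2) = 1 + x^2 (1 - 2 x) >= 1]. *)
Lemma expR_le_quad (x : R) : x <= 2^-1 -> expR x <= 1 + x + 2 * x ^+ 2.
Proof.
move=> x2; have h : 1 - x <= expR (- x) by have := expR_ge1Dx (- x).
have x1 : 0 < 1 - x by lra.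
rewrite -[expR x]invrK -expRN; apply: (@le_trans _ _ (1 - x)^-1).
  by rewrite lef_pV2 ?posrE ?expR_gt0.
rewrite -[leRHS]mulr1 -ler_pdivrMl ?mulr1; last by nra.
rewrite -invfM invf_le1; last by apply: mulr_gt0 => //; nra.
have : 0 <= x ^+ 2 * (1 - 2 * x) by rewrite mulr_ge0 ?sqr_ge0//; lra.
by rewrite expr2; nra.
Qed.

Lemma mgf_centered (b : T -> bool) (J : seq I) (t : R) :
  measurable_fun setT b -> uniq J -> iid_on J -> 0 <= t <= 2^-1 ->
  (\int[Q]_x (expR (t * \sum_(j <- J) ((b (Z j x))%:R - fine (m [set x | b x]))))%:E
   <= (expR (2 * t ^+ 2 * (size J)%:R))%:E)%E.
Proof.
move=> mb uJ iid /andP[t0 t1]; set pi := fine _.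
have mbZ i : measurable_fun setT (fun x => b (Z i x)) by exact: (measurableT_comp mb (mZ i)).
have pi0 : 0 <= pi by exact: fine_ge0.
have pi1 : pi <= 1.
  by rewrite -lee_fin /pi fineK ?fin_num_measure ?probability_le1//; exact: measurable_bool.
have k0 : 0 <= expR t - 1 by rewrite subr_ge0 -expR0 ler_expR.
have kb (c : bool) : expR (t * c%:R) = 1 + (expR t - 1) * c%:R.
  by case: c; rewrite ?mulr1 ?mulr0 ?addr0 ?expR0// addrC subrK.
have eN : expR (t * \sum_(j <- J) (0 - pi)) = expR (- (t * pi)) ^+ size J.
  by rewrite sumr_const_seq -expRM_natl; congr expR; ring.
have fE x : expR (t * \sum_(j <- J) ((b (Z j x))%:R - pi)) =
    expR (- (t * pi)) ^+ size J * (\prod_(j <- J) (1 + (expR t - 1) * (b (Z j x))%:R) *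
      \prod_(l <- [::]) (b (Z l x))%:R).
  rewrite big_nil mulr1 -eN -(eq_bigr _ (fun j _ => kb (b (Z j x)))).
  rewrite -expR_sum -expRD -mulr_sumr -mulrDr -big_split; congr (expR (_ * _)).
  by apply: eq_bigr => j _; rewrite sub0r addrC.
under eq_integral => x _ do rewrite fE EFinM.
rewrite ge0_integralZl_EFin//; first last.
- by meas.
- move=> x _; rewrite lee_fin mulr_ge0// ?big_nil//.
  by apply: prodr_ge0 => i _; rewrite addr_ge0// mulr_ge0.
rewrite integral_prod_indep ?cats0//= -/pi -EFinM lee_fin expr0 mulr1 -exprMn.
rewrite mulrDr mulr1 mulrA mulrBr mulr1 -expRD expRM_natr -[2 * t ^+ 2]/(2 * t ^+ 2).
apply: lerXn2r; rewrite ?nnegrE ?expR_ge0//.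
  have : 0 <= expR (- (t * pi)) by exact: expR_ge0.
  have : 0 <= expR (- (t * pi) + t) by exact: expR_ge0.
  by move=> h1 h2; nra.
apply: (@le_trans _ _ (1 + 2 * t ^+ 2)); last exact: expR_ge1Dx.
have tp : 0 <= t * pi by rewrite mulr_ge0.
have tq : 0 <= t * (1 - pi) by rewrite mulr_ge0// subr_ge0.
have h1 : expR (- (t * pi)) <= 1 + (- (t * pi)) + 2 * (- (t * pi)) ^+ 2.
  by apply: expR_le_quad; lra.
have h2 : expR (- (t * pi) + t) <= 1 + (- (t * pi) + t) + 2 * (- (t * pi) + t) ^+ 2.
  by apply: expR_le_quad; nra.
(* Each factor is an average of two exponentials; in the quadratic bounds the linear terms cancel
   and the square terms add up to [2 t^2 pi (1 - pi)]. *)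
apply: (@le_trans _ _ ((1 - pi) * (1 + (- (t * pi)) + 2 * (- (t * pi)) ^+ 2)
   + pi * (1 + (- (t * pi) + t) + 2 * (- (t * pi) + t) ^+ 2))).
  rewrite [X in X <= _](_ : _ = (1 - pi) * expR (- (t * pi)) + pi * expR (- (t * pi) + t)); last by ring.
  by apply: lerD; apply: ler_wpM2l => //; rewrite subr_ge0.
rewrite -subr_ge0 (_ : _ - _ = 2 * t ^+ 2 * (1 - pi * (1 - pi))); last by ring.
by rewrite !mulr_ge0// ?sqr_ge0//; nra.
Qed.

End binomial_moment.

Section sample.
Context {R : realType} {d dT : measure_display} {Om : measurableType d} {T : measurableType dT}.
Context (Q : probability Om R) (m : probability T R) {I : eqType} (Z : I -> Om -> T).
Hypothesis mZ : forall i, measurable_fun setT (Z i).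

(** With [t = 1 / (2 sqrt N)], [powR_le_expR] bounds the moment of order [q] by [(q / t)^q] times
    the sum of the exponential moments at [t] and [-t], each at most [expR 1]; [(2 q)^q] is
    [(q / t)^q] without its factor [N^(q/2)]. *)
Definition moment_cst (q : R) : R := powR (2 * q) q * (2 * expR 1).

Lemma moment_cst_ge0 q : 0 <= moment_cst q.
Proof. by rewrite /moment_cst !mulr_ge0 ?powR_ge0 ?expR_ge0. Qed.

(** [N] only bounds the size of [J], so that a full sample and a sample with one point left out get
    the same estimate. *)
Lemma centered_moment (b : T -> bool) (J : seq I) (N : nat) (q : R) : 0 < q ->
  measurable_fun setT b -> uniq J -> iid_on Q m Z J -> (0 < N)%N -> (size J <= N)%N ->
  (\int[Q]_x (powR `|\sum_(j <- J) ((b (Z j x))%:R - fine (m [set x | b x]))| q)%:E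
   <= (moment_cst q * powR N%:R (q / 2))%:E)%E.
Proof.
move=> q0 mb uJ iid N0 JN; set pi := fine _.
have NR0 : 0 < N%:R :> R by rewrite ltr0n.
pose t : R := 2^-1 * powR N%:R (- 2^-1).
have tN : t ^+ 2 * N%:R = 4^-1.
  have hN : powR N%:R (- 2^-1) ^+ 2 = N%:R^-1 :> R.
    rewrite -(powR_mulrn 2 (powR_ge0 _ _)) -powRrM (_ : - 2^-1 * 2%:R = -1); last by lra.
    by rewrite powR_inv1 ?ltW.
  by rewrite /t exprMn hN -mulrA mulVf ?gt_eqF// mulr1; lra.
have t0 : 0 < t by rewrite /t mulr_gt0 ?powR_gt0.
have t1 : t <= 2^-1.
  rewrite /t ger_pMr// powRN invf_le1 ?powR_gt0//.
  by rewrite -[leLHS](powRr0 N%:R); apply: ler_powR; rewrite ?ler1n.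
pose S x := \sum_(j <- J) ((b (Z j x))%:R - pi).
have mbZ i : measurable_fun setT (fun x => b (Z i x)) by exact: (measurableT_comp mb (mZ i)).
have mS : measurable_fun setT S by rewrite /S; meas.
(* [mgf_centered] is for nonnegative [t]; the lower tail comes from the complementary event, whose
   centered count is [- S]. *)
pose b' x := ~~ b x.
have mb' : measurable_fun setT b' by exact: measurable_neg.
have S'E x : \sum_(j <- J) ((b' (Z j x))%:R - fine (m [set x | b' x])) = - S x.
  rewrite /S -sumrN; apply: eq_bigr => j _.
  have -> : fine (m [set x | b' x]) = 1 - pi.
    rewrite (_ : [set x | b' x] = ~` [set x | b x]); last first.
      by apply/seteqP; split => y /=; rewrite /b' => /negP.
    rewrite probability_setC; last exact: measurable_bool.
    by rewrite fineB ?fin_num_measure//; exact: measurable_bool.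
  by rewrite /b'; case: (b _) => /=; ring.
have h1 := @mgf_centered _ _ _ _ _ Q m I Z mZ b J t mb uJ iid.
have h2 := @mgf_centered _ _ _ _ _ Q m I Z mZ b' J t mb' uJ iid.
have te : expR (2 * t ^+ 2 * (size J)%:R) <= expR 1.
  rewrite ler_expR; apply: (@le_trans _ _ (2 * t ^+ 2 * N%:R)).
    by rewrite ler_wpM2l ?mulr_ge0 ?sqr_ge0// ler_nat.
  by rewrite -mulrA tN; lra.
pose c := powR q q * powR t^-1 q.
have c0 : 0 <= c by rewrite mulr_ge0 ?powR_ge0.
apply: (@le_trans _ _ (\int[Q]_x (c%:E * ((expR (t * S x))%:E + (expR (t * - S x))%:E)))%E).
  apply: ge0_le_integral_nomeas => x _; first by rewrite lee_fin powR_ge0.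
  rewrite -EFinD -EFinM lee_fin -/(S x).
  have -> : `|S x| = t^-1 * `|t * S x|.
    by rewrite normrM (gtr0_norm t0) mulKf ?gt_eqF.
  rewrite powRM ?invr_ge0 ?(ltW t0)//.
  set E := expR _ + expR _; rewrite (_ : c * E = powR t^-1 q * (powR q q * E)); last by rewrite /c; ring.
  rewrite ler_wpM2l ?powR_ge0//; apply: le_trans (powR_le_expR _ q q0 (normr_ge0 _)) _.
  rewrite ler_wpM2l ?powR_ge0// /E; case: (leP 0 (t * S x)) => h.
    by rewrite ger0_norm// lerDl expR_ge0.
  by rewrite ltr0_norm// mulrN lerDr expR_ge0.
rewrite ge0_integralZl_EFin//; first last.
- by apply: emeasurable_funD; meas.
- by move=> x _; rewrite -EFinD lee_fin addr_ge0 ?expR_ge0.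
rewrite ge0_integralD//; try by meas.
apply: (@le_trans _ _ (c%:E * ((expR 1)%:E + (expR 1)%:E))%E).
  rewrite lee_wpmul2l ?lee_fin//; apply: leeD.
    by apply: le_trans (h1 _) _; rewrite ?(ltW t0) ?t1 ?lee_fin.
  under eq_integral => x _ do rewrite -S'E.
  by apply: le_trans (h2 _) _; rewrite ?(ltW t0) ?t1 ?lee_fin.
rewrite -EFinD -EFinM lee_fin le_eqVlt; apply/orP; left; apply/eqP.
have te' : t^-1 = 2 * powR N%:R 2^-1 by rewrite /t invfM invrK -powRN opprK.
rewrite /c /moment_cst te' (powRM q (ler0n _ 2) (powR_ge0 _ _)) (powRM q (ler0n _ 2) (ltW q0)).
by rewrite -powRrM [2^-1 * q]mulrC; ring.
Qed.

End sample.

(** * Moments of the rank error *)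

Section affine_integral.
Context {R : realType} {d : measure_display} {Om : measurableType d} (Q : probability Om R).
Local Open Scope ereal_scope.

Lemma integral_affineD (k : R) (a : \bar R) (f g : Om -> \bar R) : (0 <= k)%R -> 0 <= a ->
  measurable_fun setT f -> measurable_fun setT g -> (forall x, 0 <= f x) -> (forall x, 0 <= g x) ->
  \int[Q]_x (k%:E * (a + (f x + g x))) = k%:E * (a + (\int[Q]_x f x + \int[Q]_x g x)).
Proof.
move=> k0 a0 mf mg f0 g0.
have fg0 x : 0 <= f x + g x by rewrite adde_ge0.
have mfg : measurable_fun setT (fun x => f x + g x) by exact: (emeasurable_funD mf mg).
have ma : measurable_fun setT (fun _ : Om => a) by exact: measurable_cst.
have mafg : measurable_fun setT (fun x => a + (f x + g x)) by exact: (emeasurable_funD ma mfg).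
rewrite ge0_integralZl_EFin//; last by move=> x _; rewrite adde_ge0.
rewrite ge0_integralD//; congr (_ * (_ + _)).
  by rewrite integral_cst// [X in a * X]probability_setT mule1.
by rewrite ge0_integralD.
Qed.

Lemma integral_sum3_le (M : \bar R) (f1 f2 f3 : Om -> \bar R) :
  measurable_fun setT f1 -> measurable_fun setT f2 -> measurable_fun setT f3 ->
  (forall x, 0 <= f1 x) -> (forall x, 0 <= f2 x) -> (forall x, 0 <= f3 x) ->
  \int[Q]_x f1 x <= M -> \int[Q]_x f2 x <= M -> \int[Q]_x f3 x <= M ->
  \int[Q]_x (f1 x + (f2 x + f3 x)) <= M + (M + M).
Proof.
move=> m1 m2 m3 p1 p2 p3 h1 h2 h3.
have m23 : measurable_fun setT (fun x => f2 x + f3 x) by exact: (emeasurable_funD m2 m3).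
have p23 x : 0 <= f2 x + f3 x by rewrite adde_ge0.
by rewrite ge0_integralD// leeD// ge0_integralD// leeD.
Qed.

End affine_integral.

Section rank_moment.
Context {R : realType} {d dT : measure_display} {Om : measurableType d} {T : measurableType dT}.
Context (Q : probability Om R) (m : probability T R) {I : eqType} (Z : I -> Om -> T).
Context (phi D : T -> R) (Lam q : R).
Hypothesis mZ : forall i, measurable_fun setT (Z i).
Hypothesis mphi : measurable_fun setT phi.
Hypothesis mD : measurable_fun setT D.
Hypothesis D0 : forall x, 0 <= D x.
Hypothesis Lam0 : 0 < Lam.
Hypothesis q1 : 1 <= q.
Hypothesis density : forall c e : R, c <= e ->
  (m [set x | (c <= phi x <= e)%R] <= (Lam * (e - c))%:E)%E.

Let q0 : 0 < q. Proof. exact: lt_le_trans q1. Qed.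

Let near t := fine (m [set x | `|phi x - t| <= 2 * D x]).
Let cdf t := fine (m [set x | phi x <= t]).

Let close x x' : R := ((`|phi x' - phi x| <= 2 * D x')%R)%:R * powR (D x') (q - 1).
Let Hq x : \bar R := (\int[m]_x' (close x x')%:E)%E.

Let close0 x x' : 0 <= close x x'. Proof. by rewrite mulr_ge0 ?powR_ge0. Qed.

Let mf1 {d'} {T' : measurableType d'} (f : T' -> T) : measurable_fun setT f ->
  measurable_fun setT (fun x => phi (f x)).
Proof. by move=> mf; apply: (measurableT_comp mphi). Qed.

Let mf2 {d'} {T' : measurableType d'} (f : T' -> T) : measurable_fun setT f ->
  measurable_fun setT (fun x => D (f x)).
Proof. by move=> mf; apply: (measurableT_comp mD). Qed.

Let mclose : measurable_fun setT (fun z : T * T => (close z.1 z.2)%:E).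
Proof. by rewrite /close; meas; first [apply: mf1|apply: mf2]. Qed.

Let window_le t r : 0 <= r -> fine (m [set x | `|phi x - t| <= r]) <= 2 * Lam * r.
Proof.
move=> r0; rewrite -lee_fin fineK; last first.
  by rewrite fin_num_measure//; apply: measurable_bool; meas.
rewrite (_ : [set x | _] = [set x | t - r <= phi x <= t + r]); last first.
  by apply/seteqP; split => x /=; rewrite ler_distl.
apply: le_trans (density _ _ _) _; first by lra.
by rewrite lee_fin; lra.
Qed.

(* With [r = near t / (8 Lam)], at most half of the mass counted by [near t] sits at points with [D <= r], since these all lie in a window of width [4 r]. *)
Let near_le t : ((powR (near t) q)%:E <= (2 * powR (8 * Lam) (q - 1))%:E *
  \int[m]_x' (((`|phi x' - t| <= 2 * D x')%R)%:R * powR (D x') (q - 1))%:E)%E.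
Proof.
have n0 : 0 <= near t by exact: fine_ge0.
have L8 : 0 < 8 * Lam by rewrite mulr_gt0.
pose r := near t / (8 * Lam).
have r0 : 0 <= r by rewrite divr_ge0// ltW.
pose A := [set x | `|phi x - t| <= 2 * D x].
pose B := [set x | `|phi x - t| <= 2 * r].
pose C := [set x | (`|phi x - t| <= 2 * D x) && (r < D x)].
have mA : measurable A by apply: measurable_bool; meas.
have mB : measurable B by apply: measurable_bool; meas.
have mC : measurable C by apply: measurable_bool; meas.
have AB : (m A <= m B + m C)%E.
  apply: le_trans (measureU2 _ mB mC); apply: le_measure; rewrite ?inE//.
    exact: measurableU.
  move=> x Ax; have [Dr|rD] := leP (D x) r.
    by left; rewrite /B /=; apply: le_trans Ax _; rewrite ler_pM2l.
  by right; rewrite /C /= rD andbT.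
have hC : near t / 2 <= fine (m C).
  have hB := window_le t (2 * r) (mulr_ge0 (ler0n _ 2) r0).
  have : near t <= fine (m B) + fine (m C).
    by rewrite -lee_fin EFinD !fineK ?fin_num_measure.
  have : 2 * Lam * (2 * r) = near t / 2 by rewrite /r; field; rewrite gt_eqF.
  by rewrite -/B in hB; lra.
have intC : ((powR r (q - 1) * (near t / 2))%:E <=
    \int[m]_x' (((`|phi x' - t| <= 2 * D x')%R)%:R * powR (D x') (q - 1))%:E)%E.
  apply: (@le_trans _ _ (\int[m]_x' ((powR r (q - 1))%:E * (\1_C x')%:E))%E).
    rewrite ge0_integralZl_EFin ?powR_ge0//; last by apply: mf_EFin; exact: measurable_indic.
    rewrite integral_indic// setIT EFinM lee_wpmul2l ?lee_fin ?powR_ge0//.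
    by rewrite -[leRHS]fineK ?fin_num_measure// lee_fin.
  apply: ge0_le_integral_nomeas => x' _; first by rewrite -EFinM lee_fin mulr_ge0 ?powR_ge0.
  rewrite -EFinM lee_fin indicE; case: (boolP (x' \in C)) => [|_]; last first.
    by rewrite mulr0 mulr_ge0 ?powR_ge0.
  rewrite inE /C /= => /andP[-> rD]; rewrite mulr1 mul1r.
  by apply: ge0_ler_powR; rewrite ?nnegrE ?subr_ge0// ltW.
apply: le_trans (lee_wpmul2l _ intC); last by rewrite lee_fin mulr_ge0 ?powR_ge0.
rewrite -EFinM lee_fin le_eqVlt; apply/orP; left; apply/eqP.
have -> : powR (near t) q = near t * powR (near t) (q - 1) by rewrite mulr_powRB1.
have {2}-> : near t = 8 * Lam * r by rewrite /r; field; rewrite gt_eqF.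
by rewrite powRM ?(ltW L8)//; field.
Qed.

(** After the exchange of integrals, [phi x] ranges over a window of radius [2 D x'] around
    [phi x'], of mass at most [4 Lam D x']; this factor completes [D^(q-1)] to [D^q]. *)
Let int_Hq : (\int[m]_x Hq x <= (4 * Lam)%:E * \int[m]_x (powR (D x) q)%:E)%E.
Proof.
rewrite /Hq (fubini_tonelli (fun z : T * T => (close z.1 z.2)%:E) mclose)/=; last first.
  by move=> z; rewrite lee_fin close0.
have L4 : 0 <= 4 * Lam by rewrite mulr_ge0// ltW.
rewrite -ge0_integralZl_EFin//; side.
apply: ge0_le_integral_nomeas => x' _.
  by apply: integral_ge0 => x _; rewrite lee_fin close0.
rewrite /close; under eq_integral => x _ do rewrite mulrC EFinM.
rewrite ge0_integralZl_EFin ?powR_ge0//; last by meas.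
rewrite (_ : (\int[m]_x _)%E = m [set x | `|phi x - phi x'| <= 2 * D x']); last first.
  rewrite -[X in m X]setIT -integral_indic//; last by apply: measurable_bool; meas.
  by apply: eq_integral => x _; rewrite indicE mem_setE distrC.
have h := window_le (phi x') (2 * D x') (mulr_ge0 (ler0n _ 2) (D0 x')).
rewrite -[X in (_ * X <= _)%E]fineK; last first.
  by rewrite fin_num_measure//; apply: measurable_bool; meas.
rewrite -!EFinM lee_fin -(mulr_powRB1 (D0 x') q0) mulrA [leLHS]mulrC ler_wpM2r ?powR_ge0//.
by lra.
Qed.

(** The factor [6^q] splits six terms: the additive [2 / N], three centered counts, the mass of a
    window of radius [2 D x] (whence [4 Lam]), and [near], bounded by [near_le] followed by
    [int_Hq]. *)
Definition rank_cst : R := powR 6 q *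
  (powR 2 q + 3 * moment_cst q + powR (4 * Lam) q + 2 * powR (8 * Lam) (q - 1) * (4 * Lam)).

(** A point at distance at most [D_j + D] is at distance at most [2 D] or at most [2 D_j]. For fixed
    [x] the rank error is therefore bounded by three counts of single events; each is centered, and
    the means of the last two are a window mass and [near]. *)
Lemma rank_moment (J : seq I) (N : nat) : uniq J -> iid_on Q m Z J -> (0 < N)%N -> (size J <= N)%N ->
  (\int[m]_x \int[Q]_om
     (powR ((2 + rank_err J (fun j => phi (Z j om)) (fun j => D (Z j om)) (cdf (phi x)) (phi x) (D x))
            / N%:R) q)%:E
   <= rank_cst%:E * ((powR N%:R (- (q / 2)))%:E + \int[m]_x (powR (D x) q)%:E))%E.
Proof.
move=> uJ iid N0 JN.
have NR0 : 0 < N%:R :> R by rewrite ltr0n.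
have Nq0 : 0 <= powR N%:R^-1 q :> R by exact: powR_ge0.
pose b1 x x' := phi x' <= phi x.
pose b2 x x' := `|phi x' - phi x| <= 2 * D x.
pose b3 x x' := `|phi x' - phi x| <= 2 * D x'.
pose Sb (b : T -> T -> bool) x om := \sum_(j <- J) ((b x (Z j om))%:R - fine (m [set x' | b x x'])).
have mb1 x : measurable_fun setT (b1 x) by rewrite /b1; meas.
have mb2 x : measurable_fun setT (b2 x) by rewrite /b2; meas.
have mb3 x : measurable_fun setT (b3 x) by rewrite /b3; meas.
have mS (b : T -> T -> bool) x : measurable_fun setT (b x) -> measurable_fun setT (Sb b x).
  move=> mb; rewrite /Sb; meas; exact: (measurableT_comp mb (mZ _)).
have mom (b : T -> T -> bool) x : measurable_fun setT (b x) ->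
    (\int[Q]_om ((powR N%:R^-1 q)%:E * (powR `|Sb b x om| q)%:E) <=
     (moment_cst q * powR N%:R (- (q / 2)))%:E)%E.
  move=> mb; have mSb := mS b x mb; rewrite ge0_integralZl_EFin//; side.
  apply: le_trans (lee_wpmul2l _ (@centered_moment _ _ _ _ _ Q m I Z mZ (b x) J N q q0 mb uJ iid N0 JN)) _.
    by rewrite lee_fin.
  rewrite -EFinM lee_fin mulrCA ler_wpM2l ?moment_cst_ge0//.
  rewrite -(powR_inv1 (ltW NR0)) -powRrM -powRD; last by rewrite (gt_eqF NR0) implybT.
  by apply: ler_powR; [rewrite ler1n|lra].
pose A x := (powR 2 q * powR N%:R (- (q / 2)) + powR (4 * Lam) q * powR (D x) q)%:E.
pose G x := ((2 * powR (8 * Lam) (q - 1))%:E * Hq x)%E.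
have mHq : measurable_fun setT Hq.
  by apply: (measurable_fun_fubini_tonelli_F _ mclose) => z; rewrite lee_fin close0.
have Hq0 x : (0 <= Hq x)%E by apply: integral_ge0 => x' _; rewrite lee_fin close0.
have G0 x : (0 <= G x)%E by rewrite mule_ge0// lee_fin mulr_ge0 ?powR_ge0.
have A0 x : (0 <= A x)%E by rewrite lee_fin addr_ge0 ?mulr_ge0 ?powR_ge0.
have pw x om : ((powR ((2 + rank_err J (fun j => phi (Z j om)) (fun j => D (Z j om)) (cdf (phi x)) (phi x) (D x))
            / N%:R) q)%:E <= (powR 6 q)%:E * ((A x + G x) +
   ((powR N%:R^-1 q)%:E * (powR `|Sb b1 x om| q)%:E + ((powR N%:R^-1 q)%:E * (powR `|Sb b2 x om| q)%:E +
    (powR N%:R^-1 q)%:E * (powR `|Sb b3 x om| q)%:E))))%E.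
  have nl := near_le (phi x); rewrite -/(Hq x) -/(G x) in nl.
  apply: (@le_trans _ _ ((powR 6 q)%:E * ((A x + (powR (near (phi x)) q)%:E) +
   ((powR N%:R^-1 q)%:E * (powR `|Sb b1 x om| q)%:E + ((powR N%:R^-1 q)%:E * (powR `|Sb b2 x om| q)%:E +
    (powR N%:R^-1 q)%:E * (powR `|Sb b3 x om| q)%:E))))%E); last first.
    by rewrite lee_wpmul2l ?lee_fin ?powR_ge0// leeD// leeD.
  rewrite [X in (_ <= X)%E](_ : _ = (powR 6 q * ((powR 2 q * powR N%:R (- (q / 2)) +
    powR (4 * Lam) q * powR (D x) q + powR (near (phi x)) q) + (powR N%:R^-1 q * powR `|Sb b1 x om| q
    + (powR N%:R^-1 q * powR `|Sb b2 x om| q + powR N%:R^-1 q * powR `|Sb b3 x om| q))))%:E)//.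
  rewrite lee_fin.
  pose l := [:: 2 / N%:R; 4 * Lam * D x; near (phi x);
     N%:R^-1 * `|Sb b1 x om|; N%:R^-1 * `|Sb b2 x om|; N%:R^-1 * `|Sb b3 x om|].
  have l0 y : y \in l -> 0 <= y.
    rewrite !inE => /or4P[/eqP->|/eqP->|/eqP->|/or3P[|/eqP->|/eqP->]].
    - by rewrite divr_ge0.
    - by rewrite !mulr_ge0// ltW.
    - exact: fine_ge0.
    - by move=> /eqP->; rewrite mulr_ge0// invr_ge0 ltW.
    - by rewrite mulr_ge0// invr_ge0 ltW.
    - by rewrite mulr_ge0// invr_ge0 ltW.
  have NI0 : 0 <= N%:R^-1 :> R by rewrite invr_ge0 ltW.
  have := powR_sum_le l id q q0 l0; rewrite /l /= !big_cons !big_nil !addr0.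
  rewrite (powRM q NI0 (normr_ge0 (Sb b1 x om))) (powRM q NI0 (normr_ge0 (Sb b2 x om)))
    (powRM q NI0 (normr_ge0 (Sb b3 x om))).
  rewrite (powRM q (mulr_ge0 (ler0n _ 4) (ltW Lam0)) (D0 x)).
  rewrite (powRM q (ler0n _ 2) NI0).
  have p2 : powR N%:R^-1 q <= powR N%:R (- (q / 2)) :> R.
    rewrite -(powR_inv1 (ltW NR0)) -powRrM; apply: ler_powR; first by rewrite ler1n.
    by have := q0; lra.
  move=> h; apply: le_trans (le_trans h _); last first.
    rewrite ler_wpM2l ?powR_ge0//.
    have : powR 2 q * powR N%:R^-1 q <= powR 2 q * powR N%:R (- (q / 2)) :> R.
      by rewrite ler_wpM2l ?powR_ge0.
    by lra.
  have sz : (size J)%:R <= N%:R :> R by rewrite ler_nat.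
  have re0 : 0 <= rank_err J (fun j => phi (Z j om)) (fun j => D (Z j om)) (cdf (phi x)) (phi x) (D x).
    by rewrite /rank_err addr_ge0 ?sumr_ge0.
  apply: ge0_ler_powR; rewrite ?nnegrE ?(ltW q0)//.
  - by apply: divr_ge0 => //; apply: addr_ge0.
  - have Ln := ltW Lam0; have nn : 0 <= near (phi x) by exact: fine_ge0.
    by have Dx := D0 x; nneg.
  rewrite ler_pdivrMr// [X in _ <= X](_ : _ = 2 + (N%:R * (4 * Lam * D x) + N%:R * near (phi x)
     + `|Sb b1 x om| + `|Sb b2 x om| + `|Sb b3 x om|)); last by field; rewrite gt_eqF.
  have c2 : \sum_(j <- J) (b2 x (Z j om))%:R <= `|Sb b2 x om| + N%:R * (4 * Lam * D x).
    have -> : \sum_(j <- J) (b2 x (Z j om))%:R = Sb b2 x om + (size J)%:R * fine (m [set x' | b2 x x']).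
      by rewrite /Sb sumrB sumr_const_seq subrK.
    apply: lerD; first exact: ler_norm.
    apply: ler_pM => //; first exact: fine_ge0.
    apply: le_trans (window_le _ _ _) _; first by rewrite mulr_ge0.
    by lra.
  have c3 : \sum_(j <- J) (b3 x (Z j om))%:R <= `|Sb b3 x om| + N%:R * near (phi x).
    have -> : \sum_(j <- J) (b3 x (Z j om))%:R = Sb b3 x om + (size J)%:R * near (phi x).
      by rewrite /Sb sumrB sumr_const_seq subrK.
    apply: lerD; first exact: ler_norm.
    by apply: ler_wpM2r => //; exact: fine_ge0.
  have c1 : rank_err J (fun j => phi (Z j om)) (fun j => D (Z j om)) (cdf (phi x)) (phi x) (D x)
     <= `|Sb b1 x om| + (\sum_(j <- J) (b2 x (Z j om))%:R + \sum_(j <- J) (b3 x (Z j om))%:R).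
    rewrite /rank_err lerD2l -big_split; apply: ler_sum => j _ /=.
    rewrite /b2 /b3 -natrD ler_nat; case: (leP `|_| (D _ + D x)) => //= h1.
    by case: (leP `|_| (2 * D x)) => //= h2; case: (leP `|_| (2 * D _)) => //= h3; lra.
  by lra.
apply: (@le_trans _ _ (\int[m]_x ((powR 6 q)%:E * ((A x + G x) +
   (3 * (moment_cst q * powR N%:R (- (q / 2))))%:E)))%E).
  apply: ge0_le_integral_nomeas => x _.
    by apply: integral_ge0 => om _; rewrite lee_fin powR_ge0.
  apply: le_trans (ge0_le_integral_nomeas _ _ _ _ _ (fun om _ => pw x om)) _.
    by move=> om _; rewrite lee_fin powR_ge0.
  have mX (b : T -> T -> bool) : measurable_fun setT (b x) ->
      measurable_fun setT (fun om => (powR N%:R^-1 q)%:E * (powR `|Sb b x om| q)%:E)%E.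
    by move=> /mS mb; apply: measurable_funeM; meas.
  have pX (b : T -> T -> bool) om : (0 <= (powR N%:R^-1 q)%:E * (powR `|Sb b x om| q)%:E)%E.
    by rewrite -EFinM lee_fin mulr_ge0 ?powR_ge0.
  have m1 := mX _ (mb1 x); have m2 := mX _ (mb2 x); have m3 := mX _ (mb3 x).
  have p1 := pX b1; have p2 := pX b2; have p3 := pX b3.
  have m23 : measurable_fun setT (fun om => (powR N%:R^-1 q)%:E * (powR `|Sb b2 x om| q)%:E +
      (powR N%:R^-1 q)%:E * (powR `|Sb b3 x om| q)%:E)%E by exact: (emeasurable_funD m2 m3).
  have AG0 : (0 <= A x + G x)%E by rewrite adde_ge0.
  have p23 om : (0 <= (powR N%:R^-1 q)%:E * (powR `|Sb b2 x om| q)%:E +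
      (powR N%:R^-1 q)%:E * (powR `|Sb b3 x om| q)%:E)%E by rewrite adde_ge0.
  rewrite (integral_affineD Q _ _ _ _ (powR_ge0 _ _) AG0 m1 m23 p1 p23).
  apply: lee_wpmul2l; first by rewrite lee_fin powR_ge0.
  apply: leeD2l.
  rewrite -(ge0_integralD Q measurableT (fun om _ => p1 om) m1 (fun om _ => p23 om) m23).
  have -> : (3 * (moment_cst q * powR N%:R (- (q / 2))))%:E =
     ((moment_cst q * powR N%:R (- (q / 2)))%:E + ((moment_cst q * powR N%:R (- (q / 2)))%:E
       + (moment_cst q * powR N%:R (- (q / 2)))%:E))%E by rewrite -!EFinD; congr EFin; ring.
  exact: (integral_sum3_le Q _ _ _ _ m1 m2 m3 p1 p2 p3 (mom _ _ (mb1 x)) (mom _ _ (mb2 x)) (mom _ _ (mb3 x))).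
have mA : measurable_fun setT A by rewrite /A; meas.
have mG : measurable_fun setT G by apply: measurable_funeM.
have c0 : (0 <= (3 * (moment_cst q * powR N%:R (- (q / 2))))%:E :> \bar R)%E.
  by rewrite lee_fin !mulr_ge0 ?moment_cst_ge0 ?powR_ge0.
under eq_integral => x _ do rewrite [(A x + G x + _)%E]addeC.
rewrite integral_affineD ?powR_ge0//.
set ID := (\int[m]_x (powR (D x) q)%:E)%E.
have ID0 : (0 <= ID)%E by apply: integral_ge0 => x _; rewrite lee_fin powR_ge0.
have -> : (\int[m]_x A x = (powR 2 q * powR N%:R (- (q / 2)))%:E + (powR (4 * Lam) q)%:E * ID)%E.
  rewrite /A; under eq_integral => x _ do rewrite EFinD [X in (_ + X)%E]EFinM.
  rewrite ge0_integralD//; side.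
  by rewrite integral_cst// [X in (_ * X + _)%E]probability_setT mule1 ge0_integralZl_EFin ?powR_ge0//; side.
have intG : (\int[m]_x G x <= (2 * powR (8 * Lam) (q - 1) * (4 * Lam))%:E * ID)%E.
  rewrite /G ge0_integralZl_EFin//; last by rewrite mulr_ge0 ?powR_ge0.
  rewrite (_ : ((2 * powR (8 * Lam) (q - 1) * (4 * Lam))%:E * ID =
     (2 * powR (8 * Lam) (q - 1))%:E * ((4 * Lam)%:E * ID))%E); last by rewrite muleA -EFinM.
  by rewrite lee_wpmul2l// lee_fin mulr_ge0 ?powR_ge0.
set P := powR N%:R (- (q / 2)).
have P0 : 0 <= P by exact: powR_ge0.
have M0 := moment_cst_ge0 q.
have L40 : 0 <= 2 * powR (8 * Lam) (q - 1) * (4 * Lam) by rewrite !mulr_ge0 ?powR_ge0// ltW.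
have c40 : 0 <= powR (4 * Lam) q by exact: powR_ge0.
have c20 : 0 <= powR 2 q :> R by exact: powR_ge0.
rewrite /rank_cst; set s0 := _ + _ + _ + _.
rewrite (_ : ((powR 6 q * s0)%:E * (P%:E + ID) = (powR 6 q)%:E * (s0%:E * (P%:E + ID)))%E); last first.
  by rewrite muleA -EFinM.
rewrite lee_wpmul2l ?lee_fin ?powR_ge0// {}/s0.
(* If [D] has an infinite moment of order [q], the right-hand side is infinite because its constant
   is positive. *)
case: ID ID0 intG => [r| |]; rewrite ?lee_fin => r0 intG //; last first.
  rewrite [X in (_ <= X)%E](_ : _ = +oo%E) ?leey//.
  rewrite addey// gt0_muley// lte_fin.
  have : 0 < powR 2 q :> R by exact: powR_gt0.
  by move: M0 c40 L40; lra.
apply: (@le_trans _ _ ((3 * (moment_cst q * P))%:E + ((powR 2 q * P)%:E + (powR (4 * Lam) q)%:E * r%:E +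
  (2 * powR (8 * Lam) (q - 1) * (4 * Lam))%:E * r%:E))%E).
  by apply: leeD => //; apply: leeD.
do 4 rewrite -?EFinM -?EFinD; rewrite lee_fin.
set a := moment_cst q in M0 *; set b := powR 2 q in c20 *; set c := powR (4 * Lam) q in c40 *.
set e := 2 * powR _ _ * _ in L40 *.
have ? := mulr_ge0 c20 r0; have ? := mulr_ge0 M0 r0; have ? := mulr_ge0 c40 P0.
have ? := mulr_ge0 L40 P0.
by lra.
Qed.

End rank_moment.

(** * Pointwise bounds *)

Section pointwise.
Context {R : realType}.

Lemma size_index_ord n : size (index_enum 'I_n) = n.
Proof. by rewrite -sum1_size -[RHS]card_ord -sum1_card; apply: eq_bigl. Qed.

Definition emp_rank {n} (y : 'I_n -> R) (u y0 : R) : R :=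
  (n%:R + 1)^-1 * (\sum_(i < n) ((y i < y0)%R)%:R + u * (1 + \sum_(i < n) ((y i == y0)%R)%:R)).

Lemma emp_rank_in01 {n} (y : 'I_n -> R) (u y0 : R) : 0 < u <= 1 -> 0 < emp_rank y u y0 <= 1.
Proof.
move=> /andP[u0 u1]; have n0 : 0 < n%:R + 1 :> R by rewrite ltr_wpDl.
have s1 : 0 <= \sum_(i < n) ((y i < y0)%R)%:R :> R by rewrite sumr_ge0.
have s2 : 0 <= \sum_(i < n) ((y i == y0)%R)%:R :> R by rewrite sumr_ge0.
have s3 : \sum_(i < n) ((y i < y0)%R)%:R + \sum_(i < n) ((y i == y0)%R)%:R <= n%:R :> R.
  rewrite -big_split -[X in _ <= X%:R](card_ord n) -sumr_const; apply: ler_sum => i _ /=.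
  by case: ltgtP; rewrite ?addr0 ?add0r.
apply/andP; split.
  by rewrite mulr_gt0 ?invr_gt0// ltr_wpDl// mulr_gt0// ltr_wpDr.
rewrite /emp_rank ler_pdivrMl// mulr1.
have : u * (1 + \sum_(i < n) ((y i == y0)%R)%:R) <= 1 + \sum_(i < n) ((y i == y0)%R)%:R.
  by rewrite ler_piMl// addr_ge0.
by lra.
Qed.

(** Multiplied by [n + 1], the error is that of a value between the strict and the weak count, plus
    [u - F], which lies in [-1, 1] and is absorbed by the [2]. *)
Lemma emp_rank_err {n} (y T D : 'I_n -> R) (u y0 t0 D0 F : R) : (0 < n)%N ->
  0 < u <= 1 -> 0 <= F <= 1 -> (forall i, `|y i - T i| <= D i) -> `|y0 - t0| <= D0 ->
  `|emp_rank y u y0 - F| <= (2 + rank_err (index_enum 'I_n) T D F t0 D0) / n%:R.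
Proof.
move=> n0 /andP[u0 u1] /andP[F0 F1] hD hD0.
have nR : 0 < n%:R :> R by rewrite ltr0n.
set e := rank_err _ _ _ _ _ _.
have e0 : 0 <= e by rewrite /e /rank_err addr_ge0// sumr_ge0.
pose lt := \sum_(i < n) ((y i < y0)%R)%:R : R.
pose le := \sum_(i < n) ((y i <= y0)%R)%:R : R.
pose eq := \sum_(i < n) ((y i == y0)%R)%:R : R.
have leE : le = lt + eq.
  by rewrite /le /lt /eq -big_split; apply: eq_bigr => i _ /=; case: ltgtP; rewrite ?addr0 ?add0r.
have eq0 : 0 <= eq by rewrite /eq sumr_ge0.
have sz : (size (index_enum 'I_n))%:R = n%:R :> R by rewrite size_index_ord.
have lele : lt <= le by rewrite leE lerDl.
have h1 : `|lt - n%:R * F| <= e.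
  by rewrite -sz; apply: (rank_err_bound _ _ _ _ _ _ _ _ _ hD hD0); rewrite lexx.
have h2 : `|le - n%:R * F| <= e.
  by rewrite -sz; apply: (rank_err_bound _ _ _ _ _ _ _ _ _ hD hD0); rewrite lexx andbT.
rewrite ler_pdivlMr//.
have n1 : 0 < n%:R + 1 :> R by rewrite ltr_wpDl.
have -> : emp_rank y u y0 - F = (n%:R + 1)^-1 * (lt + u * (1 + eq) - (n%:R + 1) * F).
  by rewrite /emp_rank -/lt -/eq; field; rewrite gt_eqF.
rewrite normrM gtr0_norm ?invr_gt0// mulrAC -[leRHS]mul1r; apply: ler_pM => //.
- by rewrite ler_pdivrMl// mulr1 lerDl.
have ue : 0 <= u * eq <= eq by rewrite mulr_ge0 ?(ltW u0)// ler_piMl.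
by move: h1 h2 ue; rewrite leE !ler_norml => /andP[? ?] /andP[? ?] /andP[? ?]; apply/andP; split; lra.
Qed.

Section quantile_point.
Context {n : nat} (y T D : 'I_n -> R) (F : R -> R) (a b L q : R).
Hypothesis n0 : (0 < n)%N.
Hypothesis q1 : 1 <= q.
Hypothesis (F_nd : forall x y, x <= y -> F x <= F y).
Hypothesis (F01 : forall x, 0 <= F x <= 1).
Hypothesis (F_lo : forall x, x < a -> F x <= 0).
Hypothesis (F_hi : forall x, b <= x -> 1 <= F x).
Hypothesis (L0 : 0 <= L).
Hypothesis (F_lip : forall x y, a <= x -> x <= y -> y <= b -> y - x <= L * (F y - F x)).
Hypothesis hD : forall i, `|y i - T i| <= D i.
Hypothesis hT : forall i, a <= T i <= b.

Let q0 : 0 < q. Proof. exact: lt_le_trans q1. Qed.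

(* Rank error at the sample point [i], with that point left out of its own sample *)
Definition loo_err (F : R -> R) (T D : 'I_n -> R) (i : 'I_n) : R :=
  rank_err [seq j <- index_enum 'I_n | j != i] T D (F (T i)) (T i) (D i).

(** Bounds the [q]-th power of the distance from [y i] to [ginv F v] for every level [v] in the cell
    of [i]: the triangle inequality passes through [T i], and [L] converts the rank error into a
    distance. *)
Definition cell_cost (i : 'I_n) : R :=
  powR 2 q * (powR (D i) q + powR L q * powR ((2 + loo_err F T D i) / n%:R) q).

(* The empirical quantile at level [v] is a sample point whose cell [cell_lo i, cell_hi i] contains [v]; tied points share a cell. *)
Definition cell_lo (i : 'I_n) : R := (\sum_(l < n) ((y l < y i)%R)%:R) / n%:R.
Definition cell_hi (i : 'I_n) : R := (\sum_(l < n) ((y l <= y i)%R)%:R) / n%:R.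
Definition cell_mult (i : 'I_n) : R := \sum_(l < n) ((y l == y i)%R)%:R.

Let D0 i : 0 <= D i. Proof. exact: le_trans (hD i). Qed.

Lemma loo_err_ge0 i : 0 <= loo_err F T D i.
Proof. by rewrite /loo_err /rank_err addr_ge0// sumr_ge0. Qed.

Lemma cell_cost_ge0 i : 0 <= cell_cost i.
Proof. by rewrite /cell_cost mulr_ge0 ?addr_ge0 ?mulr_ge0 ?powR_ge0. Qed.

(** The point [i] itself adds 0 to the strict count and 1 to the weak one; up to this unit both ends
    of the cell are ranks in the sample without [i]. *)
Lemma cell_dist i v : cell_lo i <= v <= cell_hi i -> `|F (T i) - v| <= (2 + loo_err F T D i) / n%:R.
Proof.
have nR : 0 < n%:R :> R by rewrite ltr0n.
rewrite /cell_lo /cell_hi ler_pdivrMr// ler_pdivlMr// => /andP[v1 v2].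
rewrite ler_pdivlMr// -[X in _ * X](gtr0_norm nR) -normrM mulrBl distrC.
pose J := [seq j <- index_enum 'I_n | j != i].
have split (c : R -> R -> bool) : \sum_(l < n) (c (y l) (y i))%:R =
    (c (y i) (y i))%:R + \sum_(l <- J) (c (y l) (y i))%:R :> R.
  by rewrite (bigD1 i)//= /J big_filter.
have sz : (size J)%:R + 1 = n%:R :> R.
  rewrite /J size_filter -sum1_count natr_sum.
  rewrite -[in RHS](card_ord n) -sumr_const [RHS](bigD1 i)//= addrC; congr (_ + _).
have ltle : \sum_(l <- J) ((y l < y i)%R)%:R <= \sum_(l <- J) ((y l <= y i)%R)%:R :> R.
  by apply: ler_sum => l _; rewrite ler_nat; case: ltgtP.
have b1 : `|\sum_(l <- J) ((y l < y i)%R)%:R - (size J)%:R * F (T i)| <= loo_err F T D i.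
  by apply: (rank_err_bound _ _ _ _ _ _ _ _ _ hD (hD i)); rewrite lexx.
have b2 : `|\sum_(l <- J) ((y l <= y i)%R)%:R - (size J)%:R * F (T i)| <= loo_err F T D i.
  by apply: (rank_err_bound _ _ _ _ _ _ _ _ _ hD (hD i)); rewrite lexx andbT.
rewrite (split (fun a b => a < b)) ltxx add0r in v1.
rewrite (split (fun a b => a <= b)) lexx in v2.
have /andP[f0 f1] := F01 (T i).
move: b1 b2 v1 v2; rewrite -sz !ler_norml.
set A := \sum_(l <- J) _; set B := \sum_(l <- J) _; set k := (size J)%:R.
by move=> /andP[? ?] /andP[? ?] ? /= ?; apply/andP; split; lra.
Qed.

(** Which sample point is selected depends on [v]. Summing over all points whose cell contains [v],
    each divided by its multiplicity, removes the choice: the tie class of the selected point has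
    total weight 1 and the cost of any member bounds the error. *)
Lemma quantile_cell v : 0 < v <= 1 ->
  powR `|ginv (fun t => n%:R^-1 * \sum_(j < n) ((y j <= t)%R)%:R) v - ginv F v| q
  <= \sum_(i < n) cell_cost i / cell_mult i * ((cell_lo i <= v <= cell_hi i)%R)%:R.
Proof.
move=> v01; have [i [-> iv]] := ginv_sample y v n0 v01.
have c_le k : y k = y i -> powR `|y i - ginv F v| q <= cell_cost k.
  move=> yk.
  have kv : cell_lo k <= v <= cell_hi k.
    by move: iv; rewrite nltE nltD_neqE /cell_lo /cell_hi yk.
  have h1 := dist_ginv F a b L F_nd F_lo F_hi L0 F_lip (T k) v (hT k) v01.
  have h2 := cell_dist k v kv.
  have h3 : `|y i - ginv F v| <= D k + L * ((2 + loo_err F T D k) / n%:R).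
    rewrite -yk (_ : y k - ginv F v = (y k - T k) + (T k - ginv F v)); last by ring.
    apply: le_trans (ler_normD _ _) _; apply: lerD => //; apply: le_trans h1 _.
    by rewrite ler_wpM2l.
  have p0 : 0 <= (2 + loo_err F T D k) / n%:R by rewrite divr_ge0// addr_ge0// loo_err_ge0.
  apply: (@le_trans _ _ (powR (D k + L * ((2 + loo_err F T D k) / n%:R)) q)).
    apply: ge0_ler_powR; rewrite ?nnegrE ?(ltW q0)//.
    by apply: addr_ge0 => //; exact: mulr_ge0.
  apply: le_trans (powRD_le _ _ _ q0 (D0 k) (mulr_ge0 L0 p0)) _.
  by rewrite /cell_cost (powRM q L0 p0).
rewrite -[leLHS]mulr1 -[X in _ * X <= _](sum_class y i) big_mkcond mulr_sumr; apply: ler_sum => k _.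
have mk : cell_mult k = (neq y k)%:R by rewrite /neq natr_sum.
case: eqP => [yk|_]; last first.
  rewrite mulr0; apply: mulr_ge0 => //; apply: divr_ge0; last by rewrite mk.
  exact: cell_cost_ge0.
have -> : (cell_lo k <= v <= cell_hi k) = true.
  by move: iv; rewrite nltE nltD_neqE /cell_lo /cell_hi yk.
by rewrite mulr1 mk ler_wpM2r ?invr_ge0// c_le.
Qed.

Lemma quantile_point v V : 0 < v <= 1 -> 0 < V <= 1 ->
  powR `|ginv (fun t => n%:R^-1 * \sum_(j < n) ((y j <= t)%R)%:R) v - ginv F V| q
  <= powR 2 q * (\sum_(i < n) cell_cost i / cell_mult i * ((cell_lo i <= v <= cell_hi i)%R)%:R
                 + powR L q * powR `|v - V| q).
Proof.
move=> v01 V01; set g := ginv _ v.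
apply: (@le_trans _ _ (powR (`|g - ginv F v| + L * `|v - V|) q)).
  apply: ge0_ler_powR; rewrite ?nnegrE ?(ltW q0)//; first by rewrite addr_ge0 ?mulr_ge0.
  rewrite (_ : g - ginv F V = (g - ginv F v) + (ginv F v - ginv F V)); last by ring.
  apply: le_trans (ler_normD _ _) _; rewrite lerD2l.
  exact: (ginv_lipschitz F a b L F_lo F_hi L0 F_lip).
apply: le_trans (powRD_le _ _ _ q0 (normr_ge0 _) (mulr_ge0 L0 (normr_ge0 _))) _.
rewrite ler_wpM2l ?powR_ge0// lerD//; first exact: quantile_cell.
by rewrite (powRM q L0 (normr_ge0 _)).
Qed.

End quantile_point.

(** Each weight is at most 1, so [(w s)^q <= w s]: the weight survives outside the power, at the
    price of the factor [K^q]. *)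
Lemma powR_weighted_sum {K : nat} (w c : 'I_K -> R) (q : R) : 1 <= q ->
  (forall s, 0 <= w s) -> \sum_(s < K) w s = 1 -> (forall s, 0 <= c s) ->
  powR (\sum_(s < K) w s * c s) q <= powR K%:R q * \sum_(s < K) w s * powR (c s) q.
Proof.
move=> q1 w0 w1 c0; have q0 : 0 < q by exact: lt_le_trans q1.
apply: le_trans (powR_sum_le (index_enum 'I_K) (fun s => w s * c s) q q0 _) _.
  by move=> s _; rewrite mulr_ge0.
rewrite size_index_ord ler_wpM2l ?powR_ge0//; apply: ler_sum => s _.
rewrite (powRM q (w0 s) (c0 s)) ler_wpM2r ?powR_ge0//.
have ws1 : w s <= 1 by rewrite -w1 (bigD1 s)//= lerDl sumr_ge0.
have [->|wN] := eqVneq (w s) 0; first by rewrite powR0 ?gt_eqF.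
by apply: ge1r_powR => //; rewrite lt_def wN w0.
Qed.

End pointwise.

(** * Uniform ranks and the risk under the auxiliary sample *)

Lemma mf_sum_in {d : measure_display} {T : measurableType d} {R : realType} {I : eqType}
    (r : seq I) (h : I -> T -> R) : (forall i, i \in r -> measurable_fun setT (h i)) ->
  measurable_fun setT (fun x => \sum_(i <- r) h i x).
Proof.
move=> mh; under eq_fun do rewrite big_seq.
under eq_fun do rewrite big_mkcond.
apply: mf_sum => i; case: (boolP (i \in r)) => [/mh//|_]; exact: mf_cst.
Qed.

Lemma integral_eq_law {d1 d2 d : measure_display} {T1 : measurableType d1} {T2 : measurableType d2}
    {T : measurableType d} {R : realType} (P1 : probability T1 R) (P2 : probability T2 R)
    (X : T1 -> T) (W : T2 -> T) (psi : T -> \bar R) :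
  measurable_fun setT X -> measurable_fun setT W ->
  (forall B, measurable B -> P1 (X @^-1` B) = P2 (W @^-1` B)) ->
  measurable_fun setT psi -> (forall x, 0 <= psi x)%E ->
  (\int[P1]_x psi (X x) = \int[P2]_x psi (W x))%E.
Proof.
move=> mX mW XW mpsi psi0; rewrite -(integral_law _ mX)// -(integral_law _ mW)//.
by apply: eq_measure_integral => A mA _; exact: XW.
Qed.

Section window.
Context {R : realType} (A B : R).

Definition clamp (x : R) : R := Num.min (Num.max x A) B.

Lemma clamp_nd x y : x <= y -> clamp x <= clamp y.
Proof.
move=> xy; rewrite /clamp /Num.min /Num.max.
by case: (ltP x A); case: (ltP y A); case: (ltP A B); case: (ltP x B); case: (ltP y B) => /=; lra.
Qed.

Lemma clamp_in x : A <= B -> A <= clamp x <= B.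
Proof. by move=> AB; rewrite /clamp ge_min lexx orbT andbT le_min AB andbT le_max lexx orbT. Qed.

Lemma clamp_range x y : A <= B -> clamp x - clamp y <= B - A.
Proof.
by move=> AB; have /andP[_ h1] := clamp_in x AB; have /andP[h2 _] := clamp_in y AB; lra.
Qed.

Lemma clamp_id x : A <= x <= B -> clamp x = x.
Proof. by move=> /andP[h1 h2]; rewrite /clamp max_l// min_l. Qed.

(* Share of a window [A, B] of ranks occupied by the rank of [z k], when ties are broken uniformly *)
Definition rank_share {n} (z : 'I_n -> R) (k : 'I_n) : R :=
  (clamp (\sum_(l < n) ((z l <= z k)%R)%:R) - clamp (\sum_(l < n) ((z l < z k)%R)%:R))
    / \sum_(l < n) ((z l == z k)%R)%:R.

Lemma rank_share_ge0 {n} (z : 'I_n -> R) k : 0 <= rank_share z k.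
Proof.
rewrite divr_ge0 ?sumr_ge0// subr_ge0; apply: clamp_nd; apply: ler_sum => l _.
by rewrite ler_nat; case: ltgtP.
Qed.

(** By [sum_rank_increments] the shares telescope to at most [clamp n - clamp 0]. *)
Lemma sum_rank_share {n} (z : 'I_n -> R) : A <= B -> \sum_(k < n) rank_share z k <= B - A.
Proof.
move=> AB; apply: le_trans (clamp_range n%:R 0%:R AB).
apply: le_trans (sum_rank_increments z (fun c => clamp c%:R) _) => [|c].
  rewrite le_eqVlt; apply/orP; left; apply/eqP; apply: eq_bigr => k _.
  by rewrite /rank_share nltD_neqE nltE /neq natr_sum.
by apply: clamp_nd; rewrite ler_nat.
Qed.

Lemma rank_share_perm {n} (z z' : 'I_n -> R) (g : {perm 'I_n}) k :
  (forall l, z' l = z (g l)) -> rank_share z' k = rank_share z (g k).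
Proof.
move=> zz'; rewrite /rank_share.
have e (c : R -> R -> bool) : \sum_(l < n) (c (z' l) (z' k))%:R = \sum_(l < n) (c (z l) (z (g k)))%:R :> R.
  by rewrite [RHS](reindex_inj (@perm_inj _ g)); apply: eq_bigr => l _; rewrite !zz'.
by rewrite (e (fun a b => a <= b)) (e (fun a b => a < b)) (e (fun a b => a == b)).
Qed.

Lemma mf_rank_share {d : measure_display} {T : measurableType d} {n} (z : T -> 'I_n -> R) k :
  (forall l, measurable_fun setT (fun x => z x l)) ->
  measurable_fun setT (fun x => rank_share (z x) k).
Proof.
move=> mz; rewrite /rank_share /clamp; apply: mf_M.
  by meas.
by apply: mf_V => [x|]; [rewrite sumr_ge0|meas].
Qed.

(** For [u] in [0, 1], [r + u * m] runs through a tie block of length [m] starting at rank [r];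
    clamping both ends of the block cuts out its part inside the window. *)
Lemma measure_window (r m : R) : 0 < m ->
  (lebesgue_measure ([set u : R | (A <= r + u * m <= B)%R] `&` [set u | (0 <= u <= 1)%R])
   <= ((clamp (r + m) - clamp r) / m)%:E)%E.
Proof.
move=> m0; set lo := (clamp r - r) / m; set hi := (clamp (r + m) - r) / m.
have lohi : lo <= hi.
  by rewrite ler_pM2r ?invr_gt0// lerB//; apply: clamp_nd; rewrite lerDl ltW.
apply: (@le_trans _ _ (lebesgue_measure `[lo, hi]%classic)).
  apply: le_measure; rewrite ?inE//.
    apply: measurableI; apply: measurable_bool; apply: mf_and; apply: mf_le; meas.
  all: try exact: measurable_id.
  move=> u /= [AuB /andP[u0 u1]]; rewrite in_itv /=.
  rewrite /lo /hi ler_pdivrMr// ler_pdivlMr// lerBlDl lerBrDl -(clamp_id _ AuB).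
  apply/andP; split; apply: clamp_nd; first by rewrite lerDl mulr_ge0// ltW.
  by rewrite lerD2l ger_pMl.
rewrite lebesgue_measure_itv /= lte_fin; case: ltP => h.
  by rewrite -EFinB lee_fin /hi /lo; lra.
by rewrite lee_fin divr_ge0 ?(ltW m0)// subr_ge0; apply: clamp_nd; rewrite lerDl ltW.
Qed.

End window.

(** * Independence of disjoint blocks of variables *)

Section generated.
Context {R : realType} {d : measure_display} {Om : measurableType d} {Q : probability Om R}.
Context {I : eqType} {D : set I} {E : I -> set (set Om)}.

(** Cylinder events over a block of indices form a pi-system, on which the independence of disjoint
    blocks follows from [mutual_indep]. *)
Definition gen (J : seq I) : set (set Om) :=
  [set B | exists2 A : I -> set Om, (forall i, i \in J -> E i (A i)) &
                                    B = \bigcap_(i in [set` J]) A i].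

Hypothesis Em : forall i, E i `<=` measurable.
Hypothesis ET : forall i, E i setT.
Hypothesis EI : forall i, setI_closed (E i).
Hypothesis indep : mutual_indep Q D E.

Lemma gen_measurable J : gen J `<=` measurable.
Proof.
by move=> _ [A EA ->]; apply: fin_bigcap_measurable => // i iJ; apply: Em; exact: EA.
Qed.

Lemma gen_setI J : setI_closed (gen J).
Proof.
move=> _ _ [A EA ->] [B EB ->]; exists (fun i => A i `&` B i).
  by move=> i iJ; apply: EI; [exact: EA|exact: EB].
by rewrite bigcapI.
Qed.

Lemma gen_setT J : gen J setT.
Proof. by exists (fun=> setT) => //; apply/esym/seteqP; split. Qed.

(** Both families of events are merged into one over [J1 ++ J2]; the product formulas for [J1], [J2]
    and their concatenation then combine. *)
Lemma gen_indep J1 J2 A0 B0 : uniq (J1 ++ J2) -> (forall i, i \in J1 ++ J2 -> D i) ->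
  gen J1 A0 -> gen J2 B0 -> Q (A0 `&` B0) = (Q A0 * Q B0)%E.
Proof.
move=> uJ JD [A1 EA1 ->] [A2 EA2 ->].
pose A i := if i \in J1 then A1 i else A2 i.
have [u1 n12 u2] : [/\ uniq J1, ~~ has (mem J1) J2 & uniq J2] by apply/and3P; rewrite -cat_uniq.
have e1 : \bigcap_(i in [set` J1]) A1 i = \bigcap_(i in [set` J1]) A i.
  by apply: eq_bigcapr => i /= iJ; rewrite /A iJ.
have nJ1 i : i \in J2 -> (i \in J1) = false.
  by move=> iJ; apply: contraNF n12 => iJ1; apply/hasP; exists i.
have e2 : \bigcap_(i in [set` J2]) A2 i = \bigcap_(i in [set` J2]) A i.
  by apply: eq_bigcapr => i /= iJ; rewrite /A nJ1.
have EA i : i \in J1 ++ J2 -> E i (A i).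
  rewrite mem_cat /A => /orP[iJ|iJ]; first by rewrite iJ; exact: EA1.
  by rewrite nJ1//; exact: EA2.
rewrite e1 e2 (indep J1 A u1); last first.
  by move=> i iJ; split; [apply: JD|apply: EA]; rewrite mem_cat iJ.
rewrite (indep J2 A u2); last first.
  by move=> i iJ; split; [apply: JD|apply: EA]; rewrite mem_cat iJ orbT.
rewrite -big_cat -(indep _ A uJ); last by move=> i iJ; split; [exact: JD|exact: EA].
congr (Q _); apply/seteqP; split => x /=.
  by move=> [h1 h2] i; rewrite /= mem_cat => /orP[/h1|/h2].
by move=> h; split => i /= iJ; apply: h; rewrite /= mem_cat iJ ?orbT.
Qed.

Lemma decouple_gen (J1 J2 : seq I) (Phi : Om -> Om -> \bar R) :
  uniq (J1 ++ J2) -> (forall i, i \in J1 ++ J2 -> D i) ->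
  measurable_fun setT
    (fun z : g_sigma_algebraType (gen J1) * g_sigma_algebraType (gen J2) => Phi z.1 z.2) ->
  (forall x y, 0 <= Phi x y)%E ->
  (\int[Q]_x Phi x x = \int[Q]_x \int[Q]_y Phi x y)%E.
Proof.
move=> uJ JD mPhi Phi0; apply: (@decouple _ _ _ Q (gen J1) (gen J2)) => //.
- exact: gen_measurable.
- exact: gen_setI.
- exact: gen_setT.
- exact: gen_measurable.
- exact: gen_setI.
- exact: gen_setT.
- by move=> A B; exact: gen_indep.
Qed.

Lemma gen_mfun {dT : measure_display} {T : measurableType dT} (X : Om -> T) i J :
  i \in J -> (forall B, measurable B -> E i (X @^-1` B)) ->
  measurable_fun setT (X : g_sigma_algebraType (gen J) -> T).
Proof.
move=> iJ EX _ B mB; rewrite setTI; apply: sub_sigma_algebra.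
exists (fun k => if k == i then X @^-1` B else setT).
  by move=> k kJ; case: eqP => [->|_]; [exact: EX|exact: ET].
apply/seteqP; split => [x Bx k _ /=|x h]; first by case: eqP.
by have /= := h i iJ; rewrite eqxx.
Qed.

End generated.
Arguments gen {d Om I} E J.

Section aux.
Context {R : realType} {K p : nat} {N : 'I_K -> nat} {f : p.-tuple R -> 'I_K -> R}.
Context {d : measure_display} {Om : measurableType d} {Q : probability Om R}.
Context {Xa : 'I_K -> nat -> Om -> p.-tuple R} {Za : 'I_K -> nat -> Om -> R} {Ua : 'I_K -> Om -> R}.
Hypothesis mf : forall s, measurable_fun setT (fun x => f x s).
Hypothesis N0 : forall s, (0 < N s)%N.
Hypothesis mXa : forall s i, measurable_fun setT (Xa s i).
Hypothesis mZa : forall s i, measurable_fun setT (Za s i).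
Hypothesis mUa : forall s, measurable_fun setT (Ua s).
Hypothesis law_Xa : forall s i, (i < 2 * N s)%N -> forall B, measurable B ->
  Q (Xa s i @^-1` B) = Q (Xa s 0 @^-1` B).
Hypothesis law_Za : forall s i, (i < 2 * N s)%N -> forall B, measurable B ->
  Q (Za s i @^-1` B) = Q (Za s 0 @^-1` B).
Hypothesis law_Ua : forall s B, measurable B ->
  Q (Ua s @^-1` B) = lebesgue_measure (B `&` [set z | (0 <= z <= 1)%R]).

Let D : set (aux_idx K) := fun i : aux_idx K => match i with
  | inl (inl (s, j)) => (j < 2 * N s)%N
  | inl (inr (s, j)) => (j < 2 * N s)%N
  | inr _ => True end.
Let E : aux_idx K -> set (set Om) := fun i : aux_idx K => match i with
  | inl (inl (s, j)) => [set Xa s j @^-1` B | B in measurable]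
  | inl (inr (s, j)) => [set Za s j @^-1` B | B in measurable]
  | inr s => [set Ua s @^-1` B | B in measurable] end.
Hypothesis indep : mutual_indep Q D E.

Let ix s j : aux_idx K := inl (inl (s, j)).
Let iz s j : aux_idx K := inl (inr (s, j)).
Let iu s : aux_idx K := inr s.

Let pre_meas {d' : measure_display} {T : measurableType d'} (X : Om -> T) B :
  measurable_fun setT X -> measurable B -> measurable (X @^-1` B).
Proof. by move=> mX mB; rewrite -[X in measurable X]setTI; exact: mX. Qed.

Let Em i : E i `<=` measurable.
Proof. by case: i => [[[s j]|[s j]]|s] _ [B mB <-]; exact: pre_meas. Qed.

Let ET i : E i setT.
Proof. by case: i => [[[s j]|[s j]]|s]; exists setT. Qed.

Let EI i : setI_closed (E i).
Proof.
by case: i => [[[s j]|[s j]]|s] _ _ [A mA <-] [B mB <-]; exists (A `&` B) => //; exact: measurableI.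
Qed.

Local Notation O J := (g_sigma_algebraType (gen E J)).

Let mX J s j : ix s j \in J -> measurable_fun setT (Xa s j : O J -> _).
Proof. by move=> jJ; apply: (gen_mfun ET _ _ _ jJ) => B mB; exists B. Qed.
Let mZ J s j : iz s j \in J -> measurable_fun setT (Za s j : O J -> _).
Proof. by move=> jJ; apply: (gen_mfun ET _ _ _ jJ) => B mB; exists B. Qed.
Let mU J s : iu s \in J -> measurable_fun setT (Ua s : O J -> _).
Proof. by move=> jJ; apply: (gen_mfun ET _ _ _ jJ) => B mB; exists B. Qed.

Let Y s j om := f (Xa s j om) s + Za s j om.

Let mY J s j : ix s j \in J -> iz s j \in J -> measurable_fun setT (Y s j : O J -> _).
Proof.
move=> xJ zJ; apply: mf_D; last exact: mZ.
exact: (measurableT_comp (mf s) (mX _ _ _ xJ)).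
Qed.

Lemma mY_sample s j : measurable_fun setT (Y s j).
Proof. by apply: mf_D => //; exact: (measurableT_comp (mf s)). Qed.

Let decoupleE := @decouple_gen _ _ _ _ _ _ _ Em ET EI indep.

(** The embedding [h] lets one statement cover the first half, the second half (a shift by [N s])
    and the second half with a point left out. *)
Lemma sample_iid {J : eqType} (h : J -> nat) (s : 'I_K) (r : seq J) : injective h ->
  (forall j, h j < 2 * N s)%N ->
  iid_on Q (law_of Q (mXa s 0)) (fun j => Xa s (h j)) r.
Proof.
move=> hinj hN L uL _ A mA.
pose B (i : aux_idx K) := if i is inl (inl (s', j)) then Xa s' j @^-1` A else setT.
have uM : uniq [seq ix s (h j) | j <- L] by rewrite map_inj_uniq// => i j [/hinj].
have H := indep _ B uM; rewrite big_map in H.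
transitivity (\prod_(j <- L) Q (B (ix s (h j))))%E.
  rewrite -H => [|_ /mapP[j jL ->]]; last by split; [exact: hN|exists A].
  congr (Q _); apply/seteqP; split => x /= hx i; last first.
    by move=> iL; apply: (hx (ix s (h i))); apply/mapP; exists i.
  by move=> /mapP[j jL ->]; exact: hx.
elim: (L) => [|l L' IH]; first by rewrite big_nil.
rewrite big_cons IH /B /= law_Xa ?hN// exprS EFinM fineK ?fin_num_measure//.
Qed.

(** A perturbed score needs a feature vector and a noise, so a block of scores collects both kinds
    of indices. *)
Definition smp s (L : seq nat) : seq (aux_idx K) := map (ix s) L ++ map (iz s) L.

Lemma smp_uniq s L : uniq L -> uniq (smp s L).
Proof.
move=> uL; rewrite cat_uniq !map_inj_uniq ?uL ?andbT//=; try by move=> i j [].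
by apply/hasPn => _ /mapP[j _ ->]; apply/negP => /mapP[].
Qed.

Lemma smp_ix s L j : j \in L -> ix s j \in smp s L.
Proof. by move=> jL; rewrite mem_cat map_f. Qed.

Lemma smp_iz s L j : j \in L -> iz s j \in smp s L.
Proof. by move=> jL; rewrite mem_cat orbC map_f. Qed.

Lemma smp_inv s L i : i \in smp s L -> exists2 j, j \in L & i = ix s j \/ i = iz s j.
Proof. by rewrite mem_cat => /orP[/mapP[j jL ->]|/mapP[j jL ->]]; exists j => //; [left|right]. Qed.

Lemma smp_D s L i : (forall j, j \in L -> (j < 2 * N s)%N) -> i \in smp s L -> D i.
Proof. by move=> LN /smp_inv[j /LN jN [->|->]]. Qed.

Lemma smp2_uniq s s' L L' : uniq L -> uniq L' -> (s != s') || ~~ has (mem L) L' ->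
  uniq (smp s L ++ smp s' L').
Proof.
move=> uL uL' h; rewrite cat_uniq !smp_uniq//= andbT; apply/hasPn => i /smp_inv[j jL' ij].
apply/negP => /smp_inv[j' j'L ij']; move: h => /orP[/eqP|/hasP]; apply.
  by move: ij ij' => [->|->] [] [].
exists j => //=; suff -> : j = j' by [].
by move: ij ij' => [->|->] [] [].
Qed.

Let muY s := law_of Q (mY_sample s 0).

(** Feature and noise of one sample are decoupled first; each is then replaced by the variable of
    index 0, which has the same law. *)
Lemma law_YE s j (psi : R -> \bar R) : (j < 2 * N s)%N ->
  measurable_fun setT psi -> (forall y, 0 <= psi y)%E ->
  (\int[Q]_om psi (Y s j om) =
   \int[Q]_om \int[Q]_om' psi (f (Xa s 0 om) s + Za s 0 om')%R)%E.
Proof.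
move=> jN mpsi psi0.
rewrite (decoupleE [:: ix s j] [:: iz s j] (fun om om' => psi (f (Xa s j om) s + Za s j om')%R))//.
- pose g x := (\int[Q]_om' psi (f x s + Za s 0 om')%R)%E.
  have mg : measurable_fun setT g.
    apply: (measurable_fun_fubini_tonelli_F (fun z : p.-tuple R * Om => psi (f z.1 s + Za s 0 z.2))) => //.
    apply: (measurableT_comp mpsi); apply: mf_D.
      by apply: (measurableT_comp (mf s)); exact: measurable_fst.
    by apply: (measurableT_comp (mZa s 0)); exact: measurable_snd.
  rewrite -[RHS](integral_eq_law Q Q (Xa s j) (Xa s 0) g)//; last 2 first.
  - by move=> B mB; exact: law_Xa.
  - by move=> x; apply: integral_ge0.
  apply: eq_integral => om _.
  apply: (integral_eq_law Q Q (Za s j) (Za s 0) (fun z => psi (f (Xa s j om) s + z))) => //.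
    by move=> B mB; exact: law_Za.
  by apply: (measurableT_comp mpsi); apply: mf_D; [exact: mf_cst|exact: measurable_id].
- by move=> i; rewrite !inE => /orP[/eqP->|/eqP->].
- apply: (measurableT_comp mpsi); apply: mf_D.
    apply: (measurableT_comp (mf s)); apply: (measurableT_comp (mX [:: ix s j] s j _)).
      by rewrite inE.
    exact: measurable_fst.
  apply: (measurableT_comp (mZ [:: iz s j] s j _)); first by rewrite inE.
  exact: measurable_snd.
Qed.

Lemma law_Y s j (psi : R -> \bar R) : (j < 2 * N s)%N ->
  measurable_fun setT psi -> (forall y, 0 <= psi y)%E ->
  (\int[Q]_om psi (Y s j om) = \int[muY s]_y psi y)%E.
Proof.
move=> jN mpsi psi0.
by rewrite (integral_law _ (mY_sample s 0))// (law_YE s j psi)// (law_YE s 0 psi)// muln_gt0 N0.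
Qed.

Let N2 s j : (j < N s)%N -> (j < 2 * N s)%N.
Proof. by move=> jN; rewrite mul2n -addnn ltn_addr. Qed.

Definition rank_stat s (y : R) (om : Om) : R :=
  F1hat N f (fun s i => Xa s i om) (fun s i => Za s i om) (fun s => Ua s om) s y.

(** The test score is placed last among [N s + 1] points, as one more member of the sample. [zvec2]
    also turns the [j]-th sample score into a free argument. *)
Let zvec s (y : R) om (k : 'I_(N s).+1) : R := if k == N s :> nat then y else Y s k om.
Let zvec2 s j (a b : R) om (k : 'I_(N s).+1) : R :=
  if k == N s :> nat then a else if k == j :> nat then b else Y s k om.

Let mY_gen s L j : j \in L -> measurable_fun setT (Y s j : O (smp s L) -> R).
Proof. by move=> jL; apply: mY; [exact: smp_ix|exact: smp_iz]. Qed.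

(** * Uniformity of the randomized rank of an independent test score *)

Section uniform.
Variables (s : 'I_K) (al be : R).
Hypothesis albe : al <= be.

Let n1 : R := (N s)%:R + 1.
Let A := al * n1.
Let B := be * n1.
Let n1_gt0 : 0 < n1. Proof. by rewrite /n1 ltr_pwDr. Qed.
Let AB : A <= B. Proof. by rewrite ler_pM2r. Qed.

Let share (z : 'I_(N s).+1 -> R) k := rank_share A B z k.
Let share0 z k : 0 <= share z k. Proof. exact: rank_share_ge0. Qed.

(** The tie-breaking variable is independent of the sample and enters affinely; integrating it out
    leaves the length estimated in [measure_window], which is the share of the test point. *)
Let average_U y :
  (\int[Q]_om (((al <= rank_stat s y om <= be)%R)%:R)%:E <=
   \int[Q]_om (share (zvec s y om) ord_max)%:E)%E.
Proof.
pose st (om om' : Om) : R := n1^-1 * (\sum_(i < N s) ((Y s i om < y)%R)%:R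
   + Ua s om' * (1 + \sum_(i < N s) ((Y s i om == y)%R)%:R)).
have uJ : uniq (smp s (iota 0 (N s)) ++ [:: iu s]).
  rewrite cat_uniq smp_uniq ?iota_uniq//= andbT orbF; apply/negP => /smp_inv[j _].
  by case.
have JD i : i \in smp s (iota 0 (N s)) ++ [:: iu s] -> D i.
  rewrite mem_cat => /orP[/smp_D|]; last by rewrite inE => /eqP->.
  by apply=> j; rewrite mem_iota => /N2.
have mst : measurable_fun setT (fun z : O (smp s (iota 0 (N s))) * O [:: iu s] => st z.1 z.2).
  have mYz (i : 'I_(N s)) : measurable_fun setT
      (fun z : O (smp s (iota 0 (N s))) * O [:: iu s] => Y s i z.1).
    apply: (measurableT_comp (mY_gen s (iota 0 (N s)) i _)); last exact: measurable_fst.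
    by rewrite mem_iota /=.
  have mUz : measurable_fun setT
      (fun z : O (smp s (iota 0 (N s))) * O [:: iu s] => Ua s z.2).
    apply: (measurableT_comp (mU [:: iu s] s _)); last exact: measurable_snd.
    by rewrite inE.
  by rewrite /st; meas using mYz mUz.
rewrite [X in (X <= _)%E](decoupleE _ _ (fun om om' => (((al <= st om om' <= be)%R)%:R)%:E) uJ JD); last 2 first.
- by meas using mst.
- by move=> *; rewrite lee_fin.
apply: ge0_le_integral_nomeas => om _; first by apply: integral_ge0 => *; rewrite lee_fin.
pose r : R := \sum_(i < N s) ((Y s i om < y)%R)%:R.
pose m : R := 1 + \sum_(i < N s) ((Y s i om == y)%R)%:R.
have m0 : 0 < m by rewrite /m ltr_wpDr// sumr_ge0.
have mset : measurable [set u : R | A <= r + u * m <= B].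
  apply: measurable_bool; apply: mf_and; apply: mf_le; meas; exact: measurable_id.
rewrite (_ : (\int[Q]_om' _)%E = Q (Ua s @^-1` [set u : R | A <= r + u * m <= B])); last first.
  rewrite -[X in Q X]setIT -integral_indic//; last by apply: pre_meas.
  apply: eq_integral => om' _; rewrite indicE mem_setE /st /= -/r -/m.
  by rewrite ler_pdivlMl// ler_pdivrMl// [n1 * al]mulrC [n1 * be]mulrC.
rewrite law_Ua//; apply: le_trans (measure_window _ _ r m m0) _.
rewrite lee_fin /share /rank_share.
have zl (c : R -> R -> bool) : \sum_(l < (N s).+1) (c (zvec s y om l) (zvec s y om ord_max))%:R
    = \sum_(i < N s) (c (Y s i om) y)%:R + (c y y)%:R :> R.
  rewrite big_ord_recr /= /zvec /= eqxx; congr (_ + _); apply: eq_bigr => i _.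
  by rewrite /= ltn_eqF.
rewrite (zl (fun a b => a <= b)) (zl (fun a b => a < b)) (zl (fun a b => a == b)).
rewrite lexx ltxx eqxx addr0 [_ + 1]addrC -/r [\sum_(i < N s) _ + 1]addrC -/m.
rewrite (_ : 1 + \sum_(i < N s) _ = r + m)// /r /m addrCA; congr (1 + _).
by rewrite -big_split; apply: eq_bigr => i _ /=; case: ltgtP; rewrite ?addr0 ?add0r.
Qed.

(** Independence turns the [j]-th sample score into an integration variable of law [muY s], on the
    same footing as the test score. *)
Let swap (j : 'I_(N s)) k y :
  (\int[Q]_om (share (zvec s y om) k)%:E =
   \int[muY s]_b \int[Q]_om (share (zvec2 s j y b om) k)%:E)%E.
Proof.
pose L2 := [seq i <- iota 0 (N s) | i != nat_of_ord j].
have uJ : uniq (smp s [:: nat_of_ord j] ++ smp s L2).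
  apply: smp2_uniq; rewrite ?filter_uniq ?iota_uniq// eqxx /=.
  by apply/hasPn => i; rewrite mem_filter => /andP[ij _]; rewrite /= inE.
have JD i : i \in smp s [:: nat_of_ord j] ++ smp s L2 -> D i.
  rewrite mem_cat => /orP[] /smp_D; apply=> i'; first by rewrite inE => /eqP->; exact: N2.
  by rewrite mem_filter mem_iota => /andP[_ /andP[_]]; exact: N2.
have mz (d' : measure_display) (T : measurableType d') (b : T -> R) (W : T -> O (smp s L2)) :
    measurable_fun setT b -> measurable_fun setT W ->
    measurable_fun setT (fun x => (share (zvec2 s j y (b x) (W x)) k)%:E).
  move=> mb mW; apply: mf_EFin; apply: (mf_rank_share _ _) => l; rewrite /zvec2.
  case: (boolP (l == N s :> nat)) => lN /=; first exact: mf_cst.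
  case: (boolP (l == j :> nat)) => lj //=; apply: (measurableT_comp (mY_gen s L2 l _)) => //.
  by rewrite mem_filter lj mem_iota /= add0n ltn_neqAle lN -ltnS ltn_ord.
rewrite -(law_Y s j (fun b => \int[Q]_om (share (zvec2 s j y b om) k)%:E)%E); last 3 first.
- exact: N2.
- apply: (measurable_fun_fubini_tonelli_F
    (fun z : R * Om => (share (zvec2 s j y z.1 z.2) k)%:E)) => [|z]; last by rewrite lee_fin.
  apply: mf_EFin; apply: (mf_rank_share _ _) => l; rewrite /zvec2.
  case: (boolP (l == N s :> nat)) => lN /=; first exact: mf_cst.
  case: (boolP (l == j :> nat)) => lj /=; first exact: measurable_fst.
  apply: (measurableT_comp (mY_sample s l)); exact: measurable_snd.
- by move=> b; apply: integral_ge0 => om _; rewrite lee_fin.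
rewrite -(decoupleE _ _ (fun om om' => (share (zvec2 s j y (Y s j om) om') k)%:E) uJ JD); last 2 first.
- apply: mz; last exact: measurable_snd.
  apply: (measurableT_comp (mY_gen s [:: nat_of_ord j] j _)); last exact: measurable_fst.
  by rewrite inE.
- by move=> *; rewrite lee_fin.
apply: eq_integral => om _; congr (share _ _)%:E; apply/funext => l.
by rewrite /zvec /zvec2; case: ifP => // _; case: eqP => // ->.
Qed.

(* Exchangeability: the test point and a sample point play symmetric roles. *)
Let exchange (k : 'I_(N s).+1) :
  (\int[muY s]_y \int[Q]_om (share (zvec s y om) ord_max)%:E =
   \int[muY s]_y \int[Q]_om (share (zvec s y om) k)%:E)%E.
Proof.
have [kN|kN] := eqVneq (nat_of_ord k) (N s).
  by rewrite (_ : k = ord_max)//; apply: val_inj.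
have kN' : (k < N s)%N by rewrite ltn_neqAle kN -ltnS ltn_ord.
pose j := Ordinal kN'.
under eq_integral => y _ do rewrite (swap j).
under [RHS]eq_integral => y _ do rewrite (swap j).
pose G (z : R * R) := (\int[Q]_om (share (zvec2 s j z.1 z.2 om) k)%:E)%E.
have G0 z : (0 <= G z)%E by apply: integral_ge0 => om _; rewrite lee_fin.
have mG : measurable_fun setT G.
  apply: (measurable_fun_fubini_tonelli_F
    (fun z : (R * R) * Om => (share (zvec2 s j z.1.1 z.1.2 z.2) k)%:E)) => [|z]; last by rewrite lee_fin.
  have m1 : measurable_fun setT (fun z : (R * R) * Om => z.1) by exact: measurable_fst.
  apply: mf_EFin; apply: (mf_rank_share _ _) => l; rewrite /zvec2.
  case: (boolP (l == N s :> nat)) => lN /=; first by apply: (measurableT_comp _ m1); exact: measurable_fst.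
  case: (boolP (l == j :> nat)) => lj; first by apply: (measurableT_comp _ m1); exact: measurable_snd.
  apply: (measurableT_comp (mY_sample s l)); exact: measurable_snd.
rewrite [RHS](fubini_tonelli (m1 := muY s) (m2 := muY s) G mG G0).
apply: eq_integral => a _; apply: eq_integral => b _; apply: eq_integral => om _.
congr (_%:E).
have -> : k = tperm k ord_max ord_max by rewrite tpermR.
apply: (rank_share_perm _ _ _ _ (tperm k ord_max) ord_max) => l; rewrite /zvec2.
case: tpermP => [->|->|/eqP lk /eqP lm] /=.
- by rewrite eqxx (negbTE kN) eqxx.
- by rewrite eqxx (negbTE kN) eqxx.
- have -> : (l == N s :> nat) = false by apply: contraNF lm => h; apply/eqP/val_inj/eqP.
  by have -> : (l == k :> nat) = false by apply: contraNF lk => h; apply/eqP/val_inj/eqP.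
Qed.

(** The [N s + 1] expected shares are equal by [exchange] and sum to at most [B - A], that is
    [N s + 1] times [be - al]. *)
Lemma rank_stat_uniform :
  (\int[muY s]_y \int[Q]_om (((al <= rank_stat s y om <= be)%R)%:R)%:E <= (be - al)%:E)%E.
Proof.
pose G k y := (\int[Q]_om (share (zvec s y om) k)%:E)%E.
have G0 k y : (0 <= G k y)%E by apply: integral_ge0 => om _; rewrite lee_fin.
have mz k : measurable_fun setT (fun z : R * Om => (share (zvec s z.1 z.2) k)%:E).
  apply: mf_EFin; apply: (mf_rank_share _ _) => l; rewrite /zvec.
  case: (boolP (l == N s :> nat)) => lN /=; first exact: measurable_fst.
  apply: (measurableT_comp (mY_sample s l)); exact: measurable_snd.
have mG k : measurable_fun setT (G k).
  by apply: (measurable_fun_fubini_tonelli_F _ (mz k)) => z; rewrite lee_fin.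
have mzy k y : measurable_fun setT (fun om => (share (zvec s y om) k)%:E).
  apply: mf_EFin; apply: (mf_rank_share _ _) => l; rewrite /zvec.
  case: (boolP (l == N s :> nat)) => lN /=; [exact: mf_cst|exact: mY_sample].
have sumG : (\sum_(k < (N s).+1) \int[muY s]_y G k y <= (B - A)%:E)%E.
  rewrite -ge0_integral_sum//.
  apply: (@le_trans _ _ (\int[muY s]_y (B - A)%:E)%E); last first.
    by rewrite integral_cst// [X in (_ * X)%E]probability_setT mule1.
  apply: ge0_le_integral_nomeas => y _; first by apply: sume_ge0.
  rewrite /G -ge0_integral_sum//; last by move=> k om _; rewrite lee_fin.
  apply: (@le_trans _ _ (\int[Q]_om (B - A)%:E)%E); last first.
    by rewrite integral_cst// [X in (_ * X)%E]probability_setT mule1.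
  apply: ge0_le_integral_nomeas => om _; first by apply: sume_ge0 => k _; rewrite lee_fin.
  by rewrite sumEFin lee_fin; exact: sum_rank_share.
have e k : (\int[muY s]_y G k y = \int[muY s]_y G ord_max y)%E by apply/esym; exact: exchange.
rewrite (eq_bigr _ (fun k _ => e k)) in sumG.
apply: (@le_trans _ _ (\int[muY s]_y G ord_max y)%E).
  apply: ge0_le_integral_nomeas => y _; last exact: average_U.
  by apply: integral_ge0 => om _; rewrite lee_fin.
have I0 : (0 <= \int[muY s]_y G ord_max y)%E by apply: integral_ge0.
case: (\int[muY s]_y G ord_max y)%E I0 sumG => [r| |] // I0.
  rewrite sumEFin sumr_const card_ord !lee_fin -mulr_natl -natr1 -/n1 => h.
  by rewrite -(ler_pM2l n1_gt0) mulrBr ![n1 * _]mulrC (le_trans _ h)// mulrC.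
rewrite big_ord_recl addye//.
by rewrite -ltNye (lt_le_trans _ (sume_ge0 _ _)).
Qed.

End uniform.

(** * The risk integrated over the auxiliary sample *)

Section risk.
Variables (fstar : p.-tuple R -> 'I_K -> R) (sigma Lam L q : R).
Hypothesis mfstar : forall s, measurable_fun setT (fun x => fstar x s).
Hypothesis sigma0 : 0 <= sigma.
Hypothesis Lam0 : 0 < Lam.
Hypothesis q1 : 1 <= q.

Let mu s := law_of Q (mXa s 0).

Hypothesis density : forall s (c e : R), c <= e ->
  (mu s [set x | (c <= fstar x s <= e)%R] <= (Lam * (e - c))%:E)%E.

Definition dev s x := `|f x s - fstar x s| + sigma.
Definition cdf_law s t := fine (mu s [set x | fstar x s <= t]).

Let dev0 s x : 0 <= dev s x. Proof. by rewrite addr_ge0. Qed.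

Let mdev s : measurable_fun setT (dev s).
Proof. by rewrite /dev; meas using mf mfstar. Qed.

Let mcdf s : measurable_fun setT (cdf_law s).
Proof.
apply: nondecreasing_measurable => // x y xy.
have mS t : measurable [set x | fstar x s <= t].
  by apply: measurable_bool; meas using mfstar.
rewrite /cdf_law fine_le ?fin_num_measure// le_measure ?inE// => z /= h.
exact: le_trans xy.
Qed.

Lemma test_rank_moment s :
  (\int[mu s]_x \int[Q]_om
     (powR ((2 + rank_err (index_enum 'I_(N s)) (fun j => fstar (Xa s j om) s) (fun j => dev s (Xa s j om))
       (cdf_law s (fstar x s)) (fstar x s) (dev s x)) / (N s)%:R) q)%:E
   <= (rank_cst Lam q)%:E * ((powR (N s)%:R (- (q / 2)))%:E + \int[mu s]_x (powR (dev s x) q)%:E))%E.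
Proof.
apply: (@rank_moment _ _ _ _ _ Q (mu s) _ (fun j : 'I_(N s) => Xa s j) (fun x => fstar x s) (dev s) Lam q) => //.
- exact: density.
- exact: index_enum_uniq.
- by apply: sample_iid; [exact: ord_inj|move=> j; exact: N2].
- by rewrite size_index_ord.
Qed.

Definition Ys s om (i : 'I_(N s)) := Y s (N s + i) om.
Definition Ts s om (i : 'I_(N s)) := fstar (Xa s (N s + i) om) s.
Definition Ds s om (i : 'I_(N s)) := dev s (Xa s (N s + i) om).

Let hN s (i : 'I_(N s)) : (N s + i < 2 * N s)%N.
Proof. by rewrite mul2n -addnn ltn_add2l. Qed.

Let mf_rank_err {d' : measure_display} {T' : measurableType d'} {I : eqType} (J : seq I)
    (Tf Df : T' -> I -> R) (F t0 D0 : T' -> R) :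
  (forall i, i \in J -> measurable_fun setT (fun x => Tf x i)) ->
  (forall i, i \in J -> measurable_fun setT (fun x => Df x i)) ->
  measurable_fun setT F -> measurable_fun setT t0 -> measurable_fun setT D0 ->
  measurable_fun setT (fun x => rank_err J (Tf x) (Df x) (F x) (t0 x) (D0 x)).
Proof.
move=> mT mD mF mt0 mD0; rewrite /rank_err; apply: mf_D.
  by apply: mf_abs; apply: mf_sum_in => i iJ; have h := mT i iJ; meas.
by apply: mf_sum_in => i iJ; have h := mT i iJ; have h' := mD i iJ; meas.
Qed.

Let law_second s (i : 'I_(N s)) (psi : p.-tuple R -> \bar R) :
  measurable_fun setT psi -> (forall x, 0 <= psi x)%E ->
  (\int[Q]_om psi (Xa s (N s + i) om) = \int[mu s]_x psi x)%E.
Proof.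
move=> mpsi psi0; rewrite (integral_law _ (mXa s 0))//.
by apply: integral_eq_law => // B mB; apply: law_Xa.
Qed.

(** Decoupling the point [i] from the rest of its half-sample turns it into a test point, so
    [rank_moment] applies with the other [N s - 1] points as sample. *)
Let loo s (i : 'I_(N s)) :
  (\int[Q]_om (powR ((2 + loo_err (cdf_law s) (Ts s om) (Ds s om) i) / (N s)%:R) q)%:E
   <= (rank_cst Lam q)%:E * ((powR (N s)%:R (- (q / 2)))%:E + \int[mu s]_x (powR (dev s x) q)%:E))%E.
Proof.
pose Ji := [seq j <- index_enum 'I_(N s) | j != i].
pose J1 := [:: ix s (N s + i)].
pose J2 := [seq ix s (N s + nat_of_ord j) | j <- Ji].
have uJ : uniq (J1 ++ J2).
  rewrite /= map_inj_uniq ?filter_uniq ?index_enum_uniq ?andbT//; last first.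
    by move=> j k [/addnI/ord_inj].
  by apply/mapP => -[j]; rewrite mem_filter => /andP[ji _] [/addnI/ord_inj ij]; rewrite ij eqxx in ji.
have JD k : k \in J1 ++ J2 -> D k.
  by rewrite mem_cat inE => /orP[/eqP->|/mapP[j _ ->]]; exact: hN.
pose G (x : p.-tuple R) om : \bar R := (powR ((2 + rank_err Ji (Ts s om) (Ds s om)
   (cdf_law s (fstar x s)) (fstar x s) (dev s x)) / (N s)%:R) q)%:E.
have G0 x om : (0 <= G x om)%E by rewrite lee_fin powR_ge0.
have mG (d' : measure_display) (T' : measurableType d') (x : T' -> p.-tuple R) (W : T' -> Om) :
    measurable_fun setT x -> (forall j, j \in Ji -> measurable_fun setT (fun t => Xa s (N s + j) (W t))) ->
    measurable_fun setT (fun t => G (x t) (W t)).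
  move=> mx mW.
  have m1 : measurable_fun setT (fun t => fstar (x t) s) by exact: (measurableT_comp (mfstar s) mx).
  have m2 : measurable_fun setT (fun t => dev s (x t)) by exact: (measurableT_comp (mdev s) mx).
  have m3 : measurable_fun setT (fun t => cdf_law s (fstar (x t) s)) by exact: (measurableT_comp (mcdf s) m1).
  rewrite /G; apply: mf_EFin; apply: mf_pow; apply: mf_M; last exact: mf_cst.
  apply: mf_D; first exact: mf_cst.
  apply: mf_rank_err => // j jJ; first exact: (measurableT_comp (mfstar s) (mW j jJ)).
  exact: (measurableT_comp (mdev s) (mW j jJ)).
rewrite (_ : (\int[Q]_om _)%E = (\int[Q]_om G (Xa s (N s + i) om) om)%E)//.
rewrite (decoupleE J1 J2 (fun om om' => G (Xa s (N s + i) om) om') uJ JD)//; last first.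
  apply: mG; first by apply: (measurableT_comp (mX J1 s (N s + i) _)); rewrite ?inE//; exact: measurable_fst.
  move=> j jJ; apply: (measurableT_comp (mX J2 s (N s + j) _)); last exact: measurable_snd.
  by apply/mapP; exists j.
rewrite (law_second s i (fun x => \int[Q]_om' G x om')%E); last 2 first.
- apply: (measurable_fun_fubini_tonelli_F (fun z : p.-tuple R * Om => G z.1 z.2)) => [|z]; last exact: G0.
  apply: mG; first exact: measurable_fst.
  by move=> j _; apply: (measurableT_comp (mXa s (N s + j))); exact: measurable_snd.
- by move=> x; apply: integral_ge0.
apply: (@rank_moment _ _ _ _ _ Q (mu s) _ (fun j : 'I_(N s) => Xa s (N s + j)) (fun x => fstar x s) (dev s) Lam q) => //.
- exact: density.
- by rewrite filter_uniq// index_enum_uniq.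
- by apply: sample_iid; [move=> j k /addnI/ord_inj|exact: hN].
- by rewrite size_filter (leq_trans (count_size _ _))// size_index_ord.
Qed.

Definition cells_cst : R := powR 2 q * (1 + powR L q * rank_cst Lam q).

Let cost s om i : R := cell_cost (Ts s om) (Ds s om) (cdf_law s) L q i.

Let cost0 s om i : 0 <= cost s om i.
Proof. by rewrite /cost /cell_cost mulr_ge0 ?addr_ge0 ?mulr_ge0 ?powR_ge0. Qed.

Let mcost s i {d' : measure_display} {T' : measurableType d'} (W : T' -> Om) :
  (forall j : 'I_(N s), measurable_fun setT (fun t => Xa s (N s + j) (W t))) ->
  measurable_fun setT (fun t => cost s (W t) i).
Proof.
move=> mW.
have m1 j : measurable_fun setT (fun t => Ts s (W t) j) by exact: (measurableT_comp (mfstar s) (mW j)).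
have m2 j : measurable_fun setT (fun t => Ds s (W t) j) by exact: (measurableT_comp (mdev s) (mW j)).
have m3 : measurable_fun setT (fun t => cdf_law s (Ts s (W t) i)) by exact: (measurableT_comp (mcdf s) (m1 i)).
rewrite /cost /cell_cost /loo_err; apply: mf_M; first exact: mf_cst.
apply: mf_D; first by apply: mf_pow.
apply: mf_M; first exact: mf_cst.
apply: mf_pow; apply: mf_M; last exact: mf_cst.
by apply: mf_D; [exact: mf_cst|exact: mf_rank_err].
Qed.

Let int_cost s i : (\int[Q]_om (cost s om i)%:E <=
  cells_cst%:E * ((powR (N s)%:R (- (q / 2)))%:E + \int[mu s]_x (powR (dev s x) q)%:E))%E.
Proof.
set P : R := powR _ _; set ID := (\int[mu s]_x _)%E.
have ID0 : (0 <= ID)%E by apply: integral_ge0 => x _; rewrite lee_fin powR_ge0.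
have P0 : 0 <= P by exact: powR_ge0.
have r0 : 0 <= rank_cst Lam q.
  by rewrite /rank_cst; have ? := moment_cst_ge0 q; have ? := ltW Lam0; nneg.
pose e om := powR ((2 + loo_err (cdf_law s) (Ts s om) (Ds s om) i) / (N s)%:R) q.
have m1 j : measurable_fun setT (fun t => Ts s t j) by exact: (measurableT_comp (mfstar s)).
have m2 j : measurable_fun setT (fun t => Ds s t j) by exact: (measurableT_comp (mdev s)).
have m3 : measurable_fun setT (fun t => cdf_law s (Ts s t i)) by exact: (measurableT_comp (mcdf s) (m1 i)).
have me : measurable_fun setT (fun om => (e om)%:E).
  apply: mf_EFin; apply: mf_pow; apply: mf_M; last exact: mf_cst.
  by apply: mf_D; [exact: mf_cst|exact: mf_rank_err].
have mD' : measurable_fun setT (fun om => (powR (Ds s om i) q)%:E).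
  by apply: mf_EFin; exact: mf_pow.
have mLe : measurable_fun setT (fun om => (powR L q)%:E * (e om)%:E)%E by apply: measurable_funeM.
rewrite (_ : (\int[Q]_om _)%E = (\int[Q]_om ((powR 2 q)%:E * (0 + ((powR (Ds s om i) q)%:E
   + (powR L q)%:E * (e om)%:E))))%E); last first.
  by apply: eq_integral => om _; rewrite add0e.
have pe om : (0 <= (e om)%:E)%E by rewrite lee_fin powR_ge0.
have pL om : (0 <= (powR L q)%:E * (e om)%:E)%E by rewrite mule_ge0// lee_fin powR_ge0.
have pD om : (0 <= (powR (Ds s om i) q)%:E)%E by rewrite lee_fin powR_ge0.
rewrite (integral_affineD Q _ _ _ _ (powR_ge0 _ _) (lexx 0%E) mD' mLe pD pL) add0e.
rewrite (ge0_integralZl_EFin Q measurableT (fun om _ => pe om) me (powR_ge0 _ _)).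
rewrite (law_second s i (fun x => (powR (dev s x) q)%:E)); last 2 first.
- by apply: mf_EFin; apply: mf_pow; exact: mdev.
- by move=> x; rewrite lee_fin powR_ge0.
have h := loo s i; rewrite -/P -/ID in h.
rewrite /cells_cst EFinM -muleA; apply: lee_wpmul2l; first by rewrite lee_fin powR_ge0.
have Lr0 : 0 <= powR L q * rank_cst Lam q by apply: mulr_ge0 => //; exact: powR_ge0.
rewrite EFinD ge0_muleDl ?lee_fin// mul1e; apply: leeD.
  by rewrite leeDr// lee_fin.
by rewrite EFinM -muleA; apply: lee_wpmul2l; first by rewrite lee_fin powR_ge0.
Qed.

(** The bound of [quantile_cell] at the rank of a test score of group [s], averaged over the law of
    that score; [s'] is the group whose quantile is read. *)
Definition cells_sum s s' om : \bar R :=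
  (\sum_(i < N s') ((cell_cost (Ts s' om) (Ds s' om) (cdf_law s') L q i / cell_mult (Ys s' om) i)%:E *
     \int[muY s]_y (((cell_lo (Ys s' om) i <= rank_stat s y om <= cell_hi (Ys s' om) i)%R)%:R)%:E))%E.

Let m_lo s' i {d' : measure_display} {T' : measurableType d'} (W : T' -> Om) :
  (forall j : 'I_(N s'), measurable_fun setT (fun t => Ys s' (W t) j)) ->
  [/\ measurable_fun setT (fun t => cell_lo (Ys s' (W t)) i),
      measurable_fun setT (fun t => cell_hi (Ys s' (W t)) i) &
      measurable_fun setT (fun t => (cell_mult (Ys s' (W t)) i)^-1)].
Proof.
move=> mW; split; rewrite /cell_lo /cell_hi /cell_mult; try by meas using mW.
by apply: mf_V => [t|]; [rewrite sumr_ge0|meas using mW].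
Qed.

Let m_stat s {d' : measure_display} {T' : measurableType d'} (y : T' -> R) (W : T' -> Om) :
  measurable_fun setT y -> (forall j : 'I_(N s), measurable_fun setT (fun t => Y s j (W t))) ->
  measurable_fun setT (fun t => Ua s (W t)) ->
  measurable_fun setT (fun t => rank_stat s (y t) (W t)).
Proof.
move=> my mW mUW.
rewrite (_ : (fun t => _) = (fun t => ((N s)%:R + 1)^-1 * (\sum_(i < N s) ((Y s i (W t) < y t)%R)%:R
   + Ua s (W t) * (1 + \sum_(i < N s) ((Y s i (W t) == y t)%R)%:R))))//.
by meas using mW mUW.
Qed.

(** The cells depend on the second half of group [s'], the rank on the first half and the
    tie-breaker of group [s]. Once these are decoupled, a cell is hit with probability at most its
    length [cell_mult / N s'], which cancels the division by the multiplicity. *)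
Let int_cell s s' (i : 'I_(N s')) :
  (\int[Q]_om ((cost s' om i / cell_mult (Ys s' om) i)%:E *
     \int[muY s]_y (((cell_lo (Ys s' om) i <= rank_stat s y om <= cell_hi (Ys s' om) i)%R)%:R)%:E)
   <= ((N s')%:R^-1)%:E * \int[Q]_om (cost s' om i)%:E)%E.
Proof.
pose J1 := smp s' (iota (N s') (N s')).
pose J2 := smp s (iota 0 (N s)) ++ [:: iu s].
have u12 : uniq (J1 ++ J2).
  rewrite catA cat_uniq smp2_uniq ?iota_uniq//=; last first.
    (* For [s = s'] the blocks are still disjoint, since the two halves use disjoint index
       ranges. *)
    case: eqP => //= ->; apply/hasPn => k; rewrite mem_iota add0n => /andP[_ kN].
    by rewrite /= mem_iota leqNgt kN.
  by rewrite andbT orbF mem_cat negb_or; apply/andP; split; apply/negP => /smp_inv[j _ []].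
have JD k : k \in J1 ++ J2 -> D k.
  rewrite mem_cat /J2 mem_cat => /or3P[/smp_D|/smp_D|].
  - by apply=> j; rewrite mem_iota => /andP[_]; rewrite mul2n -addnn.
  - by apply=> j; rewrite mem_iota => /andP[_]; exact: N2.
  - by rewrite inE => /eqP->.
have in1 (j : 'I_(N s')) : (N s' + j)%N \in iota (N s') (N s').
  by rewrite mem_iota leq_addr ltn_add2l ltn_ord.
have in2 (j : 'I_(N s)) : nat_of_ord j \in iota 0 (N s) by rewrite mem_iota /=.
pose I1 om om' y : \bar R :=
  (((cell_lo (Ys s' om) i <= rank_stat s y om' <= cell_hi (Ys s' om) i)%R)%:R)%:E.
have I0 om om' y : (0 <= I1 om om' y)%E by rewrite lee_fin.
pose k om := cost s' om i / cell_mult (Ys s' om) i.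
have k0 om : 0 <= k om by rewrite divr_ge0// /cell_mult sumr_ge0.
pose O1 := O J1; pose O2 := O J2.
have mY1 j : measurable_fun setT (fun om : O1 => Ys s' om j) by apply: mY_gen.
have mX1 (j : 'I_(N s')) : measurable_fun setT (fun om : O1 => Xa s' (N s' + j) om).
  by apply: mX; apply: smp_ix.
have mY2 (j : 'I_(N s)) : measurable_fun setT (fun om : O2 => Y s j om).
  by apply: mY; rewrite mem_cat ?smp_ix ?smp_iz.
have mU2 : measurable_fun setT (fun om : O2 => Ua s om).
  by apply: mU; rewrite mem_cat inE eqxx orbT.
have [lo1 hi1 mu1] := m_lo s' i (fun om : O1 => om) mY1.
have mk : measurable_fun setT (fun om : O1 => k om).
  by rewrite /k; apply: mf_M => //; exact: (mcost s' i (fun om : O1 => om) mX1).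
have mI (d' : measure_display) (T' : measurableType d') (a : T' -> O1) (b : T' -> O2) (y : T' -> R) :
    measurable_fun setT a -> measurable_fun setT b -> measurable_fun setT y ->
    measurable_fun setT (fun t => I1 (a t) (b t) (y t)).
  move=> ma mb my.
  have lo2 := measurableT_comp lo1 ma; have hi2 := measurableT_comp hi1 ma.
  have ms : measurable_fun setT (fun t => rank_stat s (y t) (b t)).
    apply: m_stat => //; last exact: (measurableT_comp mU2 mb).
    by move=> j; exact: (measurableT_comp (mY2 j) mb).
  by rewrite /I1; apply: mf_EFin; apply: mf_b2r; apply: mf_and; apply: mf_le.
have mI' : measurable_fun setT (fun z : O1 * O2 => \int[muY s]_y I1 z.1 z.2 y)%E.
  apply: (measurable_fun_fubini_tonelli_F (m2 := muY s) (fun z : (O1 * O2) * R => I1 z.1.1 z.1.2 z.2)) => [|z]; last exact: I0.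
  apply: mI; last exact: measurable_snd.
    by apply: (measurableT_comp (@measurable_fst _ _ _ _)); exact: measurable_fst.
  by apply: (measurableT_comp (@measurable_snd _ _ _ _)); exact: measurable_fst.
rewrite (decoupleE J1 J2 (fun om om' => (k om)%:E * \int[muY s]_y I1 om om' y)%E u12 JD); last 2 first.
- apply: emeasurable_funM => //; apply: mf_EFin; apply: (measurableT_comp mk); exact: measurable_fst.
- by move=> om om'; apply: mule_ge0; [rewrite lee_fin|apply: integral_ge0].
have mId : measurable_fun setT (fun om : Om => om : O2).
  move=> _ B mB; rewrite setTI; apply: (sub_gen (gen E J2)) mB; apply: gen_measurable; do ?[exact: Em|exact: ET|exact: EI|exact: indep].
have NR0 : 0 < (N s')%:R :> R by rewrite ltr0n.
have c0 om : (0 <= (cost s' om i)%:E)%E by rewrite lee_fin.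
have mc : measurable_fun setT (fun om => (cost s' om i)%:E).
  by apply: mf_EFin; exact: (mcost s' i id (fun j => mXa s' (N s' + j))).
have NI0 : 0 <= (N s')%:R^-1 :> R by rewrite invr_ge0 ltW.
rewrite -(ge0_integralZl_EFin Q measurableT (fun om _ => c0 om) mc NI0).
apply: ge0_le_integral_nomeas => om _.
  by apply: integral_ge0 => om' _; apply: mule_ge0; [rewrite lee_fin|apply: integral_ge0].
have mIy : measurable_fun setT (fun z : Om * R => I1 om z.1 z.2).
  apply: (mI _ _ (fun _ : Om * R => om) (fun z : Om * R => z.1) (fun z : Om * R => z.2)) => //.
    by apply: (measurableT_comp mId); exact: measurable_fst.
  exact: measurable_snd.
rewrite ge0_integralZl_EFin//; last 2 first.
- by move=> om' _; apply: integral_ge0.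
- by apply: (measurable_fun_fubini_tonelli_F (m2 := muY s) _ mIy).
rewrite (fubini_tonelli (m1 := Q) (m2 := muY s) (fun z : Om * R => I1 om z.1 z.2) mIy)//=.
have mult0 : 0 < cell_mult (Ys s' om) i.
  by rewrite /cell_mult (bigD1 i)//= eqxx ltr_pwDl// sumr_ge0.
have lohi : cell_hi (Ys s' om) i - cell_lo (Ys s' om) i = cell_mult (Ys s' om) i / (N s')%:R.
  rewrite /cell_hi /cell_lo /cell_mult -mulrBl -sumrB; congr (_ / _); apply: eq_bigr => l _.
  by case: ltgtP; rewrite ?subrr ?subr0.
have le_lohi : cell_lo (Ys s' om) i <= cell_hi (Ys s' om) i.
  by rewrite -subr_ge0 lohi divr_ge0// ltW.
apply: (@le_trans _ _ ((k om)%:E * (cell_hi (Ys s' om) i - cell_lo (Ys s' om) i)%:E)%E).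
  by apply: lee_wpmul2l; [rewrite lee_fin|exact: rank_stat_uniform].
rewrite -!EFinM lee_fin lohi /k le_eqVlt; apply/orP; left; apply/eqP.
by field; rewrite !gt_eqF.
Qed.

Let m_cell_term s s' (i : 'I_(N s')) : measurable_fun setT (fun om =>
  ((cell_cost (Ts s' om) (Ds s' om) (cdf_law s') L q i / cell_mult (Ys s' om) i)%:E *
     \int[muY s]_y (((cell_lo (Ys s' om) i <= rank_stat s y om <= cell_hi (Ys s' om) i)%R)%:R)%:E)%E).
Proof.
have [lo1 hi1 mu1] := m_lo s' i id (fun j => mY_sample s' (N s' + j)).
apply: emeasurable_funM.
  by apply: mf_EFin; apply: mf_M => //; exact: (mcost s' i id (fun j => mXa s' (N s' + j))).
apply: (measurable_fun_fubini_tonelli_F (m2 := muY s) (fun z : Om * R =>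
  (((cell_lo (Ys s' z.1) i <= rank_stat s z.2 z.1 <= cell_hi (Ys s' z.1) i)%R)%:R)%:E)).
  have lo2 := measurableT_comp lo1 (@measurable_fst _ _ Om R).
  have hi2 := measurableT_comp hi1 (@measurable_fst _ _ Om R).
  have ms : measurable_fun setT (fun z : Om * R => rank_stat s z.2 z.1).
    apply: (m_stat s (fun z : Om * R => z.2) (fun z : Om * R => z.1)).
    - exact: measurable_snd.
    - by move=> j; apply: (measurableT_comp (mY_sample s j)); exact: measurable_fst.
    - by apply: (measurableT_comp (mUa s)); exact: measurable_fst.
  by apply: mf_EFin; apply: mf_b2r; apply: mf_and; apply: mf_le.
by move=> z; rewrite lee_fin.
Qed.

Let cell_term_ge0 s s' (i : 'I_(N s')) om : (0 <=
  (cell_cost (Ts s' om) (Ds s' om) (cdf_law s') L q i / cell_mult (Ys s' om) i)%:E *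
     \int[muY s]_y (((cell_lo (Ys s' om) i <= rank_stat s y om <= cell_hi (Ys s' om) i)%R)%:R)%:E)%E.
Proof.
apply: mule_ge0; last by apply: integral_ge0 => y _; rewrite lee_fin.
by rewrite lee_fin divr_ge0 ?cost0// /cell_mult sumr_ge0.
Qed.

Lemma cells_integral s s' : (\int[Q]_om cells_sum s s' om <=
  cells_cst%:E * ((powR (N s')%:R (- (q / 2)))%:E + \int[mu s']_x (powR (dev s' x) q)%:E))%E.
Proof.
rewrite /cells_sum ge0_integral_sum//.
set c := (cells_cst%:E * _)%E.
apply: (@le_trans _ _ (\sum_(i < N s') ((N s')%:R^-1)%:E * c)%E).
  apply: lee_sum => i _; apply: le_trans (int_cell s s' i) _.
  by apply: lee_wpmul2l; [rewrite lee_fin invr_ge0|exact: int_cost].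
rewrite -ge0_sume_distrl; last by move=> i _; rewrite lee_fin invr_ge0.
rewrite (_ : (\sum_(i < N s') ((N s')%:R^-1)%:E)%E = 1%E :> \bar R) ?mul1e//.
rewrite sumEFin sumr_const card_ord; congr EFin.
by rewrite -(mulr_natl (N s')%:R^-1) mulfV// pnatr_eq0 -lt0n.
Qed.

Variable w : 'I_K -> R.
Hypothesis w0 : forall s, 0 <= w s.
Hypothesis w1 : \sum_(s < K) w s = 1.

Definition test_err s x om : R :=
  powR ((2 + rank_err (index_enum 'I_(N s)) (fun j => fstar (Xa s j om) s) (fun j => dev s (Xa s j om))
       (cdf_law s (fstar x s)) (fstar x s) (dev s x)) / (N s)%:R) q.

Let test_err0 s x om : (0 <= (test_err s x om)%:E)%E. Proof. by rewrite lee_fin powR_ge0. Qed.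

Let mtest s (d' : measure_display) (T' : measurableType d') (x : T' -> p.-tuple R) (W : T' -> Om) :
  measurable_fun setT x -> (forall j : 'I_(N s), measurable_fun setT (fun t => Xa s j (W t))) ->
  measurable_fun setT (fun t => (test_err s (x t) (W t))%:E).
Proof.
move=> mx mW.
have m1 : measurable_fun setT (fun t => fstar (x t) s) by exact: (measurableT_comp (mfstar s) mx).
have m2 : measurable_fun setT (fun t => dev s (x t)) by exact: (measurableT_comp (mdev s) mx).
have m3 : measurable_fun setT (fun t => cdf_law s (fstar (x t) s)) by exact: (measurableT_comp (mcdf s) m1).
rewrite /test_err; apply: mf_EFin; apply: mf_pow; apply: mf_M; last exact: mf_cst.
apply: mf_D; first exact: mf_cst.
apply: mf_rank_err => // j _; first exact: (measurableT_comp (mfstar s) (mW j)).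
exact: (measurableT_comp (mdev s) (mW j)).
Qed.

Let mtest_joint s : measurable_fun setT (fun z : p.-tuple R * Om => (test_err s z.1 z.2)%:E).
Proof.
apply: mtest; first exact: measurable_fst.
by move=> j; apply: (measurableT_comp (mXa s j)); exact: measurable_snd.
Qed.

Let mtest_Q s : measurable_fun setT (fun om => \int[mu s]_x (test_err s x om)%:E)%E.
Proof.
by apply: (measurable_fun_fubini_tonelli_G (m1 := mu s) _ (mtest_joint s)).
Qed.

Lemma test_err_integral s : (\int[Q]_om \int[mu s]_x (test_err s x om)%:E <=
  (rank_cst Lam q)%:E * ((powR (N s)%:R (- (q / 2)))%:E + \int[mu s]_x (powR (dev s x) q)%:E))%E.
Proof.
rewrite -(fubini_tonelli (m1 := mu s) (m2 := Q) _ (mtest_joint s))//.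
exact: test_rank_moment.
Qed.

Definition cell_weight s' om i : R :=
  cell_cost (Ts s' om) (Ds s' om) (cdf_law s') L q i / cell_mult (Ys s' om) i.

Let cell_weight0 s' om i : 0 <= cell_weight s' om i.
Proof. by rewrite divr_ge0 ?cost0// /cell_mult sumr_ge0. Qed.

Definition cells_at s om y : R := \sum_(s' < K) w s' * \sum_(i < N s') cell_weight s' om i *
  ((cell_lo (Ys s' om) i <= rank_stat s y om <= cell_hi (Ys s' om) i)%R)%:R.

Let cells_at0 s om y : 0 <= cells_at s om y.
Proof. by apply: sumr_ge0 => s' _; rewrite mulr_ge0// sumr_ge0// => i _; rewrite mulr_ge0. Qed.

Definition loss_cst : R := powR 2 q * powR K%:R q.

(** Dominates the [q]-th power of the loss at [(x, z)]: the error of the empirical quantiles at the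
    rank, plus the error of the rank itself carried through Lipschitz quantile functions. *)
Definition majorant s om x z : R := loss_cst * (cells_at s om (f x s + z) + powR L q * test_err s x om).

Let loss_cst0 : 0 <= loss_cst. Proof. by rewrite mulr_ge0 ?powR_ge0. Qed.

Lemma majorant_ge0 s om x z : 0 <= majorant s om x z.
Proof. by rewrite mulr_ge0// addr_ge0// mulr_ge0 ?powR_ge0. Qed.

Let mind s om s' (i : 'I_(N s')) : measurable_fun setT (fun y =>
  ((cell_lo (Ys s' om) i <= rank_stat s y om <= cell_hi (Ys s' om) i)%R)%:R : R).
Proof.
have ms : measurable_fun setT (fun y => rank_stat s y om).
  by apply: (m_stat s (fun y : R => y) (fun=> om)) => //; exact: measurable_id.
by apply: mf_b2r; apply: mf_and; apply: mf_le => //; exact: mf_cst.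
Qed.

Let mcells_at s om : measurable_fun setT (cells_at s om).
Proof.
apply: mf_sum => s'; apply: mf_M; first exact: mf_cst.
by apply: mf_sum => i; apply: mf_M; [exact: mf_cst|exact: mind].
Qed.

Lemma majorant_measurable s om :
  measurable_fun setT (fun xz : p.-tuple R * R => (majorant s om xz.1 xz.2)%:E).
Proof.
apply: mf_EFin; apply: mf_M; first exact: mf_cst.
apply: mf_D.
  apply: (measurableT_comp (mcells_at s om)); apply: mf_D; last exact: measurable_snd.
  by apply: (measurableT_comp (mf s)); exact: measurable_fst.
apply: mf_M; first exact: mf_cst.
apply/measurable_EFinP; apply: (mtest s _ _ (fun xz : p.-tuple R * R => xz.1) (fun=> om)) => //.
exact: measurable_fst.
Qed.

Let int_cells_at s om :
  (\int[muY s]_y (cells_at s om y)%:E = \sum_(s' < K) (w s')%:E * cells_sum s s' om)%E.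
Proof.
rewrite /cells_at; under eq_integral => y _ do rewrite -sumEFin.
rewrite ge0_integral_sum//; last 2 first.
- move=> s'; apply: mf_EFin; apply: mf_M; first exact: mf_cst.
  by apply: mf_sum => i; apply: mf_M; [exact: mf_cst|exact: mind].
- by move=> s' y _; rewrite lee_fin mulr_ge0// sumr_ge0// => i _; rewrite mulr_ge0.
apply: eq_bigr => s' _; under eq_integral => y _ do rewrite EFinM.
rewrite ge0_integralZl_EFin//; last 2 first.
- by move=> y _; rewrite lee_fin sumr_ge0// => i _; rewrite mulr_ge0.
- by apply: mf_EFin; apply: mf_sum => i; apply: mf_M; [exact: mf_cst|exact: mind].
congr (_ * _)%E; under eq_integral => y _ do rewrite -sumEFin.
rewrite ge0_integral_sum//; last 2 first.
- by move=> i; apply: mf_EFin; apply: mf_M; [exact: mf_cst|exact: mind].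
- by move=> i y _; rewrite lee_fin mulr_ge0.
apply: eq_bigr => i _; under eq_integral => y _ do rewrite EFinM.
rewrite ge0_integralZl_EFin//; last by apply: mf_EFin; exact: mind.
Qed.

(** The cell part sees the test pair only through its perturbed score, so its double integral
    reduces to one over [muY s]; the rank part is a function of the feature alone. *)
Lemma majorant_integral s om :
  (\int[Q]_om1 \int[Q]_om2 (majorant s om (Xa s 0 om1) (Za s 0 om2))%:E =
   loss_cst%:E * (\sum_(s' < K) (w s')%:E * cells_sum s s' om
                  + (powR L q)%:E * \int[mu s]_x (test_err s x om)%:E))%E.
Proof.
have mtx : measurable_fun setT (fun x => (test_err s x om)%:E).
  by apply: (mtest s _ _ (fun x => x) (fun=> om)) => //; exact: measurable_id.
pose h2 x : \bar R := ((powR L q)%:E * (test_err s x om)%:E)%E.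
have h20 x : (0 <= h2 x)%E by rewrite mule_ge0// lee_fin powR_ge0.
have mh2 : measurable_fun setT h2 by apply: measurable_funeM.
pose h1 x z : \bar R := (cells_at s om (f x s + z)%R)%:E.
have h10 x z : (0 <= h1 x z)%E by rewrite lee_fin.
have mh1 x : measurable_fun setT (fun om2 => h1 x (Za s 0 om2)).
  apply: mf_EFin; apply: (measurableT_comp (mcells_at s om)); apply: mf_D; [exact: mf_cst|exact: mZa].
have mh1' : measurable_fun setT (fun om1 => \int[Q]_om2 h1 (Xa s 0 om1) (Za s 0 om2))%E.
  apply: (measurable_fun_fubini_tonelli_F (fun z : Om * Om => h1 (Xa s 0 z.1) (Za s 0 z.2))) => //.
  apply: mf_EFin; apply: (measurableT_comp (mcells_at s om)); apply: mf_D.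
    apply: (measurableT_comp (mf s)); apply: (measurableT_comp (mXa s 0)); exact: measurable_fst.
  apply: (measurableT_comp (mZa s 0)); exact: measurable_snd.
transitivity (\int[Q]_om1 (loss_cst%:E * (0 + (\int[Q]_om2 h1 (Xa s 0 om1) (Za s 0 om2) + h2 (Xa s 0 om1)))))%E.
  apply: eq_integral => om1 _.
  rewrite (_ : (\int[Q]_om2 _)%E = (\int[Q]_om2 (loss_cst%:E * (0 + (h1 (Xa s 0 om1) (Za s 0 om2) + h2 (Xa s 0 om1)))))%E); last first.
    by apply: eq_integral => om2 _; rewrite add0e.
  have mc2 : measurable_fun setT (fun _ : Om => h2 (Xa s 0 om1)) by exact: measurable_cst.
  have p1 om2 : (0 <= h1 (Xa s 0 om1) (Za s 0 om2))%E by [].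
  have p2 (om2 : Om) : (0 <= h2 (Xa s 0 om1))%E by [].
  rewrite (integral_affineD Q _ _ _ _ loss_cst0 (lexx 0%E) (mh1 _) mc2 p1 p2).
  by rewrite integral_cst// [X in (_ * (_ + (_ + _ * X)) = _)%E]probability_setT mule1.
rewrite (integral_affineD Q _ _ _ _ loss_cst0 (lexx 0%E) mh1' (measurableT_comp mh2 (mXa s 0)) _ (fun=> h20 _)); last first.
  by move=> om1; apply: integral_ge0.
rewrite add0e; congr (_ * (_ + _))%E.
  rewrite -(law_YE s 0 (fun y => (cells_at s om y)%:E)); last 3 first.
  - by rewrite muln_gt0 N0.
  - by apply: mf_EFin.
  - by move=> y; rewrite lee_fin.
  rewrite (law_Y s 0 (fun y => (cells_at s om y)%:E)); last 3 first.
  - by rewrite muln_gt0 N0.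
  - by apply: mf_EFin.
  - by move=> y; rewrite lee_fin.
  exact: int_cells_at.
rewrite -(integral_law Q (mXa s 0) h2 mh2 h20).
by rewrite /h2 ge0_integralZl_EFin// powR_ge0.
Qed.

Let rk0 : 0 <= rank_cst Lam q.
Proof. by rewrite /rank_cst; have ? := moment_cst_ge0 q; have ? := ltW Lam0; nneg. Qed.

Definition risk_cst : R := loss_cst * (cells_cst + powR L q * rank_cst Lam q).

Let cells_sum0 s s' om : (0 <= cells_sum s s' om)%E.
Proof. by apply: sume_ge0 => i _; exact: cell_term_ge0. Qed.

Let mcells_sum s s' : measurable_fun setT (cells_sum s s').
Proof. by apply: emeasurable_sum => i; exact: m_cell_term. Qed.

(* The test pair is replaced by copies of [Xa s 0] and [Za s 0] that are independent of the whole auxiliary sample. *)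
Definition risk_majorant om : \bar R :=
  (\sum_(s < K) (w s)%:E * \int[Q]_om1 \int[Q]_om2 (majorant s om (Xa s 0 om1) (Za s 0 om2))%:E)%E.

Let term s om : \bar R := (loss_cst%:E * (0 + (\sum_(s' < K) (w s')%:E * cells_sum s s' om
                  + (powR L q)%:E * \int[mu s]_x (test_err s x om)%:E)))%E.

Let sumc0 s om : (0 <= \sum_(s' < K) (w s')%:E * cells_sum s s' om)%E.
Proof. by apply: sume_ge0 => s' _; rewrite mule_ge0// lee_fin. Qed.

Let sumt0 s om : (0 <= (powR L q)%:E * \int[mu s]_x (test_err s x om)%:E)%E.
Proof. by rewrite mule_ge0 ?lee_fin ?powR_ge0//; apply: integral_ge0. Qed.

Let msumc s : measurable_fun setT (fun om => \sum_(s' < K) (w s')%:E * cells_sum s s' om)%E.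
Proof. by apply: emeasurable_sum => s'; apply: measurable_funeM. Qed.

Let msumt s : measurable_fun setT (fun om => (powR L q)%:E * \int[mu s]_x (test_err s x om)%:E)%E.
Proof. by apply: measurable_funeM. Qed.

Let risk_majorantE om : risk_majorant om = (\sum_(s < K) (w s)%:E * term s om)%E.
Proof. by apply: eq_bigr => s _; rewrite majorant_integral /term add0e. Qed.

Let term0 s om : (0 <= term s om)%E.
Proof. by rewrite /term mule_ge0 ?lee_fin// adde_ge0// adde_ge0. Qed.

Let mterm s : measurable_fun setT (term s).
Proof.
apply: measurable_funeM; apply: (emeasurable_funD (measurable_cst 0%E)).
exact: (emeasurable_funD (msumc s) (msumt s)).
Qed.

Lemma risk_majorant_ge0 om : (0 <= risk_majorant om)%E.
Proof. by rewrite risk_majorantE; apply: sume_ge0 => s _; rewrite mule_ge0// lee_fin. Qed.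

Lemma risk_majorant_measurable : measurable_fun setT risk_majorant.
Proof.
rewrite (_ : risk_majorant = (fun om => \sum_(s < K) (w s)%:E * term s om)%E).
  by apply: emeasurable_sum => s; apply: measurable_funeM.
by apply/funext => om; exact: risk_majorantE.
Qed.

Lemma risk_integral : (\int[Q]_om risk_majorant om <= risk_cst%:E *
  \sum_(s < K) (w s)%:E * ((powR (N s)%:R (- (q / 2)))%:E + \int[mu s]_x (powR (dev s x) q)%:E))%E.
Proof.
pose b s : \bar R := ((powR (N s)%:R (- (q / 2)))%:E + \int[mu s]_x (powR (dev s x) q)%:E)%E.
have b0 s : (0 <= b s)%E.
  by rewrite adde_ge0 ?lee_fin ?powR_ge0//; apply: integral_ge0 => x _; rewrite lee_fin powR_ge0.
have cc0 : 0 <= cells_cst.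
  by rewrite mulr_ge0 ?powR_ge0// addr_ge0// mulr_ge0 ?powR_ge0.
have Lr0 : 0 <= powR L q * rank_cst Lam q by rewrite mulr_ge0 ?powR_ge0.
set B := (\sum_(s < K) (w s)%:E * b s)%E.
have B0 : (0 <= B)%E by apply: sume_ge0 => s _; rewrite mule_ge0// lee_fin.
under eq_integral => om _ do rewrite risk_majorantE.
rewrite ge0_integral_sum//; last 2 first.
- by move=> s; apply: measurable_funeM.
- by move=> s om _; rewrite mule_ge0// lee_fin.
apply: (@le_trans _ _ (\sum_(s < K) (w s)%:E * (loss_cst%:E * (cells_cst%:E * B + (powR L q * rank_cst Lam q)%:E * b s)))%E).
  apply: lee_sum => s _; rewrite ge0_integralZl_EFin//.
  apply: lee_wpmul2l; first by rewrite lee_fin.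
  rewrite (integral_affineD Q _ _ _ _ loss_cst0 (lexx 0%E) (msumc s) (msumt s) (sumc0 s) (sumt0 s)) add0e.
  apply: lee_wpmul2l; first by rewrite lee_fin.
  apply: leeD.
    rewrite ge0_integral_sum//; last 2 first.
    - by move=> s'; apply: measurable_funeM.
    - by move=> s' om _; rewrite mule_ge0// lee_fin.
    rewrite /B ge0_sume_distrr; last by move=> s' _; rewrite mule_ge0// lee_fin.
    apply: lee_sum => s' _; rewrite ge0_integralZl_EFin// muleCA.
    by apply: lee_wpmul2l; [rewrite lee_fin|exact: cells_integral].
  rewrite ge0_integralZl_EFin ?powR_ge0//; last by move=> om _; apply: integral_ge0.
  rewrite EFinM -muleA; apply: lee_wpmul2l; first by rewrite lee_fin powR_ge0.
  exact: test_err_integral.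
rewrite (eq_bigr (fun s => (loss_cst%:E * ((w s)%:E * (cells_cst%:E * B) + (powR L q * rank_cst Lam q)%:E * ((w s)%:E * b s))))%E); last first.
  move=> s _; rewrite muleCA; congr (_ * _)%E.
  rewrite ge0_muleDr ?mule_ge0 ?lee_fin//; congr (_ + _)%E.
  by rewrite muleCA.
rewrite -ge0_sume_distrr; last by move=> s _; rewrite adde_ge0// !mule_ge0 ?lee_fin// mule_ge0.
rewrite big_split /= -ge0_sume_distrl; last by move=> s _; rewrite lee_fin.
rewrite -ge0_sume_distrr; last by move=> s _; rewrite mule_ge0// lee_fin.
(* The cell bound is the same weighted sum for every test group, so averaging it over [s] multiplies
   it by the total weight 1 and it joins the rank part. *)
rewrite sumEFin w1 mul1e -/B -ge0_muleDl ?lee_fin//.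
by rewrite -EFinD muleA -EFinM.
Qed.

End risk.

End aux.

(** * Distribution functions with bounded density *)

Section density.
Context {R : realType} {d : measure_display} {T : measurableType d}.
Context (m : probability T R) (phi : T -> R) (lo hi a b : R) (rho : R -> R).
Hypothesis mphi : measurable_fun setT phi.
Hypothesis lo0 : 0 < lo.
Hypothesis ab : a < b.
Hypothesis mrho : measurable_fun setT rho.
Hypothesis rho_in : forall x, a <= x <= b -> lo <= rho x <= hi.
Hypothesis rhoE : forall B : set R, measurable B ->
  (m (phi @^-1` B) = \int[lebesgue_measure]_(x in B `&` [set x | (a <= x <= b)%R]) (rho x)%:E)%E.

Let F t := fine (m [set x | phi x <= t]).

Let itvE (c e : R) : [set x : R | c <= x <= e] = `[c, e]%classic.
Proof. by apply/seteqP; split => x /=; rewrite in_itv. Qed.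

Let mle t : measurable [set x | phi x <= t].
Proof. by apply: measurable_bool; apply: mf_le => //; exact: mf_cst. Qed.

Let mfin t : m [set x | phi x <= t] \is a fin_num.
Proof. exact: fin_num_measure. Qed.

Lemma cdf_in01 t : 0 <= F t <= 1.
Proof.
by rewrite /F -lee_fin -[X in _ && X]lee_fin fineK// measure_ge0 probability_le1.
Qed.

Lemma cdf_le x y : x <= y -> F x <= F y.
Proof.
move=> xy; apply: fine_le => //; apply: le_measure; rewrite ?inE//.
by move=> z /= /le_trans; exact.
Qed.

Lemma density_upper c e : c <= e -> (m [set x | (c <= phi x <= e)%R] <= (hi * (e - c))%:E)%E.
Proof.
move=> ce; rewrite -[X in m X]/(phi @^-1` [set x : R | c <= x <= e]) itvE rhoE// itvE.
have hi0 : 0 <= hi by have /andP[h1 h2] := rho_in a (introT andP (conj (lexx a) (ltW ab))); have := lo0; lra.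
apply: (@le_trans _ _ (\int[lebesgue_measure]_(x in `[c, e]%classic `&` `[a, b]%classic) hi%:E)%E).
  apply: ge0_le_integral => //.
  - exact: measurableI.
  - by move=> x [_ /=]; rewrite in_itv /= => /rho_in /andP[h _]; rewrite lee_fin (le_trans (ltW lo0) h).
  - by apply/measurable_EFinP; exact: measurable_funS mrho.
  - by move=> x [_ /=]; rewrite in_itv /= => /rho_in /andP[_ h]; rewrite lee_fin.
rewrite integral_cst//; last exact: measurableI.
rewrite EFinM; apply: lee_wpmul2l; first by rewrite lee_fin.
apply: (@le_trans _ _ (lebesgue_measure `[c, e]%classic)).
  by apply: le_measure; rewrite ?inE//; exact: measurableI.
by rewrite lebesgue_measure_itv /= lte_fin; case: ltP => h; rewrite -?EFinB lee_fin// subr_ge0.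
Qed.

Lemma cdf_below x : x < a -> F x = 0.
Proof.
move=> xa; rewrite /F -[X in m X]/(phi @^-1` [set y : R | y <= x]) rhoE//.
  rewrite (_ : _ `&` _ = set0) ?integral_set0//.
  by apply/seteqP; split => // y /= [h1 /andP[h2 _]]; have := le_lt_trans (le_trans h2 h1) xa; rewrite ltxx.
by apply: measurable_bool; apply: mf_le; [exact: measurable_id|exact: mf_cst].
Qed.

Lemma cdf_above x : b <= x -> F x = 1.
Proof.
move=> bx; rewrite /F (_ : m _ = 1%E)//.
rewrite -(@probability_setT _ _ _ m) -[X in m X]/(phi @^-1` [set y : R | y <= x]) -[setT in RHS](preimage_setT phi).
rewrite !rhoE//.
  congr (integral _ _ _); apply/seteqP; split => y /= [h1 h2]; split=> //.
  by case/andP: h2 => _ h; exact: le_trans bx.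
by apply: measurable_bool; apply: mf_le; [exact: measurable_id|exact: mf_cst].
Qed.

Lemma cdf_growth x y : a <= x -> x <= y -> y <= b -> lo * (y - x) <= F y - F x.
Proof.
move=> ax xy yb.
have e : (m [set z | (phi z <= y)%R] = m [set z | (phi z <= x)%R] + m [set z | (x < phi z <= y)%R])%E.
  rewrite -measureU//.
  - congr (m _); apply/seteqP; split => z /=.
      by move=> h; case: (leP (phi z) x) => h'; [left|right; rewrite h].
    by case=> [h|/andP[_ //]]; exact: le_trans xy.
  - by apply: measurable_bool; apply: mf_and; [apply: mf_lt|apply: mf_le]; try exact: mf_cst.
  - by apply/seteqP; split => // z /= [h1 /andP[h2 _]]; have := le_lt_trans h1 h2; rewrite ltxx.
have mfin2 : m [set z | (x < phi z <= y)%R] \is a fin_num.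
  by apply: fin_num_measure; apply: measurable_bool; apply: mf_and; [apply: mf_lt|apply: mf_le]; try exact: mf_cst.
rewrite /F e fineD// [X in _ <= X - _]addrC addrK -lee_fin fineK//.
have xyE : [set z : R | (x < z <= y)%R] = `]x, y]%classic by apply/seteqP; split => z /=; rewrite in_itv.
rewrite -[X in m X]/(phi @^-1` [set z : R | x < z <= y]) xyE rhoE// itvE.
have -> : `]x, y]%classic `&` `[a, b]%classic = `]x, y]%classic.
  apply/seteqP; split => z /=; first by case.
  move=> h; split=> //; move: h; rewrite !in_itv /= => /andP[h1 h2]; apply/andP; split; lra.
apply: (@le_trans _ _ (\int[lebesgue_measure]_(z in `]x, y]%classic) lo%:E)%E).
  rewrite integral_cst// [X in (_ <= _ * X)%E]lebesgue_measure_itv /= lte_fin EFinM.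
  case: ltP => h; first by rewrite EFinB.
  by apply: lee_wpmul2l; rewrite lee_fin ?(ltW lo0)// subr_le0.
apply: ge0_le_integral => //.
- by move=> z _; rewrite lee_fin ltW.
- by apply/measurable_EFinP; exact: measurable_funS mrho.
- move=> z /=; rewrite in_itv /= => /andP[h1 h2]; rewrite lee_fin.
  by have /rho_in/andP[] : a <= z <= b by apply/andP; split; lra.
Qed.

Lemma support_itv : m [set x | ~ (a <= phi x <= b)%R] = 0%E.
Proof.
rewrite -[X in m X]/(phi @^-1` [set x : R | ~ (a <= x <= b)]) rhoE.
  by rewrite (_ : _ `&` _ = set0) ?integral_set0//; apply/seteqP; split => x // [].
rewrite -[X in measurable X]/(~` [set x : R | (a <= x <= b)]) itvE; exact: measurableC.
Qed.

(** By [cdf_growth] the CDF is positive to the right of [a], and no mass sits at or below [a]. Level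
    0 must be excluded: its level set is unbounded below, and there [inf] is a default value. *)
Lemma cdf_pos : m [set x | F (phi x) <= 0] = 0%E.
Proof.
have mF : measurable [set x | F (phi x) <= 0].
  rewrite -[X in measurable X]/(phi @^-1` [set t | F t <= 0]) -[X in measurable X]setTI.
  apply: mphi => //; apply: measurable_bool; apply: mf_le; last exact: mf_cst.
  by apply: nondecreasing_measurable => // x y; exact: cdf_le.
apply/eqP; rewrite -measure_le0; apply: (@le_trans _ _ (m [set x | (phi x <= a)%R])).
  apply: le_measure; rewrite ?inE// => x /=; apply: contraTT; rewrite -!ltNge => ax.
  set t := Num.min (phi x) b; have at' : a < t by rewrite lt_min ax ab.
  apply: (@lt_le_trans _ _ (F t)); last by apply: cdf_le; rewrite ge_min lexx.
  have tb : t <= b by rewrite ge_min lexx orbT.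
  have := cdf_growth _ _ (lexx a) (ltW at') tb.
  have := cdf_in01 a; have := mulr_gt0 lo0 (_ : 0 < t - a); rewrite subr_gt0 => /(_ at'); lra.
rewrite -[X in m X]/(phi @^-1` [set z : R | z <= a]) rhoE.
  rewrite (_ : _ `&` _ = [set a]) ?integral_set1//.
  apply/seteqP; split => z /=; last by move=> ->; rewrite lexx (ltW ab).
  by case=> h1 /andP[h2 _]; apply/eqP; rewrite eq_le h1.
by apply: measurable_bool; apply: mf_le; [exact: measurable_id|exact: mf_cst].
Qed.

End density.

(** * Transfer to the auxiliary sample *)

Section transfer.
Context {R : realType} {K p : nat} {d d' : measure_display}.
Context {Omega : measurableType d} {Om : measurableType d'}.
Context (P : probability Omega R) (Q : probability Om R).
Context (S : Omega -> 'I_K) (X : Omega -> p.-tuple R) (s : 'I_K) (sigma : R).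
Context (W : Om -> p.-tuple R) (Z : Om -> R).
Hypothesis mX : measurable_fun setT X.
Hypothesis mS : measurable (evS S s).
Hypothesis S_gt0 : (0 < P (evS S s))%E.
Hypothesis mW : measurable_fun setT W.
Hypothesis mZ : measurable_fun setT Z.
Hypothesis sigma0 : 0 <= sigma.
Hypothesis law_W : forall B, measurable B -> Q (W @^-1` B) = condP P S s (X @^-1` B).
Hypothesis law_Z : forall B, measurable B -> Q (Z @^-1` B) =
  (((2 * sigma)^-1)%R%:E * lebesgue_measure (B `&` [set z | (- sigma <= z <= sigma)%R]))%E.

Let I := [set z : R | - sigma <= z <= sigma].

Let mI : measurable I.
Proof.
by apply: measurable_bool; apply: mf_and; apply: mf_le; try exact: mf_cst; exact: measurable_id.
Qed.

Let c_gt0 : 0 < (fine (P (evS S s)))^-1.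
Proof. by rewrite invr_gt0 fine_gt0// S_gt0 -ge0_fin_numE// fin_num_measure. Qed.

Lemma condE_law (psi : p.-tuple R -> \bar R) : measurable_fun setT psi -> (forall x, 0 <= psi x)%E ->
  condE P S s (fun om => psi (X om)) = (\int[law_of Q mW]_x psi x)%E.
Proof.
move=> mpsi psi0; rewrite integral_law//.
by rewrite /condE; apply: (integral_same_law P Q (evS S s) _ X W psi) => //; exact: ltW.
Qed.

Lemma noise_law (psi : R -> \bar R) : measurable_fun setT psi -> (forall x, 0 <= psi x)%E ->
  (((2 * sigma)^-1)%R%:E * \int[lebesgue_measure]_(z in I) psi z)%E = (\int[Q]_om psi (Z om))%E.
Proof.
move=> mpsi psi0; apply: (@integral_same_law R _ _ _ _ _ _ lebesgue_measure Q I _ id Z psi) => //.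
- by rewrite invr_ge0 mulr_ge0.
- by move=> B mB; rewrite setIC; exact: law_Z.
Qed.

(** Domination is required off a null set [A] of feature values and for noise in range;
    measurability is asked of [Psi], while the loss [h] is only nonnegative. *)
Lemma noisy_condE_le (A : set (p.-tuple R)) (h : Omega -> R -> \bar R) (Psi : p.-tuple R * R -> \bar R) :
  measurable A -> law_of Q mW A = 0%E ->
  (forall om z, 0 <= h om z)%E -> measurable_fun setT Psi -> (forall xz, 0 <= Psi xz)%E ->
  (forall om z, ~ A (X om) -> (- sigma <= z <= sigma)%R -> h om z <= Psi (X om, z))%E ->
  (condE P S s (fun om => ((2 * sigma)^-1)%R%:E * \int[lebesgue_measure]_(z in I) h om z)
   <= \int[Q]_om1 \int[Q]_om2 Psi (W om1, Z om2))%E.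
Proof.
move=> mA A0 h0 mPsi Psi0 hPsi.
have ci0 : (0 <= ((2 * sigma)^-1)%R%:E)%E by rewrite lee_fin invr_ge0 mulr_ge0.
pose psi x := (\int[Q]_om2 Psi (x, Z om2))%E.
have psi0 x : (0 <= psi x)%E by apply: integral_ge0.
have mslice x : measurable_fun setT (fun z => Psi (x, z)) by exact: measurableT_comp.
have psiE x : psi x = (\int[law_of Q mZ]_z Psi (x, z))%E by rewrite integral_law.
have mpsi : measurable_fun setT psi.
  by rewrite (funext psiE); apply: (measurable_fun_fubini_tonelli_F (m2 := law_of Q mZ)).
rewrite -[X in (_ <= X)%E]/(\int[Q]_om1 psi (W om1))%E -(integral_law Q mW)// -condE_law//.
apply: lee_wpmul2l; first by rewrite lee_fin ltW.
apply: (ge0_le_integral_off P (evS S s) (evS S s `&` X @^-1` A)) => //.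
- by apply: measurableI => //; rewrite -[X in measurable X]setTI; exact: mX.
- move: A0; rewrite -[X in X = _]/(Q (W @^-1` A)) law_W// /condP => /eqP.
  by rewrite mule_eq0 eqe gt_eqF//= => /eqP.
- by move=> om _; apply: mule_ge0 => //; apply: integral_ge0.
- by apply: (measurable_funTS); exact: (measurableT_comp mpsi mX).
- move=> om Sm nA; rewrite /psi -(noise_law (fun z => Psi (X om, z)))//; apply: lee_wpmul2l => //.
  by apply: ge0_le_integral_nomeas => // z Iz; apply: hPsi => // AX; apply: nA.
Qed.

End transfer.

(** * Domination of the loss at a fixed auxiliary outcome *)

Section pointwise_loss.
Context {R : realType} {K p : nat} {N : 'I_K -> nat} {f fstar : p.-tuple R -> 'I_K -> R}.
Context {d d' : measure_display} {Omega : measurableType d} {Om : measurableType d'}.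
Context {P : probability Omega R} {Q : probability Om R}.
Context {S : Omega -> 'I_K} {X : Omega -> p.-tuple R} {w : 'I_K -> R}.
Context {Xa : 'I_K -> nat -> Om -> p.-tuple R} {Za : 'I_K -> nat -> Om -> R} {Ua : 'I_K -> Om -> R}.
Context (sigma L q : R) (a b : 'I_K -> R) (mXa : forall s i, measurable_fun setT (Xa s i)).
Hypothesis N0 : forall s, (0 < N s)%N.
Hypothesis q1 : 1 <= q.
Hypothesis w0 : forall s, 0 <= w s.
Hypothesis w1 : \sum_(s < K) w s = 1.
Hypothesis L0 : 0 <= L.

Let F := @cdf_law R K p d' Om Q Xa mXa fstar.

Hypothesis FE : forall s, cdf_nu P S X fstar s = F s.
Hypothesis F_nd : forall s x y, x <= y -> F s x <= F s y.
Hypothesis F01 : forall s x, 0 <= F s x <= 1.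
Hypothesis F_lo : forall s x, x < a s -> F s x = 0.
Hypothesis F_hi : forall s x, b s <= x -> F s x = 1.
Hypothesis F_lip : forall s x y, a s <= x -> x <= y -> y <= b s -> y - x <= L * (F s y - F s x).

Variable om : Om.
Hypothesis hZ : forall s i, (i < 2 * N s)%N -> - sigma <= Za s i om <= sigma.
Hypothesis hU : forall s, 0 < Ua s om <= 1.
Hypothesis hT : forall s i, (i < 2 * N s)%N -> a s <= fstar (Xa s i om) s <= b s.

Let q0 : 0 < q. Proof. exact: lt_le_trans q1. Qed.

Let dev_le s x z : - sigma <= z <= sigma -> `|f x s + z - fstar x s| <= @dev R K p f fstar sigma s x.
Proof.
move=> hz; rewrite /dev addrAC (le_trans (ler_normD _ _))// lerD2l ler_norml.
by case/andP: hz => h1 h2; apply/andP.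
Qed.

(** With the almost sure facts assumed at the fixed outcome [om], the claim is deterministic:
    [quantile_point] in each group, [emp_rank_err] for the rank, and [powR_weighted_sum] to combine
    the groups. *)
Lemma pointwise_loss s x z : 0 < F s (fstar x s) -> - sigma <= z <= sigma ->
  powR `|Pihat w N f (fun s i => Xa s i om) (fun s i => Za s i om) (fun s => Ua s om) x s z
         - fstar0 P S X w fstar x s| q
  <= @majorant R K p N f d' Om Q Xa Za Ua mXa fstar sigma L q w s om x z.
Proof.
move=> V0 hz; set v := @rank_stat R K p N f d' Om Xa Za Ua s (f x s + z) om.
set V := F s (fstar x s).
have V01 : 0 < V <= 1 by rewrite V0; case/andP: (F01 s (fstar x s)).
have vE : v = emp_rank (fun i : 'I_(N s) => f (Xa s i om) s + Za s i om) (Ua s om) (f x s + z) by [].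
have v01 : 0 < v <= 1 by rewrite vE; exact: emp_rank_in01.
have N2 (i : 'I_(N s)) : (i < 2 * N s)%N by rewrite mul2n -addnn ltn_addr.
have err : powR `|v - V| q <= @test_err R K p N f d' Om Q Xa mXa fstar sigma q s x om.
  have h : `|v - V| <= (2 + rank_err (index_enum 'I_(N s)) (fun j : 'I_(N s) => fstar (Xa s j om) s)
      (fun j => @dev R K p f fstar sigma s (Xa s j om)) V (fstar x s) (@dev R K p f fstar sigma s x)) / (N s)%:R.
    rewrite vE; apply: emp_rank_err => //; first by case/andP: V01 => /ltW -> ->.
    - by move=> i; apply: dev_le; apply: hZ.
    - exact: dev_le.
  by apply: ge0_ler_powR; rewrite ?nnegrE ?(ltW q0)// (le_trans _ h).
pose y s' := @Ys R K p N f d' Om Xa Za s' om.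
pose G s' := ginv (fun t => (N s')%:R^-1 * \sum_(j < N s') ((y s' j <= t)%R)%:R) v.
have hG s' : powR `|G s' - ginv (F s') V| q <= powR 2 q *
    (\sum_(i < N s') @cell_weight R K p N f d' Om Q Xa Za mXa fstar sigma L q s' om i *
       ((cell_lo (y s') i <= v <= cell_hi (y s') i)%R)%:R
     + powR L q * powR `|v - V| q).
  apply: (quantile_point (y s') (@Ts R K p N d' Om Xa fstar s' om) (@Ds R K p N f d' Om Xa fstar sigma s' om)
    (F s') (a s') (b s') L q) => //.
  - exact: F_nd.
  - by move=> t /F_lo ->.
  - by move=> t /F_hi ->.
  - exact: F_lip.
  - by move=> i; apply: dev_le; apply: hZ; rewrite mul2n -addnn ltn_add2l.
  - by move=> i; apply: hT; rewrite mul2n -addnn ltn_add2l.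
have -> : Pihat w N f (fun s i => Xa s i om) (fun s i => Za s i om) (fun s => Ua s om) x s z
    - fstar0 P S X w fstar x s = \sum_(s' < K) w s' * (G s' - ginv (F s') V).
  rewrite -sumrB; apply: eq_bigr => s' _; rewrite mulrBr; congr (_ - w s' * _).
  by rewrite /V -!FE.
have s1 : powR `|\sum_(s' < K) w s' * (G s' - ginv (F s') V)| q
    <= powR (\sum_(s' < K) w s' * `|G s' - ginv (F s') V|) q.
  apply: ge0_ler_powR; rewrite ?nnegrE ?(ltW q0)//; first by apply: sumr_ge0 => s' _; rewrite mulr_ge0.
  apply: le_trans (ler_norm_sum _ _ _) _; apply: ler_sum => s' _.
  by rewrite normrM (ger0_norm (w0 _)).
apply: (le_trans s1); apply: (le_trans (powR_weighted_sum w _ q q1 w0 w1 _)) => //.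
rewrite /majorant /loss_cst mulrAC [X in _ <= X]mulrC; apply: ler_wpM2l; first exact: powR_ge0.
apply: (@le_trans _ _ (\sum_(s' < K) w s' * (powR 2 q *
    (\sum_(i < N s') @cell_weight R K p N f d' Om Q Xa Za mXa fstar sigma L q s' om i *
       ((cell_lo (y s') i <= v <= cell_hi (y s') i)%R)%:R
     + powR L q * powR `|v - V| q)))); first by apply: ler_sum => s' _; apply: ler_wpM2l.
rewrite (eq_bigr (fun s' => powR 2 q * (w s' * \sum_(i < N s') @cell_weight R K p N f d' Om Q Xa Za mXa fstar sigma L q s' om i *
       ((cell_lo (y s') i <= v <= cell_hi (y s') i)%R)%:R) + w s' * (powR 2 q * (powR L q * powR `|v - V| q)))); last first.
  by move=> s' _; ring.
rewrite big_split/= -mulr_sumr -mulr_suml w1 mul1r -mulrDr; apply: ler_wpM2l; first exact: powR_ge0.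
by rewrite lerD2l; apply: ler_wpM2l; rewrite ?powR_ge0.
Qed.

End pointwise_loss.

(** Let [y] be the root of [x]. If [y > a], then [y = y^(1-q) x], and [1 - q <= 0] gives
    [y <= a^(1-q) x]. *)
Lemma poweR_tangent {R : realType} (a q : R) (x : \bar R) : 0 < a -> 1 <= q -> (0 <= x)%E ->
  (poweR x q^-1 <= a%:E + (powR a (1 - q))%:E * x)%E.
Proof.
move=> a0 q1; have q0 : 0 < q by exact: lt_le_trans q1.
case: x => [x||] //; rewrite ?lee_fin => x0; last by rewrite gt0_muley ?lte_fin ?powR_gt0// addey// leey.
set y := powR x q^-1.
have y0 : 0 <= y by exact: powR_ge0.
have xE : x = powR y q by rewrite /y -powRrM mulVf ?gt_eqF// powRr1.
have [ya|ay] := leP y a; first by apply: (le_trans ya); rewrite lerDl mulr_ge0 ?powR_ge0.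
have yp : 0 < y by exact: lt_trans ay.
apply: (@le_trans _ _ (powR a (1 - q) * x)); last by rewrite lerDr ltW.
have e : y = powR y (1 - q) * x.
  by rewrite [in RHS]xE -powRD ?subrK ?powRr1//; rewrite (gt_eqF yp) implybT.
rewrite {1}e; apply: ler_wpM2r => //.
rewrite -opprB !powRN lef_pV2 ?posrE ?powR_gt0//.
  by apply: ge0_ler_powR; rewrite ?nnegrE ?subr_ge0// ltW.
by rewrite xE powR_gt0.
Qed.

Lemma risk_cst_ge0 {R : realType} {K : nat} (Lam L q : R) : 0 <= Lam -> 0 <= @risk_cst R K Lam L q.
Proof.
move=> Lam0; have ? := moment_cst_ge0 q; have ? := moment_cst_ge0 1.
by rewrite /risk_cst /loss_cst /cells_cst /rank_cst; nneg.
Qed.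

(** * From moments of order q to the expected norm *)

Section risk_bound.
Context {R : realType} {K p : nat} {N : 'I_K -> nat} {f fstar : p.-tuple R -> 'I_K -> R}.
Context {d d' : measure_display} {Omega : measurableType d} {Om : measurableType d'}.
Context {P : probability Omega R} {Q : probability Om R}.
Context {S : Omega -> 'I_K} {X : Omega -> p.-tuple R} {w : 'I_K -> R}.
Context {Xa : 'I_K -> nat -> Om -> p.-tuple R} {Za : 'I_K -> nat -> Om -> R} {Ua : 'I_K -> Om -> R}.
Context (lam_lo lam_hi : 'I_K -> R) (sigma Lam L q : R).
Hypothesis lam_lo0 : forall s, 0 < lam_lo s.
Hypothesis hLam : forall s, lam_hi s <= Lam.
Hypothesis Lam0 : 0 < Lam.
Hypothesis hL : forall s, (lam_lo s)^-1 <= L.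
Hypothesis L0 : 0 <= L.
Hypothesis q1 : 1 <= q.
Hypothesis mX : measurable_fun setT X.
Hypothesis mS : forall s, measurable (evS S s).
Hypothesis S_gt0 : forall s, (0 < P (evS S s))%E.
Hypothesis mfstar : forall s, measurable_fun setT (fun x => fstar x s).
Hypothesis w0 : forall s, 0 <= w s.
Hypothesis w1 : \sum_(s < K) w s = 1.
Hypothesis density : forall s, exists (a b : R) (rho : R -> R),
  a < b /\ measurable_fun setT rho /\
  (forall x, a <= x <= b -> lam_lo s <= rho x <= lam_hi s) /\
  (forall B : set R, measurable B ->
     (condP P S s [set om | B (fstar (X om) s)] =
      \int[lebesgue_measure]_(x in B `&` [set x | (a <= x <= b)%R]) (rho x)%:E)%E).
Hypothesis mf : forall s, measurable_fun setT (fun x => f x s).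
Hypothesis sigma0 : 0 < sigma.
Hypothesis N0 : forall s, (0 < N s)%N.
Hypothesis mXa : forall s i, measurable_fun setT (Xa s i).
Hypothesis mZa : forall s i, measurable_fun setT (Za s i).
Hypothesis mUa : forall s, measurable_fun setT (Ua s).
Hypothesis law_Xa : forall s i, (i < 2 * N s)%N -> forall B, measurable B ->
  Q (Xa s i @^-1` B) = condP P S s (X @^-1` B).
Hypothesis law_Za : forall s i, (i < 2 * N s)%N -> forall B, measurable B ->
  Q (Za s i @^-1` B) =
    (((2 * sigma)^-1)%R%:E * lebesgue_measure (B `&` [set z | (- sigma <= z <= sigma)%R]))%E.
Hypothesis law_Ua : forall s B, measurable B ->
  Q (Ua s @^-1` B) = lebesgue_measure (B `&` [set z | (0 <= z <= 1)%R]).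
Hypothesis indep : mutual_indep Q
  (fun i : aux_idx K => match i with
                        | inl (inl (s, j)) => (j < 2 * N s)%N
                        | inl (inr (s, j)) => (j < 2 * N s)%N
                        | inr _ => True end)
  (fun i : aux_idx K => match i with
                        | inl (inl (s, j)) => [set Xa s j @^-1` B | B in measurable]
                        | inl (inr (s, j)) => [set Za s j @^-1` B | B in measurable]
                        | inr s => [set Ua s @^-1` B | B in measurable] end).

Let N2 s : (0 < 2 * N s)%N. Proof. by rewrite muln_gt0 N0. Qed.
Let q0 : 0 < q. Proof. exact: lt_le_trans q1. Qed.

Let same_Xa s i : (i < 2 * N s)%N -> forall B, measurable B -> Q (Xa s i @^-1` B) = Q (Xa s 0 @^-1` B).
Proof. by move=> i2 B mB; rewrite !law_Xa. Qed.

Let same_Za s i : (i < 2 * N s)%N -> forall B, measurable B -> Q (Za s i @^-1` B) = Q (Za s 0 @^-1` B).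
Proof. by move=> i2 B mB; rewrite !law_Za. Qed.

Let mu s := law_of Q (mXa s 0).
Let F := @cdf_law R K p d' Om Q Xa mXa fstar.
Let rm := @risk_majorant R K p N f d' Om Q Xa Za Ua mXa fstar sigma L q w.

Let mu_cond s B : measurable B -> mu s B = condP P S s (X @^-1` B).
Proof. by move=> mB; rewrite -(law_Xa s 0 (N2 s) B mB). Qed.

Let mu_density s : exists (a b : R) (rho : R -> R),
  a < b /\ measurable_fun setT rho /\
  (forall x, a <= x <= b -> lam_lo s <= rho x <= lam_hi s) /\
  (forall B : set R, measurable B ->
     (mu s ((fun x => fstar x s) @^-1` B) =
      \int[lebesgue_measure]_(x in B `&` [set x | (a <= x <= b)%R]) (rho x)%:E)%E).
Proof.
have [a [b [rho [ab [mrho [hrho E]]]]]] := density s; exists a, b, rho; do 3!split=> //.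
move=> B mB; rewrite -E// mu_cond//; rewrite -[X in measurable X]setTI; exact: mfstar.
Qed.

Let mfle s t : measurable [set x | fstar x s <= t].
Proof. by apply: measurable_bool; apply: mf_le => //; exact: mf_cst. Qed.

Let FE s : cdf_nu P S X fstar s = F s.
Proof. by apply/funext => t; rewrite /F /cdf_law -[law_of _ _]/(mu s) mu_cond. Qed.

Let F_nd s x y : x <= y -> F s x <= F s y.
Proof. exact: (cdf_le (mu s) _ (mfstar s)). Qed.

Let F01 s x : 0 <= F s x <= 1.
Proof. exact: (cdf_in01 (mu s) _ (mfstar s)). Qed.

Let upper s (c e : R) : c <= e -> (mu s [set x | (c <= fstar x s <= e)%R] <= (Lam * (e - c))%:E)%E.
Proof.
move=> ce; have [a [b [rho [ab [mrho [hrho E]]]]]] := mu_density s.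
apply: le_trans (density_upper (mu s) _ _ _ _ _ rho (lam_lo0 s) ab mrho hrho E c e ce) _.
by rewrite lee_fin ler_wpM2r// subr_ge0.
Qed.

Let support s : exists ab : R * R,
  [/\ forall x, x < ab.1 -> F s x = 0, forall x, ab.2 <= x -> F s x = 1,
      forall x y, ab.1 <= x -> x <= y -> y <= ab.2 -> y - x <= L * (F s y - F s x),
      mu s [set x | ~ (ab.1 <= fstar x s <= ab.2)%R] = 0%E
    & mu s [set x | F s (fstar x s) <= 0] = 0%E].
Proof.
have [a [b [rho [ab [mrho [hrho E]]]]]] := mu_density s; exists (a, b); split=> /=.
- exact: (cdf_below (mu s) _ a b rho E).
- exact: (cdf_above (mu s) _ a b rho E).
- move=> x y ax xy yb.
  have := cdf_growth (mu s) _ _ _ a b rho (mfstar s) (lam_lo0 s) mrho hrho E x y ax xy yb.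
  rewrite -ler_pdivlMl ?lam_lo0// => /le_trans; apply; apply: ler_wpM2r => //.
  by rewrite subr_ge0; exact: F_nd.
- exact: (support_itv (mu s) _ a b rho E).
- exact: (cdf_pos (mu s) _ _ _ a b rho (mfstar s) (lam_lo0 s) ab mrho hrho E).
Qed.

Let I := [set z : R | - sigma <= z <= sigma].
(** The value 0 is left out: there the rank can vanish, and the quantile at level 0 is a default
    value. *)
Let U := [set u : R | 0 < u <= 1].

Let mI : measurable I.
Proof.
by apply: measurable_bool; apply: mf_and; apply: mf_le; try exact: mf_cst; exact: measurable_id.
Qed.

Let mU : measurable U.
Proof.
by apply: measurable_bool; apply: mf_and; [apply: mf_lt|apply: mf_le]; try exact: mf_cst; exact: measurable_id.
Qed.

Let ae_preimage {dT : measure_display} {T : measurableType dT} (W : Om -> T) (G : set T) :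
  measurable_fun setT W -> measurable G -> Q (W @^-1` (~` G)) = 0%E -> {ae Q, forall om, G (W om)}.
Proof.
move=> mW mG QG; exists (W @^-1` (~` G)); split=> //.
by rewrite -[X in measurable X]setTI; apply: mW => //; exact: measurableC.
Qed.

Let mcdf_pos s : measurable [set x | F s (fstar x s) <= 0].
Proof.
apply: measurable_bool; apply: mf_le; last exact: mf_cst.
apply: (measurableT_comp _ (mfstar s)).
by apply: nondecreasing_measurable => // x y; exact: F_nd.
Qed.

Let risk om' : \bar R := (\sum_(s < K) (w s)%:E *
  condE P S s (fun om =>
    ((2 * sigma)^-1)%R%:E *
    \int[lebesgue_measure]_(z in [set z | (- sigma <= z <= sigma)%R])
      (powR `| Pihat w N f (fun s i => Xa s i om') (fun s i => Za s i om')
                     (fun s => Ua s om') (X om) s z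
               - fstar0 P S X w fstar (X om) s | q)%:E))%E.

(** The finitely many noises, tie-breakers and true scores lie almost surely in the ranges that
    [pointwise_loss] requires; [cdf_pos] supplies the null set of test features. *)
Lemma risk_le_majorant : {ae Q, forall om', (risk om' <= rm om')%E}.
Proof.
have [ab hab] := choice support.
have aeZ : {ae Q, forall om, forall s (i : 'I_(2 * N s)), - sigma <= Za s i om <= sigma}.
  apply: filter_forall => s; apply: filter_forall => i; apply: (ae_preimage (Za s i) I) => //.
  rewrite law_Za//; last exact: measurableC.
  by rewrite setICl measure0 mule0.
have aeU : {ae Q, forall om, forall s, 0 < Ua s om <= 1}.
  apply: filter_forall => s; apply: (ae_preimage (Ua s) U) => //.
  rewrite law_Ua; last exact: measurableC.
  apply/eqP; rewrite -measure_le0 -(lebesgue_measure_set1 (0 : R)); apply: le_measure; rewrite ?inE.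
  - apply: measurableI; first exact: measurableC.
    by apply: measurable_bool; apply: mf_and; apply: mf_le; try exact: mf_cst; exact: measurable_id.
  - exact: measurable_set1.
  - move=> u /= [/negP]; rewrite negb_and -leNgt -ltNge => /orP[h|h] /andP[h0 h1].
      by apply/eqP; rewrite eq_le h h0.
    by move: (lt_le_trans h h1); rewrite ltxx.
have aeT : {ae Q, forall om, forall s (i : 'I_(2 * N s)), (ab s).1 <= fstar (Xa s i om) s <= (ab s).2}.
  apply: filter_forall => s; apply: filter_forall => i.
  have mG : measurable [set x | (ab s).1 <= fstar x s <= (ab s).2].
    by apply: measurable_bool; apply: mf_and; apply: mf_le; try exact: mf_cst; exact: mfstar.
  apply: (ae_preimage (Xa s i) _ _ mG) => //; rewrite same_Xa//; last exact: measurableC.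
  by have [_ _ _ h _] := hab s.
apply: filterS3 aeZ aeU aeT => om' hZ hU hT; apply: lee_sum => s _.
apply: lee_wpmul2l; first by rewrite lee_fin.
have [_ _ _ _ pos] := hab s.
apply: (noisy_condE_le P Q S X s sigma (Xa s 0) (Za s 0) mX (mS s) (S_gt0 s) (mXa s 0) (mZa s 0) (ltW sigma0)
  (law_Xa s 0 (N2 s)) (law_Za s 0 (N2 s)) [set x | F s (fstar x s) <= 0]
  (fun om z => (powR `| Pihat w N f (fun s i => Xa s i om') (fun s i => Za s i om')
                     (fun s => Ua s om') (X om) s z - fstar0 P S X w fstar (X om) s | q)%:E)
  (fun xz => (@majorant R K p N f d' Om Q Xa Za Ua mXa fstar sigma L q w s om' xz.1 xz.2)%:E)) => //.
- exact: majorant_measurable.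
- by move=> xz; rewrite lee_fin; exact: majorant_ge0.
- move=> om z /= /negP; rewrite -ltNge => V0 hz; rewrite lee_fin.
  apply: (pointwise_loss sigma L q (fun s => (ab s).1) (fun s => (ab s).2)) => //.
  + by move=> s' x; have [h _ _ _ _] := hab s'; exact: h.
  + by move=> s' x; have [_ h _ _ _] := hab s'; exact: h.
  + by move=> s' x y; have [_ _ h _ _] := hab s'; exact: h.
  + by move=> s' i hi; exact: (hZ s' (Ordinal hi)).
  + by move=> s' i hi; exact: (hT s' (Ordinal hi)).
Qed.

Let err s : \bar R := condE P S s (fun om => (powR `|f (X om) s - fstar (X om) s| q)%:E).

Let merr s : measurable_fun setT (fun x => powR `|f x s - fstar x s| q).
Proof. by apply: mf_pow; apply: mf_abs; apply: mf_D => //; exact: mf_N. Qed.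

Let err0 s : (0 <= err s)%E.
Proof.
rewrite /err /condE mule_ge0 ?lee_fin ?invr_ge0 ?fine_ge0//.
by apply: integral_ge0 => om _; rewrite lee_fin powR_ge0.
Qed.

Let dev_moment s : (\int[mu s]_x (powR (@dev R K p f fstar sigma s x) q)%:E
  <= (powR 2 q)%:E * (err s + (powR sigma q)%:E))%E.
Proof.
rewrite /err (condE_law P Q S X s (Xa s 0) mX (mS s) (S_gt0 s) (mXa s 0) (law_Xa s 0 (N2 s))
  (fun x => (powR `|f x s - fstar x s| q)%:E)) -/(mu s); last 2 first.
- by apply: mf_EFin.
- by move=> x; rewrite lee_fin powR_ge0.
have -> : (\int[mu s]_x (powR `|f x s - fstar x s| q)%:E + (powR sigma q)%:E
    = \int[mu s]_x (powR `|f x s - fstar x s| q)%:E + \int[mu s]_x (powR sigma q)%:E)%E.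
  by rewrite integral_cst// [X in (_ + _ * X)%E]probability_setT mule1.
rewrite -ge0_integralD//; last 2 first.
- by apply: mf_EFin.
- by rewrite lee_fin powR_ge0.
rewrite -ge0_integralZl_EFin ?powR_ge0//; last 2 first.
- by move=> x _; rewrite -EFinD lee_fin addr_ge0 ?powR_ge0.
- by apply: (emeasurable_funD (mf_EFin _ (merr s)) (measurable_cst _)).
apply: ge0_le_integral_nomeas => x _; first by rewrite lee_fin powR_ge0.
by rewrite -EFinD -EFinM lee_fin; apply: powRD_le => //; exact: ltW.
Qed.

Lemma risk_majorant_integral : (\int[Q]_om' rm om' <= (@risk_cst R K Lam L q)%:E *
  \sum_(s < K) (w s)%:E * ((powR (N s)%:R (- (q / 2)))%:E + (powR 2 q)%:E * (err s + (powR sigma q)%:E)))%E.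
Proof.
apply: (le_trans (risk_integral mf N0 mXa mZa mUa same_Xa same_Za law_Ua indep fstar sigma Lam L q mfstar
  (ltW sigma0) Lam0 q1 upper w w0 w1)).
apply: lee_wpmul2l; first by rewrite lee_fin; exact: (risk_cst_ge0 _ _ _ (ltW Lam0)).
apply: lee_sum => s _; apply: lee_wpmul2l; first by rewrite lee_fin.
by apply: leeD2l; exact: dev_moment.
Qed.

Lemma risk_root_integral (A : R) : (\sum_(s < K) (w s)%:E * err s = A%:E)%E ->
  (\int[Q]_om' poweR (risk om') q^-1 <= ((1 + @risk_cst R K Lam L q * powR 2 q)
     * (powR A q^-1 + sigma + powR (\sum_(s < K) w s * powR (N s)%:R (- (q / 2))) q^-1))%:E)%E.
Proof.
move=> hA; set n := \sum_(s < K) _; set rc := risk_cst _ _ _.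
have rc0 : 0 <= rc by exact: (risk_cst_ge0 _ _ _ (ltW Lam0)).
have A0 : 0 <= A by rewrite -lee_fin -hA; apply: sume_ge0 => s _; rewrite mule_ge0// lee_fin.
have n0 : 0 <= n by apply: sumr_ge0 => s _; rewrite mulr_ge0 ?powR_ge0.
have s0 : 0 < powR sigma q by exact: powR_gt0.
(* [a] balances the tangent inequality: [a^q = B], hence [a^(1-q) B = a]. It is positive because
   [sigma] is. *)
set B := A + powR sigma q + n; set a := powR B q^-1.
have B0 : 0 < B by rewrite /B; lra.
have a0 : 0 < a by exact: powR_gt0.
have aq : powR a q = B by rewrite /a -powRrM mulVf ?gt_eqF// powRr1// ltW.
have aB : powR a (1 - q) * B = a.
  by rewrite -aq -powRD ?subrK ?powRr1 ?(ltW a0)//; rewrite (gt_eqF a0) implybT.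
have rm0 om : (0 <= rm om)%E.
  exact: (risk_majorant_ge0 mf N0 mXa mZa mUa same_Xa same_Za indep fstar sigma L q mfstar w w0).
have mrm : measurable_fun setT rm.
  exact: (risk_majorant_measurable mf N0 mXa mZa mUa same_Xa same_Za indep fstar sigma L q mfstar w w0).
have aV0 : (0 <= (powR a (1 - q))%:E)%E by rewrite lee_fin powR_ge0.
have risk0 om : (0 <= risk om)%E.
  apply: sume_ge0 => s _; rewrite mule_ge0 ?lee_fin// /condE mule_ge0 ?lee_fin ?invr_ge0 ?fine_ge0//.
  apply: integral_ge0 => om' _; rewrite mule_ge0 ?lee_fin ?invr_ge0 ?mulr_ge0 ?(ltW sigma0)//.
  by apply: integral_ge0 => z _; rewrite lee_fin powR_ge0.
have [Nul [mNul Nul0 hNul]] := risk_le_majorant.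
apply: (@le_trans _ _ (\int[Q]_om' (a%:E + (powR a (1 - q))%:E * rm om'))%E).
  apply: (ge0_le_integral_off Q setT Nul) => //.
  - by move=> om _; exact: poweR_ge0.
  - by move=> om _; rewrite adde_ge0 ?mule_ge0// lee_fin ltW.
  - by apply: (emeasurable_funD (measurable_cst _) (measurable_funeM _ mrm)).
  - move=> om _ nNul; apply: (le_trans (poweR_tangent a q _ a0 q1 (risk0 om))).
    apply: leeD2l; apply: lee_wpmul2l => //.
    by apply: contrapT => h; apply: nNul; apply: hNul.
rewrite ge0_integralD//; last 3 first.
- by move=> om _; rewrite lee_fin ltW.
- by move=> om _; rewrite mule_ge0.
- exact: measurable_funeM.
rewrite integral_cst// [X in (_ * X + _)%E]probability_setT mule1 ge0_integralZl_EFin ?powR_ge0//.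
apply: (@le_trans _ _ (a%:E + (powR a (1 - q))%:E * (rc * (powR 2 q * B))%:E)%E).
  apply: leeD2l; apply: lee_wpmul2l => //; apply: (le_trans risk_majorant_integral).
  rewrite [X in (_ <= X)%E]EFinM; apply: lee_wpmul2l; first by rewrite lee_fin.
  have -> : (\sum_(s < K) (w s)%:E * ((powR (N s)%:R (- (q / 2)))%:E + (powR 2 q)%:E * (err s + (powR sigma q)%:E))
      = n%:E + (powR 2 q)%:E * (A%:E + (powR sigma q)%:E))%E.
    have e : (powR sigma q)%:E = (\sum_(s < K) (w s * powR sigma q)%:E)%E.
      by rewrite sumEFin -mulr_suml w1 mul1r.
    rewrite -hA /n -sumEFin [in RHS]e -[in RHS]big_split/= ge0_sume_distrr; last first.
      move=> s _; apply: adde_ge0; last by rewrite lee_fin mulr_ge0 ?powR_ge0.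
      by rewrite mule_ge0// lee_fin.
    rewrite -big_split/=; apply: eq_bigr => s _.
    rewrite EFinM [in RHS]EFinM -ge0_muleDr ?lee_fin ?powR_ge0// muleCA -ge0_muleDr ?lee_fin ?powR_ge0//.
    by rewrite mule_ge0 ?adde_ge0 ?lee_fin ?powR_ge0.
  rewrite -[X in (_ + _ * X)%E]EFinD -EFinM -[X in (X <= _)%E]EFinD lee_fin /B.
  have h2 : 1 <= powR 2 q by have := @ler_powR _ 2 (ler1n _ 2) 0 q (ltW q0); rewrite powRr0.
  by rewrite [X in _ <= X]mulrDr addrC lerD2l ler_peMl.
rewrite -EFinM -EFinD lee_fin.
have -> : a + powR a (1 - q) * (rc * (powR 2 q * B)) = (1 + rc * powR 2 q) * a.
  have -> : powR a (1 - q) * (rc * (powR 2 q * B)) = rc * powR 2 q * (powR a (1 - q) * B) by ring.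
  by rewrite aB; ring.
apply: ler_wpM2l; first by apply: addr_ge0 => //; apply: mulr_ge0 => //; exact: powR_ge0.
apply: (le_trans (powR_subadd _ _ _ q1 (addr_ge0 A0 (ltW s0)) n0)); rewrite lerD2r.
apply: (le_trans (powR_subadd _ _ _ q1 A0 (ltW s0))); rewrite lerD2l.
by rewrite -powRrM mulfV ?gt_eqF// powRr1// ltW.
Qed.

End risk_bound.

(** A negative [b] is exceeded on the whole group, an event of conditional probability 1, so every
    admissible [b] is nonnegative. *)
Lemma norminf_ge0 {R : realType} {d : measure_display} {Omega : measurableType d} (P : probability Omega R)
    {K p : nat} (S : Omega -> 'I_K) (X : Omega -> p.-tuple R) (w : 'I_K -> R) (g : p.-tuple R -> 'I_K -> R) :
  (forall s, measurable (evS S s)) -> (forall s, 0 < P (evS S s))%E -> (forall s, 0 <= w s) ->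
  (0 <= norminf P S X w g)%E.
Proof.
move=> mS S_gt0 w0; apply: sume_ge0 => s _; rewrite mule_ge0 ?lee_fin//.
apply: le_ereal_inf_tmp => _ [b /= hb <-]; rewrite lee_fin leNgt; apply/negP => b0.
move: hb; rewrite /condP (_ : _ `&` _ = evS S s); last first.
  by apply/seteqP; split => om /= => [[]//|hs]; split=> //; exact: lt_le_trans b0 _.
have Pfin : P (evS S s) \is a fin_num by exact: fin_num_measure.
rewrite -[X in (_ * X)%E](fineK Pfin) -EFinM mulVf; first by move=> /eqP; rewrite eqe oner_eq0.
by rewrite gt_eqF// fine_gt0// S_gt0 -ge0_fin_numE.
Qed.

Theorem theorem6 (R : realType) (K : nat) (lam_lo lam_hi : 'I_K -> R) (q : R) :
  (forall s, 0 < lam_lo s) -> (forall s, 0 < lam_hi s) -> 1 <= q ->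
  exists C : R, 0 < C /\
  forall (p : nat) (d : measure_display) (Omega : measurableType d)
    (P : probability Omega R)
    (X : Omega -> p.-tuple R) (S : Omega -> 'I_K) (Y : Omega -> R)
    (fstar : p.-tuple R -> 'I_K -> R) (w : 'I_K -> R),
    measurable_fun setT X -> (forall s, measurable (evS S s)) -> measurable_fun setT Y ->
    (forall s, (0 < P (evS S s))%E) ->
    is_cond_exp P S X Y fstar ->
    (forall s, 0 <= w s) -> \sum_(s < K) w s = 1 ->
    (* (A) *)
    (forall s (t : R), condP P S s [set om | fstar (X om) s = t] = 0%E) ->
    (forall s, (condE P S s (fun om => ((fstar (X om) s) ^+ 2)%:E) < +oo)%E) ->
    (* (B) *)
    (forall s, exists (a b : R) (rho : R -> R),
        a < b /\ measurable_fun setT rho /\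
        (forall x, a <= x <= b -> lam_lo s <= rho x <= lam_hi s) /\
        (forall B : set R, measurable B ->
           (condP P S s [set om | B (fstar (X om) s)] =
            \int[lebesgue_measure]_(x in B `&` [set x | (a <= x <= b)%R]) (rho x)%:E)%E)) ->
  forall (f : p.-tuple R -> 'I_K -> R) (sigma : R) (N : 'I_K -> nat),
    (forall s, measurable_fun setT (fun x => f x s)) ->
    0 < sigma < 1 ->
    (forall s, (0 < N s)%N) ->
  forall (d' : measure_display) (Omega' : measurableType d') (Q : probability Omega' R)
    (Xa : 'I_K -> nat -> Omega' -> p.-tuple R) (Za : 'I_K -> nat -> Omega' -> R)
    (Ua : 'I_K -> Omega' -> R),
    (forall s i, measurable_fun setT (Xa s i)) ->
    (forall s i, measurable_fun setT (Za s i)) ->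
    (forall s, measurable_fun setT (Ua s)) ->
    (* laws of the auxiliary variables *)
    (forall s i, (i < 2 * N s)%N -> forall B, measurable B ->
       Q (Xa s i @^-1` B) = condP P S s (X @^-1` B)) ->
    (forall s i, (i < 2 * N s)%N -> forall B, measurable B ->
       Q (Za s i @^-1` B) =
         (((2 * sigma)^-1)%R%:E * lebesgue_measure (B `&` [set z | (- sigma <= z <= sigma)%R]))%E) ->
    (forall s B, measurable B ->
       Q (Ua s @^-1` B) = lebesgue_measure (B `&` [set z | (0 <= z <= 1)%R])) ->
    (* mutual independence of all the auxiliary variables *)
    mutual_indep Q
      (fun i : aux_idx K => match i with
                            | inl (inl (s, j)) => (j < 2 * N s)%N
                            | inl (inr (s, j)) => (j < 2 * N s)%N
                            | inr _ => True end)
      (fun i : aux_idx K => match i with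
                            | inl (inl (s, j)) => [set Xa s j @^-1` B | B in measurable]
                            | inl (inr (s, j)) => [set Za s j @^-1` B | B in measurable]
                            | inr s => [set Ua s @^-1` B | B in measurable] end) ->
    let inner (om' : Omega') : \bar R :=
      (poweR (\sum_(s < K) (w s)%:E *
        condE P S s (fun om =>
          ((2 * sigma)^-1)%R%:E *
          \int[lebesgue_measure]_(z in [set z | (- sigma <= z <= sigma)%R])
            (powR `| Pihat w N f (fun s i => Xa s i om') (fun s i => Za s i om')
                           (fun s => Ua s om') (X om) s z
                     - fstar0 P S X w fstar (X om) s | q)%:E)) q^-1)%E in
    let g := fun x s => f x s - fstar x s in
    (\int[Q]_(om' in setT) inner om' <=
      C%:E * (normr P S X w g q%R
              + (if (1 < q)%R then
                   mine (poweR (normr P S X w g (q - 1)%R) (1 - q^-1)%R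
                          + (powR sigma (1 - q^-1))%:E)
                        (norminf P S X w g + sigma%:E)
                 else 0)
              + (\sum_(s < K) w s * powR (N s)%:R (- 2^-1)
                 + powR (\sum_(s < K) w s * powR (N s)%:R (- (q / 2))) q^-1
                 + sigma)%R%:E))%E.
Proof.
move=> lo0 hi0 q1; have q0 : 0 < q by exact: lt_le_trans q1.
(* These two constants serve all groups at once. The added 1 keeps [Lam] positive for an empty index
   set. [K] is carried by the index type of the two families, so the factor [K^q] in the constant is
   admissible. *)
pose Lam := 1 + \sum_(s < K) lam_hi s; pose L := \sum_(s < K) (lam_lo s)^-1.
have iL0 s : 0 <= (lam_lo s)^-1 by rewrite invr_ge0 ltW.
have Lam0 : 0 < Lam by rewrite ltr_pwDl// sumr_ge0// => s _; exact: ltW.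
have L0 : 0 <= L by rewrite sumr_ge0.
have hLam s : lam_hi s <= Lam.
  rewrite /Lam (bigD1 s)//= addrCA lerDl addr_ge0// sumr_ge0// => i _; exact: ltW.
have hL s : (lam_lo s)^-1 <= L by rewrite /L (bigD1 s)//= lerDl sumr_ge0.
have rc0 : 0 <= @risk_cst R K Lam L q by exact: (risk_cst_ge0 _ _ _ (ltW Lam0)).
have C0 : 0 < 1 + @risk_cst R K Lam L q * powR 2 q by rewrite ltr_pwDl// mulr_ge0// powR_ge0.
exists (1 + @risk_cst R K Lam L q * powR 2 q); split=> //.
move=> p d Omega P X S Y fstar w mX mS _ S_gt0 [mfstar _] w0 w1 _ _ density f sigma N mf /andP[sigma0 _] N0.
move=> d' Omega' Q Xa Za Ua mXa mZa mUa law_Xa law_Za law_Ua indep; cbv zeta; set g := fun _ _ => _ - _.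
set M := (if _ then _ else _).
(* Nonnegativity lets this term be added to the right-hand side of the bound from
   [risk_root_integral]. *)
have M0 : (0 <= M)%E.
  rewrite /M; case: ifP => // _; rewrite le_min; apply/andP; split.
    by rewrite adde_ge0 ?poweR_ge0// lee_fin powR_ge0.
  by rewrite adde_ge0 ?lee_fin ?(ltW sigma0)//; exact: norminf_ge0.
have n0 : 0 <= \sum_(s < K) w s * powR (N s)%:R (- 2^-1).
  by apply: sumr_ge0 => s _; rewrite mulr_ge0 ?powR_ge0.
have nq0 : 0 <= powR (\sum_(s < K) w s * powR (N s)%:R (- (q / 2))) q^-1 by exact: powR_ge0.
set rest := (_ + _ + sigma); have rest0 : 0 <= rest by rewrite /rest; have := sigma0; lra.
pose A := (\sum_(s < K) (w s)%:E * condE P S s (fun om => (powR `|g (X om) s| q)%:E))%E.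
have normrE : normr P S X w g q = poweR A q^-1 by [].
have A0 : (0 <= A)%E.
  apply: sume_ge0 => s _; rewrite mule_ge0 ?lee_fin// /condE mule_ge0 ?lee_fin ?invr_ge0 ?fine_ge0//.
  by apply: integral_ge0 => om _; rewrite lee_fin powR_ge0.
(* If [g] has infinite norm of order [q], the right-hand side is [+oo]. *)
have [Ay|Afin] := eqVneq A +oo%E.
  rewrite normrE Ay poweRyr ?invr_neq0 ?gt_eqF// -addeA addye; last first.
    by rewrite gt_eqF// (lt_le_trans (ltNyr 0))// adde_ge0// lee_fin.
  by rewrite gt0_muley ?lte_fin// leey.
have AE : A = (fine A)%:E by rewrite fineK// ge0_fin_numE// lt_neqAle Afin leey.
apply: (le_trans (risk_root_integral lam_lo lam_hi sigma Lam L q lo0 hLam Lam0 hL L0 q1 mX mS S_gt0 mfstar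
  w0 w1 density mf sigma0 N0 mXa mZa mUa law_Xa law_Za law_Ua indep _ AE)).
rewrite EFinM; apply: lee_wpmul2l; first by rewrite lee_fin ltW.
rewrite normrE AE poweR_EFin; apply: (@le_trans _ _ ((powR (fine A) q^-1)%:E + rest%:E)%E).
  by rewrite -EFinD lee_fin /rest; lra.
by rewrite -addeA; apply: leeD2l; rewrite leeDr.
Qed.
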